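(* Let $\alpha=0$. With $T$ and the waves $\varphi_h$ as in the context, there exists $h_0>0$ such that for all $0<h<h_0$ the wave $\varphi_h$ is a spectrally unstable stationary solution of $$iu_t+u_{xx}-u+2|u|^2u=-h$$ (with $2T$-periodic boundary conditions), with a single unstable eigenvalue, which is real: the operator $\mathcal J\mathcal L_h$ has exactly one eigenvalue (counted with multiplicity) with positive real part, and this eigenvalue is real.
   Context: Fix $a\in(1/\sqrt2,1)$, put $\kappa=\sqrt{2a^2-1}/a$ and $T=K(\kappa)/a$ ($K$ the complete elliptic integral of the first kind), and let $\varphi_0(x)=a\,\mathrm{dn}(ax,\kappa)$, the positive even $2T$-periodic solution of $\varphi''-\varphi+2\varphi^3=0$, decreasing on $[0,T]$. For $|h|$ small, $\varphi_h$ denotes the real even $2T$-periodic solution of $\varphi''-\varphi+2\varphi^3=-h$, decreasing on $[0,T]$, that depends smoothly on $h$ and equals $\varphi_0$ at $h=0$. Explicitly, $$\varphi_h(x)=\frac{\zeta_4(\zeta_3-\zeta_1)+\zeta_1(\zeta_4-\zeta_3)\,\mathrm{sn}^2(x/g,k)}{(\zeta_3-\zeta_1)+(\zeta_4-\zeta_3)\,\mathrm{sn}^2(x/g,k)},\quad k^2=\frac{(\zeta_4-\zeta_3)(\zeta_2-\zeta_1)}{(\zeta_4-\zeta_2)(\zeta_3-\zeta_1)},\quad g=\frac{2}{\sqrt{(\zeta_4-\zeta_2)(\zeta_3-\zeta_1)}},$$ where $\zeta_1<\zeta_2<\zeta_3<\zeta_4$ are the four real roots of $z^4-z^2+2hz+c$,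 with $c=c(h)$ near $c(0)=a^2(1-a^2)$ chosen so that the period is $2T$, i.e. $gK(k)=T$. The linearization about $\varphi_h$, with $u=\varphi_h+v_1+iv_2$, is $\partial_t\binom{v_1}{v_2}=\mathcal J\mathcal L_h\binom{v_1}{v_2}$ with $\mathcal J=\begin{pmatrix}0&1\\-1&0\end{pmatrix}$, $\mathcal L_h=\begin{pmatrix}\mathcal L_{+,h}&0\\0&\mathcal L_{-,h}\end{pmatrix}$, $\mathcal L_{+,h}=-\partial_x^2+1-6\varphi_h^2$, $\mathcal L_{-,h}=-\partial_x^2+1-2\varphi_h^2$, acting on $L^2_{per}[-T,T]^2$ with domain $H^2_{per}[-T,T]^2$. The wave is spectrally stable if $\mathcal J\mathcal L_h$ has no eigenvalue with positive real part, and spectrally unstable otherwise. *)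

(* Defs.v *)
From HB Require Import structures.
From mathcomp Require Import all_boot all_order all_algebra.
From mathcomp Require Import complex.
From mathcomp Require Import all_classical all_reals all_analysis.

Set Implicit Arguments.
Unset Strict Implicit.
Unset Printing Implicit Defensive.

Import Order.TTheory GRing.Theory Num.Theory.
Import numFieldNormedType.Exports.

Local Open Scope classical_set_scope.
Local Open Scope ring_scope.
Local Open Scope complex_scope.

Section elliptic.
Context {R : realType}.
Implicit Types k s u a x : R.

Definition elliptic_integrand k (t : R) : R :=
  (Num.sqrt (1 - k ^+ 2 * sin t ^+ 2))^-1.

(* Incomplete integral of the first kind, in terms of the modulus k (not the
   parameter m = k ^ 2). One of the two intervals is empty or a point, so that
   this is the integral oriented from 0 to s, whatever the sign of s. *)
Definition ellipticF s k : R :=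
  \int[lebesgue_measure]_(t in `[0, s]) elliptic_integrand k t
  - \int[lebesgue_measure]_(t in `[s, 0]) elliptic_integrand k t.

Definition ellipticK k : R := ellipticF (pi / 2) k.

(* Jacobi amplitude: for 0 <= k < 1, s |-> ellipticF s k is an increasing
   bijection of R, and this is its inverse. *)
Definition jacobi_am u k : R := xget 0 [set s | ellipticF s k = u].

Definition jacobi_dn u k : R :=
  Num.sqrt (1 - k ^+ 2 * sin (jacobi_am u k) ^+ 2).

Definition modulus a : R := Num.sqrt (2 * a ^+ 2 - 1) / a.

Definition half_period a : R := ellipticK (modulus a) / a.

Definition wave0 a x : R := a * jacobi_dn (a * x) (modulus a).

End elliptic.

Section waves.
Context {R : realType}.

Fixpoint class_C (V : normedModType R) (n : nat) (D : set V) (f : V -> R) :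
    Prop :=
  match n with
  | 0 => forall p, D p -> {for p, continuous f}
  | m.+1 => (forall p, D p -> differentiable f p) /\
            (forall v, class_C m D (fun p => 'D_v f p))
  end.

Definition smooth (V : normedModType R) (D : set V) (f : V -> R) : Prop :=
  forall n, class_C n D f.

Definition profile_equation (h : R) (f : R -> R) : Prop :=
  forall x, [/\ derivable f x 1, derivable (derive1 f) x 1 &
    derive1 (derive1 f) x - f x + 2 * f x ^+ 3 = - h].

(* phi h is the wave at the parameter h. Only small |h| matter; there these
   properties determine phi, by uniqueness of the smooth branch through wave0. *)
Definition wave_family (a : R) (phi : R -> R -> R) : Prop :=
  let T := half_period a in
  exists d : R, [/\ 0 < d,
    forall h, `|h| < d ->
      [/\ profile_equation h (phi h),
          forall x, phi h (- x) = phi h x,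
          forall x, phi h (x + 2 * T) = phi h x &
          {in `[0, T] &, {homo phi h : x y /~ x < y}}],
    smooth [set p : R * R | `|p.1| < d] (fun p => phi p.1 p.2) &
    phi 0 =1 wave0 a].

End waves.

Section forced_nls.
Context {R : realType}.

Definition Cderivable (f : R -> R[i]) (x : R) : Prop :=
  derivable (fun y => complex.Re (f y)) x 1 /\
  derivable (fun y => complex.Im (f y)) x 1.

Definition Cderive (f : R -> R[i]) (x : R) : R[i] :=
  derive1 (fun y => complex.Re (f y)) x +i* derive1 (fun y => complex.Im (f y)) x.

(* u t x is the value at time t and position x *)
Definition solves_forced_nls (h : R) (u : R -> R -> R[i]) : Prop :=
  forall t x, [/\ Cderivable (fun s => u s x) t, Cderivable (u t) x,
    Cderivable (Cderive (u t)) x &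
    'i%C * Cderive (fun s => u s x) t + Cderive (Cderive (u t)) x - u t x
      + 2 * `|u t x| ^+ 2 * u t x = - h%:C].

Definition periodic_stationary_solution (T h : R) (phi : R -> R) : Prop :=
  (forall x, phi (x + 2 * T) = phi x) /\
  solves_forced_nls h (fun _ x => (phi x)%:C).

End forced_nls.

Section linearization.
Context {R : realType}.

(* Classes modulo equality almost everywhere on [-T, T] are represented by
   functions on R, whose values outside [-T, T] are ignored. *)
Definition ae_eq_on (T : R) (E : Type) (v w : R -> E) : Prop :=
  {ae lebesgue_measure, forall x : R, x \in `[- T, T] -> v x = w x}.

(* f is the C^1 representative of an element of H^2_per[-T, T], and f2 is its
   (weak) second derivative: f and f1 = f' are absolutely continuous, f2 is
   in L^2(-T, T), and f and f' take the same values at both endpoints. *)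
Definition H2per (T : R) (f f2 : R -> R) : Prop :=
  exists f1 : R -> R,
  [/\ f2 \_ `[- T, T] \in Lfun lebesgue_measure 2%:E,
      forall x, x \in `[- T, T] ->
        f1 x = f1 (- T) + \int[lebesgue_measure]_(t in `[- T, x]) f2 t,
      forall x, x \in `[- T, T] ->
        f x = f (- T) + \int[lebesgue_measure]_(t in `[- T, x]) f1 t,
      f T = f (- T) &
      f1 T = f1 (- T)].

Definition H2per_vec (T : R) (v v2 : R -> 'cV[R[i]]_2) : Prop :=
  forall i,
    H2per T (fun x => complex.Re (v x i 0)) (fun x => complex.Re (v2 x i 0)) /\
    H2per T (fun x => complex.Im (v x i 0)) (fun x => complex.Im (v2 x i 0)).

(* In the next three definitions f2 and v2 stand for the second derivatives of
   f and v. *)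
Definition L_plus (phi : R -> R) (f f2 : R -> R[i]) (x : R) : R[i] :=
  - f2 x + f x - (6 * phi x ^+ 2)%:C * f x.

Definition L_minus (phi : R -> R) (f f2 : R -> R[i]) (x : R) : R[i] :=
  - f2 x + f x - (2 * phi x ^+ 2)%:C * f x.

Definition L_diag (phi : R -> R) (v v2 : R -> 'cV[R[i]]_2) (x : R) : 'cV[R[i]]_2 :=
  \col_i (if i == 0 then L_plus phi (fun y => v y 0 0) (fun y => v2 y 0 0) x
          else L_minus phi (fun y => v y 1 0) (fun y => v2 y 1 0) x).

Definition J_mx : 'M[R[i]]_2 :=
  \matrix_(i, j) ((i < j)%N%:R - (j < i)%N%:R).

(* Graph of the unbounded operator J L, complexified, with domain H^2_per. *)
Definition JL (T : R) (phi : R -> R) (v w : R -> 'cV[R[i]]_2) : Prop :=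
  exists v2, H2per_vec T v v2 /\
    ae_eq_on T w (fun x => J_mx *m L_diag phi v v2 x).

Definition is_eigenvalue (T : R) (phi : R -> R) (lam : R[i]) : Prop :=
  exists v, ~ ae_eq_on T v (fun=> 0) /\ JL T phi v (fun x => lam *: v x).

(* v is in the kernel of (J L - lam) ^ n, with its natural domain. *)
Fixpoint ker_pow (T : R) (phi : R -> R) (lam : R[i]) (n : nat)
    (v : R -> 'cV[R[i]]_2) : Prop :=
  match n with
  | 0 => ae_eq_on T v (fun=> 0)
  | m.+1 => exists w, JL T phi v (fun x => lam *: v x + w x) /\
                      ker_pow T phi lam m w
  end.

Definition generalized_eigenspace (T : R) (phi : R -> R) (lam : R[i])
    (v : R -> 'cV[R[i]]_2) : Prop :=
  exists n, ker_pow T phi lam n v.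

(* The generalized eigenspace has dimension m over the complex numbers: e is a
   basis of it. *)
Definition algebraic_multiplicity (T : R) (phi : R -> R) (lam : R[i]) (m : nat) : Prop :=
  exists e : 'I_m -> R -> 'cV[R[i]]_2,
  [/\ forall j, generalized_eigenspace T phi lam (e j),
      forall c : 'I_m -> R[i],
        ae_eq_on T (fun x => \sum_j c j *: e j x) (fun=> 0) -> forall j, c j = 0 &
      forall v, generalized_eigenspace T phi lam v ->
        exists c : 'I_m -> R[i], ae_eq_on T v (fun x => \sum_j c j *: e j x)].

Definition spectrally_stable (T : R) (phi : R -> R) : Prop :=
  ~ exists lam : R[i], is_eigenvalue T phi lam /\ 0 < complex.Re lam.

Definition spectrally_unstable (T : R) (phi : R -> R) : Prop :=
  ~ spectrally_stable T phi.

End linearization.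

(* Main.v *)
Require Import Defs.
From HB Require Import structures.
From mathcomp Require Import all_boot all_order all_algebra.
From mathcomp Require Import complex ring lra.
From mathcomp Require Import all_classical all_reals all_analysis.
From mathcomp Require Import measurable_realfun.

(* Write L+ = -d^2 + 1 - 6 phi^2 and L- = -d^2 + 1 - 2 phi^2 for the wave
   phi = phi_h > 0, and split all functions into even and odd parts, which turns
   periodicity on [-T, T] into Neumann and Dirichlet conditions on [0, T].
   - L- phi = h > 0, so Picone's identity with the positive function phi gives
     L- > 0.
   - phi' < 0 on (0, T) and L+ phi' = 0, so L+ >= 0 on odd functions.
   - At h = 0, phi_0^2 + c is an eigenfunction of L+ for each of the two roots of
     3 c^2 + 2 c + phi_0(0)^2 phi_0(T)^2 = 0: one is positive with eigenvalue -m < 0,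
     the other changes sign once, at x0, and has eigenvalue n > 0. By Picone's
     identity, for small h, L+ >= 0 on the even functions that vanish at x0.
   Since L- > 0, an eigenvalue of JL with positive real part is real, and two
   independent such eigenfunctions would be orthogonal for both forms, so that some
   combination vanishing at x0 would make L+ negative: there is at most one, and
   a Jordan block would force its eigenfunction to be L- isotropic.
   For existence, let D(la) be the determinant of the Neumann data at T of the two
   even solutions of JL u = la u. D(0) is the product of the Neumann data of
   L- (positive) and L+ (negative, by Sturm comparison with the functions above).
   For la large, D(la) > 0: it does not vanish when L+ is deformed to L-, and in
   the latter case the system is complex linear and D is the squared modulus of a
   complex number. The intermediate value theorem yields la > 0 with D(la) = 0. *)


Set Implicit Arguments.
Unset Strict Implicit.
Unset Printing Implicit Defensive.

Import Order.TTheory GRing.Theory Num.Theory.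
Import numFieldNormedType.Exports.
Local Open Scope classical_set_scope.
Local Open Scope ring_scope.

(** * Derivatives and Picone's inequality *)

(** At h = 0 the wave itself lies in the kernel of L-, so the positivity of L- has no margin uniform
    in h and cannot be obtained by perturbation. It is therefore derived exactly, Picone's
    inequality leaving the weight h / phi_h. Only L+ is compared with its value at h = 0: smallness
    of h enters through phi_h > 0 and 6 |phi_h^2 - phi_0^2| < n, m. The point condition u(x0) = 0
    does the work usually done by orthogonality to the negative direction of L+. It has codimension
    one, does not move with h, and makes the sign-changing eigenfunction usable as a comparison
    function: the pole of Picone's quotient at x0 is cancelled by the zero of u. No spectral theorem
    is invoked. Uniqueness rests on the symmetry and the signs of two quadratic forms, existence on
    an initial value problem solved by Picard iteration, with Lipschitz dependence on the
    coefficients. Both forms are nonnegative on odd functions, which excludes odd unstable modes, so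
    shooting is confined to even solutions. *)

Section calculus.
Context {R : realType}.
Implicit Types (f g F : R -> R) (x a b : R).

Lemma is_deriveD_fun x f g a b : is_derive x 1 f a -> is_derive x 1 g b ->
  is_derive x 1 (fun y => f y + g y) (a + b).
Proof. by move=> ? ?; exact: is_deriveD. Qed.

Lemma is_deriveN_fun x f a : is_derive x 1 f a -> is_derive x 1 (fun y => - f y) (- a).
Proof. by move=> ?; exact: is_deriveN. Qed.

Lemma is_deriveM_fun x f g a b : is_derive x 1 f a -> is_derive x 1 g b ->
  is_derive x 1 (fun y => f y * g y) (a * g x + f x * b).
Proof.
move=> fa gb; apply: (@is_derive_eq _ _ _ (f * g)%R x 1 _).
by rewrite /GRing.scale/= addrC [g x * a]mulrC.
Qed.

Lemma is_deriveV_fun x f a : f x != 0 -> is_derive x 1 f a ->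
  is_derive x 1 (fun y => (f y)^-1) (- a * (f x)^-2).
Proof.
move=> fx fa; have h := is_deriveV fx fa.
by apply: is_derive_eq; rewrite /GRing.scale/= mulNr mulrC mulNr.
Qed.

Lemma is_deriveX_fun x f a n : is_derive x 1 f a ->
  is_derive x 1 (fun y => f y ^+ n.+1) (n.+1%:R * f x ^+ n * a).
Proof.
move=> fa; have h := is_deriveX n.+1 fa.
have -> : (fun y => f y ^+ n.+1) = f ^+ n.+1.
  by apply/funext => y; rewrite fctE.
by apply: is_derive_eq; rewrite /GRing.scale/= .
Qed.

Lemma is_deriveC_fun x c : is_derive x (1:R) (fun _ : R => c : R) (0 : R).
Proof. exact: is_derive_cst. Qed.

Lemma is_deriveid_fun x : is_derive x (1:R) (fun y : R => y) (1:R).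
Proof. exact: is_derive_id. Qed.

Lemma is_derive_mull x c : is_derive x (1:R) ( *%R c : R -> R) c.
Proof.
by have := is_deriveM_fun (is_deriveC_fun x c) (is_deriveid_fun x); rewrite mul0r add0r mulr1.
Qed.

Lemma is_derive_comp_fun x f g a b : is_derive x 1 f a -> is_derive (f x) 1 g b ->
  is_derive x 1 (fun y => g (f y)) (a * b).
Proof.
move=> fa gb; have h := is_derive1_comp gb fa.
by apply: is_derive_eq; rewrite mulrC.
Qed.

Lemma is_derive_cont x f a : is_derive x 1 f a -> {for x, continuous f}.
Proof.
move=> [fa _]; apply: differentiable_continuous; exact/derivable1_diffP.
Qed.

Lemma is_derive_within f df a b :
  (forall x, a <= x <= b -> is_derive x 1 f (df x)) ->
  {within `[a, b], continuous f}.
Proof.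
move=> h; apply: derivable_within_continuous => x; rewrite in_itv/= => /h [].
by [].
Qed.



Lemma derive_ge0_le f df a b : a <= b ->
  (forall x, a < x < b -> is_derive x 1 f (df x)) ->
  {within `[a, b], continuous f} ->
  (forall x, a < x < b -> 0 <= df x) -> f a <= f b.
Proof.
move=> ab fdf cf df0.
have aab : a \in `[a, b] by rewrite in_itv/= lexx.
have bab : b \in `[a, b] by rewrite in_itv/= lexx ab.
apply: (@ger0_derive1_le_cc _ f a b) => // x; rewrite in_itv/= => xab.
- by have [] := fdf _ xab.
- by rewrite derive1E (@derive_val _ _ _ _ _ _ _ (fdf _ xab)) df0.
Qed.

Lemma derive_gt0_lt f df a b : a < b ->
  (forall x, a < x < b -> is_derive x 1 f (df x)) ->
  {within `[a, b], continuous f} ->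
  (forall x, a < x < b -> 0 < df x) -> f a < f b.
Proof.
move=> ab fdf cf df0.
have aab : a \in `[a, b] by rewrite in_itv/= lexx ltW.
have bab : b \in `[a, b] by rewrite in_itv/= lexx ltW.
apply: (@gtr0_derive1_lt_cc _ f a b) => // x; rewrite in_itv/= => xab.
- by have [] := fdf _ xab.
- by rewrite derive1E (@derive_val _ _ _ _ _ _ _ (fdf _ xab)) df0.
Qed.

Lemma derive_eq0_eq f a b : a <= b ->
  (forall x, a <= x <= b -> is_derive x 1 f 0) -> f a = f b.
Proof.
move=> ab f0; have cf := is_derive_within f0.
have [c _] := @MVT_segment _ f (fun=> 0) a b ab
  (fun x hx => f0 x (subset_itv_oo_cc hx)) cf.
by rewrite mul0r => /eqP; rewrite subr_eq0 => /eqP.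
Qed.

(** The slope function, completed by [a] at [x], is continuous there. Since the factorization holds
    for every [y], a factor [y - x] can be cancelled algebraically where two functions vanish
    together. *)
Lemma caratheodory f x a : is_derive x 1 f a ->
  exists q : R -> R, [/\ {for x, continuous q}, q x = a &
    forall y, f y = f x + q y * (y - x)].
Proof.
move=> [dfx vfx].
exists (fun y => if y == x then a else (f y - f x) / (y - x)); split.
- move: dfx; rewrite /derivable => /cvg_ex[l hl].
  have la : l = a.
    by rewrite -vfx /derive; apply/esym/cvg_lim => //; exact: hl.
  subst l.
  apply/cvgrPdist_lt => e e0; rewrite eqxx.
  move/cvgrPdist_lt : hl => /(_ e e0); rewrite near_withinE => -[d /= d0 hd].
  exists d => //= y; rewrite /ball_/= distrC => xy.
  have [_|yx] := eqVneq y x; first by rewrite subrr normr0.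
  have := hd (y - x); rewrite /ball_/= sub0r normrN => /(_ xy).
  rewrite subr_eq0 => /(_ yx) /=.
  by rewrite /GRing.scale/= mulr1 subrK mulrC.
- by rewrite eqxx.
- move=> y; have [->|yx] := eqVneq y x; first by rewrite subrr mulr0 addr0.
  by rewrite divfK ?subr_eq0// addrC subrK.
Qed.

(* Makes f^2 chi' / chi continuous at x: at a common simple zero of f and chi, the
   junk value [0] of this quotient is also its limit. *)
Definition regular_end f (chi chi1 : R -> R) x :=
  chi x != 0 \/ [/\ f x = 0, chi x = 0 & chi1 x != 0].

(** At a common zero both functions factor through [y - x]: the quotient becomes
    [q y ^+ 2 * (y - x) * chi1 y / p y], where [p x = chi1 x] is nonzero. *)
Lemma picone_term_cont f (f1 : R) (chi chi1 : R -> R) x :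
  is_derive x 1 f f1 -> is_derive x 1 chi (chi1 x) -> {for x, continuous chi1} ->
  regular_end f chi chi1 x ->
  {for x, continuous (fun y => f y ^+ 2 * chi1 y / chi y)}.
Proof.
move=> df dchi cchi1 [chix|[fx chix chi1x]].
  have cf := is_derive_cont df; have cchi := is_derive_cont dchi.
  apply: continuousM; last exact: continuousV.
  apply: continuousM; last exact: cchi1.
  exact: (continuousM cf cf).
have [q [cq qx fq]] := caratheodory df; have [p [cp px chip]] := caratheodory dchi.
have -> : (fun y => f y ^+ 2 * chi1 y / chi y) =
          (fun y => q y ^+ 2 * (y - x) * chi1 y / p y).
  apply/funext => y; rewrite fq chip fx chix !add0r.
  have [->|yx] := eqVneq y x; first by rewrite subrr !(mulr0,mul0r,expr0n).
  have yx0 : y - x != 0 by rewrite subr_eq0.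
  have -> : (p y * (y - x))^-1 = (y - x)^-1 * (p y)^-1 by rewrite invfM mulrC.
  by rewrite exprMn [(y - x) ^+ 2]expr2; set z := (p y)^-1; field.
apply: continuousM; last by apply: continuousV => //; rewrite px.
apply: continuousM; last exact: cchi1.
apply: continuousM; first exact: (continuousM cq cq).
by apply: continuousB; [exact: cvg_id|exact: cvg_cst].
Qed.

End calculus.

Ltac deriv_step := first
  [ eassumption
  | apply: is_deriveC_fun
  | lazymatch goal with
    | |- is_derive _ _ (fun y => @?f y ^+ _) _ => eapply is_deriveX_fun
    | |- is_derive _ _ (fun y => @?f y + @?g y) _ => eapply is_deriveD_fun
    | |- is_derive _ _ (fun y => - @?f y) _ => eapply is_deriveN_fun
    | |- is_derive _ _ (fun y => @?f y * @?g y) _ => eapply is_deriveM_fun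
    | |- is_derive _ _ (fun y => (@?f y)^-1) _ => eapply is_deriveV_fun
    end
  | apply: is_deriveid_fun
  | apply: is_derive_mull ].
Ltac deriv := eapply is_derive_eq; [repeat deriv_step|]; rewrite /=.

Section picone.
Context {R : realType}.
Implicit Types (f F chi W Phi : R -> R) (x : R).

(** Here f'' = W f - F, chi'' = W chi, and Phi is a primitive of f F. The derivative of f f' - f^2
    chi'/chi + Phi is the square (f' - f chi'/chi)^2. When the end terms vanish, this says that the
    integral of f F, the quadratic form of -d^2 + W at f, is nonnegative. *)
Lemma picone f (f1 : R -> R) F chi (chi1 : R -> R) W Phi (a b : R) : a <= b ->
  (forall x, a <= x <= b -> [/\ is_derive x 1 f (f1 x),
     is_derive x 1 f1 (W x * f x - F x), is_derive x 1 chi (chi1 x),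
     is_derive x 1 chi1 (W x * chi x) & is_derive x 1 Phi (f x * F x)]) ->
  (forall x, a < x < b -> chi x != 0) ->
  regular_end f chi chi1 a -> regular_end f chi chi1 b ->
  (f b ^+ 2 * chi1 b / chi b - f b * f1 b) -
  (f a ^+ 2 * chi1 a / chi a - f a * f1 a) <= Phi b - Phi a.
Proof.
move=> ab H chi0 ra rb.
pose r x := f x ^+ 2 * chi1 x / chi x.
pose G x := f x * f1 x - r x + Phi x.
suff : G a <= G b by rewrite /G /r; lra.
have reg x : a <= x <= b -> regular_end f chi chi1 x.
  move=> /andP[]; rewrite le_eqVlt => /predU1P[<- //|ax].
  rewrite le_eqVlt => /predU1P[-> //|xb]; left.
  by apply: chi0; rewrite ax xb.
apply: (@derive_ge0_le _ G (fun x => (f1 x - f x * chi1 x / chi x) ^+ 2)) => //.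
- move=> x xab; have /H[? ? ? ? ?] : a <= x <= b by case/andP: xab => /ltW-> /ltW->.
  have chix := chi0 x xab.
  rewrite /G /r; deriv.
  by field.
- apply: continuous_in_subspaceT => x; rewrite inE/= in_itv/= => xab.
  have [df df1 dchi dchi1 dPhi] := H x xab.
  apply: (@continuousD _ _ _ (fun x => f x * f1 x - r x) Phi); last first.
    exact: is_derive_cont dPhi.
  apply: (@continuousB _ _ _ (fun x => f x * f1 x) r).
    by apply: (@continuousM _ _ f f1); [exact: is_derive_cont df|exact: is_derive_cont df1].
  apply: picone_term_cont df dchi (is_derive_cont dchi1) (reg _ xab).
- by move=> x _; exact: sqr_ge0.
Qed.

End picone.

(** * Continuous functions and their primitives *)

Section continuity.
Context {R : realType}.
Implicit Types f g : R -> R.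

Lemma contD f g : continuous f -> continuous g -> continuous (fun x => f x + g x).
Proof. by move=> cf cg x; exact: (continuousD (cf x) (cg x)). Qed.

Lemma contN f : continuous f -> continuous (fun x => - f x).
Proof. by move=> cf x; exact: (continuousN (cf x)). Qed.

Lemma contM f g : continuous f -> continuous g -> continuous (fun x => f x * g x).
Proof. by move=> cf cg x; exact: (continuousM (cf x) (cg x)). Qed.

Lemma contX f n : continuous f -> continuous (fun x => f x ^+ n).
Proof.
move=> cf; elim: n => [|n ih].
  by rewrite (_ : (fun x => f x ^+ 0) = (fun=> 1)); [move=> x; exact: cvg_cst|].
rewrite (_ : (fun x => f x ^+ n.+1) = (fun x => f x * f x ^+ n)).
  exact: contM.
by apply/funext => x; rewrite exprS.
Qed.

Lemma contC (c : R) : continuous (fun _ : R => c).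
Proof. by move=> x; exact: cvg_cst. Qed.

Lemma contI : continuous (fun x : R => x).
Proof. by move=> x; exact: cvg_id. Qed.

Lemma contMid c : continuous ( *%R c : R -> R).
Proof. by apply: contM; [exact: contC|exact: contI]. Qed.

Lemma cont_comp f g : continuous f -> continuous g -> continuous (fun x => g (f x)).
Proof. by move=> cf cg x; apply: (continuous_comp (cf x)); exact: cg. Qed.

Lemma is_derive_continuous f (f' : R -> R) : (forall x : R, is_derive x 1 f (f' x)) -> continuous f.
Proof. by move=> h x; exact: is_derive_cont (h x). Qed.

Lemma cont_sum (I : Type) (s : seq I) (F : I -> R -> R) :
  (forall i, continuous (F i)) -> continuous (fun x => \sum_(i <- s) F i x).
Proof.
move=> cF; elim: s => [|i s ih].
  by rewrite (_ : (fun x => _) = (fun=> 0)); [exact: contC|apply/funext => x; rewrite big_nil].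
rewrite (_ : (fun x => _) = (fun x => F i x + \sum_(j <- s) F j x)).
  exact: contD.
by apply/funext => x; rewrite big_cons.
Qed.

End continuity.

Ltac cont_step := first
  [ match goal with H : continuous ?f |- continuous ?f => exact H end
  | lazymatch goal with
    | |- continuous (fun y => @?f y + @?g y) => eapply contD
    | |- continuous (fun y => - @?f y) => eapply contN
    | |- continuous (fun y => @?f y ^+ _) => eapply contX
    | |- continuous (fun y => @?f y * @?g y) => eapply contM
    end
  | exact: contC
  | exact: contI
  | exact: contMid
  | assumption ].
Ltac cont := repeat cont_step.

Section primitive.
Context {R : realType}.
Implicit Types (f F G : R -> R) (a b x : R).

Lemma derive_unique f F G a b : a <= b ->
  (forall x, a <= x <= b -> is_derive x 1 F (f x)) ->
  (forall x, a <= x <= b -> is_derive x 1 G (f x)) ->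
  F b - F a = G b - G a.
Proof.
move=> ab hF hG.
have h x : a <= x <= b -> is_derive x 1 (fun y => F y - G y) 0.
  by move=> xab; have := hF x xab; have := hG x xab => ? ?; deriv; ring.
by have := derive_eq0_eq ab h => /=; lra.
Qed.

Lemma cont_integrable f a b : continuous f ->
  lebesgue_measure.-integrable `[a, b] (EFin \o f).
Proof.
move=> cf; apply: continuous_compact_integrable; first exact: segment_compact.
exact: continuous_subspaceT.
Qed.

Lemma integral_is_derive f a x : continuous f -> a < x ->
  is_derive x 1 (fun y => \int[lebesgue_measure]_(t in `[a, y]) f t) (f x).
Proof.
move=> cf ax.
have xx : x < x + 1 by rewrite ltrDl.
have [d v] := continuous_FTC1_closed xx (cont_integrable a (x + 1) cf) ax (cf x).
by apply: (DeriveDef d); rewrite -derive1E; exact: v.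
Qed.

Lemma primitive_exists f : continuous f ->
  exists F, F 0 = 0 /\ forall x, is_derive x 1 F (f x).
Proof.
move=> cf.
(* The integral starting at -a is differentiable only to the right of -a. The functions [P a],
   normalized at 0, agree where they overlap, so the base point may depend on [x]. *)
pose I a x := \int[lebesgue_measure]_(t in `[a, x]) f t.
pose P a x := I (- a) x - I (- a) 0.
have dP a x : - a < x -> is_derive x 1 (P a) (f x).
  move=> ax; have := integral_is_derive cf ax => ?; rewrite /P /I; deriv; ring.
have P0 a : P a 0 = 0 by rewrite /P subrr.
have PP a b x : `|x| < a -> `|x| < b -> P a x = P b x.
  rewrite !ltr_norml => /andP[xa xa'] /andP[xb xb'].
  have [x0|x0] := leP 0 x.
    have := @derive_unique f (P a) (P b) 0 x x0.
    rewrite !P0 !subr0; apply=> y /andP[y0 _]; apply: dP; lra.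
  have := @derive_unique f (P a) (P b) x 0 (ltW x0).
  rewrite !P0 !sub0r => h; apply: oppr_inj; apply: h => y /andP[yx _]; apply: dP; lra.
exists (fun x => P (`|x| + 1) x); split; first exact: P0.
move=> x; apply: (@near_eq_is_derive _ _ _ (P (`|x| + 2))).
- near=> y.
  have xy : `|y| < `|x| + 1.
    have : `|y - x| < 1 by near: y; exists 1 => //= z /=; rewrite distrC.
    by have := ler_normD x (y - x); rewrite addrC subrK => h1 h2; lra.
  by apply: PP; lra.
- apply: dP; have := ler_norm (- x); rewrite normrN; lra.
Unshelve. all: by end_near. Qed.

(** Normalized at 0 and covering both sides of it; it is unique for continuous [f], so identities
    between primitives are proved by differentiation. *)
Definition prim f : R -> R :=
  xget (fun=> 0) [set F | F 0 = 0 /\ forall x, is_derive x 1 F (f x)].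

Lemma primP f : continuous f -> prim f 0 = 0 /\ forall x, is_derive x 1 (prim f) (f x).
Proof.
move=> /primitive_exists[F hF]; rewrite /prim.
by case: xgetP => [G _ //|/(_ F)].
Qed.

Lemma prim0 f : continuous f -> prim f 0 = 0.
Proof. by move=> /primP[]. Qed.

Lemma prim_is_derive f x : continuous f -> is_derive x 1 (prim f) (f x).
Proof. by move=> /primP[_]. Qed.

Lemma prim_cont f : continuous f -> continuous (prim f).
Proof. by move=> cf; apply: (@is_derive_continuous _ _ f) => x; exact: prim_is_derive. Qed.

Lemma prim_unique f F : continuous f -> F 0 = 0 ->
  (forall x, is_derive x 1 F (f x)) -> F = prim f.
Proof.
move=> cf F0 dF; apply/funext => x.
have dP y := prim_is_derive y cf.
have [x0|x0] := leP 0 x.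
  by have := @derive_unique f F (prim f) 0 x x0 (fun y _ => dF y) (fun y _ => dP y);
    rewrite F0 prim0// !subr0.
have := @derive_unique f F (prim f) x 0 (ltW x0) (fun y _ => dF y) (fun y _ => dP y).
by rewrite F0 prim0// !sub0r => /oppr_inj.
Qed.

Lemma primD f g : continuous f -> continuous g ->
  prim (fun x => f x + g x) = (fun x => prim f x + prim g x).
Proof.
move=> cf cg; apply/esym/prim_unique; first cont.
  by rewrite !prim0// addr0.
by move=> x; have := prim_is_derive x cf; have := prim_is_derive x cg => ? ?; deriv.
Qed.

Lemma primZ c f : continuous f -> prim (fun x => c * f x) = (fun x => c * prim f x).
Proof.
move=> cf; apply/esym/prim_unique; first cont.
  by rewrite !prim0// mulr0.
by move=> x; have := prim_is_derive x cf => ?; deriv; ring.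
Qed.

Lemma primB f g : continuous f -> continuous g ->
  prim (fun x => f x - g x) = (fun x => prim f x - prim g x).
Proof.
move=> cf cg; apply/esym/prim_unique; first cont.
  by rewrite !prim0// subrr.
by move=> x; have := prim_is_derive x cf; have := prim_is_derive x cg => ? ?; deriv.
Qed.

Lemma cont_opp f : continuous f -> continuous (fun x => f (- x)).
Proof. by move=> cf; apply: (@cont_comp _ (fun x => - x)) => //; apply: contN; exact: contI. Qed.

Lemma is_derive_opp f (d x : R) : is_derive (- x) 1 f d ->
  is_derive x 1 (fun y => f (- y)) (- d).
Proof.
move=> df; have h : is_derive x (1:R) (fun y : R => - y) (-1) by deriv.
by have := is_derive_comp_fun h df; rewrite mulN1r.
Qed.

Lemma prim_opp f : continuous f -> prim (fun x => f (- x)) = (fun x => - prim f (- x)).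
Proof.
move=> cf; apply/esym/prim_unique; first exact: cont_opp.
  by rewrite oppr0 prim0// oppr0.
move=> x; have ? := is_derive_opp (prim_is_derive (- x) cf).
by deriv; rewrite opprK.
Qed.

Lemma integral_prim f a b : continuous f -> a <= b ->
  \int[lebesgue_measure]_(t in `[a, b]) f t = prim f b - prim f a.
Proof.
move=> cf; rewrite le_eqVlt => /predU1P[<-|ab].
  by rewrite set_itv1 Rintegral_set1 subrr.
have dP y := prim_is_derive y cf.
rewrite /Rintegral (@continuous_FTC2 _ f (prim f))//.
- exact: continuous_subspaceT.
- split => [x _||]; first by have [] := dP x.
    apply: cvg_at_right_filter; exact: prim_cont.
  apply: cvg_at_left_filter; exact: prim_cont.
- by move=> x _; rewrite derive1E (@derive_val _ _ _ _ _ _ _ (dP x)).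
Qed.

End primitive.

(** * Linear second order systems *)

Section weight.
Context {R : realType}.
Variables (K : R).
Hypothesis K1 : 1 <= K.

Definition weight (x : R) : R := expR (K * x) + expR (- (K * x)).

Lemma weight_ge1 x : 1 <= weight x.
Proof.
rewrite /weight; have [x0|x0] := leP 0 (K * x).
  have := expR_ge1Dx (K * x); have := expR_ge0 (- (K * x)); lra.
have := expR_ge1Dx (- (K * x)); have := expR_ge0 (K * x); lra.
Qed.

Lemma weight_even x : weight (- x) = weight x.
Proof. by rewrite /weight mulrN opprK addrC. Qed.

Lemma weight_gt0 x : 0 < weight x.
Proof. exact: lt_le_trans (weight_ge1 x). Qed.

Lemma weight_gex x : `|x| <= weight x.
Proof.
have h1 := expR_ge1Dx (K * x); have h2 := expR_ge1Dx (- (K * x)).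
have h3 := expR_ge0 (K * x); have h4 := expR_ge0 (- (K * x)).
rewrite /weight; have [x0|x0] := ger0P x.
  by have : x <= K * x by [rewrite ler_peMl]; lra.
have : - x <= K * - x by rewrite ler_peMl// oppr_ge0 ltW.
by rewrite mulrN; lra.
Qed.

Let is_derive_expK (c x : R) : is_derive x 1 (fun y => expR (c * y)) (c * expR (c * x)).
Proof.
have h : is_derive x 1 (fun y : R => c * y) c by deriv; ring.
exact: is_derive_comp_fun h (is_derive_expR _).
Qed.

Lemma weight_cont : continuous weight.
Proof.
apply: contD.
  by apply: (@is_derive_continuous _ _ (fun x => K * expR (K * x))) => x.
rewrite (_ : (fun x => _) = (fun x => expR (- K * x))); last first.
  by apply/funext => x; rewrite mulNr.
by apply: (@is_derive_continuous _ _ (fun x => - K * expR (- K * x))) => x.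
Qed.

(* The weight e^(Kx) + e^(-Kx) makes integration a contraction of factor 1/K,
   which replaces the factorial bounds of Picard iteration. *)
Lemma prim_weight (f : R -> R) (c x : R) : continuous f -> (forall y, `|f y| <= c * weight y) ->
  `|prim f x| <= c / K * weight x.
Proof.
move=> cf fw.
have K0 : 0 < K by apply: lt_le_trans K1.
(* [s] is twice sinh(K y): its derivative is [K * weight] and its modulus is at most [weight]. The
   bound follows because c/K s + prim f and c/K s - prim f are nondecreasing. *)
pose s y := expR (K * y) - expR (- K * y).
have ds (y : R) : is_derive y 1 s (K * weight y).
  have ? := is_derive_expK K y; have ? := is_derive_expK (- K) y.
  rewrite /s; deriv; rewrite /weight -(mulNr K y); ring.
have s0 : s 0 = 0 by rewrite /s !mulr0 subrr.
have c0 : 0 <= c.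
  have := fw 0; have := normr_ge0 (f 0); have := weight_gt0 0 => w0 f0 h.
  by rewrite -(pmulr_lge0 _ w0); exact: le_trans h.
have sle : `|s x| <= weight x.
  rewrite /s /weight mulNr; have := expR_ge0 (K * x); have := expR_ge0 (- (K * x)).
  by rewrite ler_norml => ? ?; apply/andP; split; lra.
apply: (@le_trans _ _ (c / K * `|s x|)); last first.
  by apply: ler_wpM2l => //; rewrite divr_ge0// ltW.
have main (e : R) : `|e| <= 1 -> forall a b, a <= b ->
    c / K * s a - e * prim f a <= c / K * s b - e * prim f b.
  move=> e1 a b ab.
  have d (y : R) : is_derive y 1 (fun z => c / K * s z - e * prim f z)
               (c * weight y - e * f y).
    have ? := ds y; have ? := prim_is_derive y cf.
    have K0' : K != 0 by rewrite gt_eqF.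
    by deriv; field.
  apply: (@derive_ge0_le _ (fun z => c / K * s z - e * prim f z)
    (fun y => c * weight y - e * f y)) => //.
  - by apply: is_derive_within => y _; exact: d.
  - move=> y _; rewrite subr_ge0; apply: le_trans (fw y).
    apply: le_trans (ler_norm _) _; rewrite normrM.
    by rewrite ler_piMl.
have p0 := prim0 cf.
have m1 := main 1; have m2 := main (-1).
rewrite normr1 in m1; rewrite normrN1 in m2.
have [x0|x0] := leP 0 x.
  have := m1 (lexx _) _ _ x0; have := m2 (lexx _) _ _ x0; rewrite s0 p0.
  have cs : c / K * s x <= c / K * `|s x|.
    by apply: ler_wpM2l (ler_norm _); rewrite divr_ge0// ltW.
  by rewrite ler_norml => ? ?; apply/andP; split; lra.
have := m1 (lexx _) _ _ (ltW x0); have := m2 (lexx _) _ _ (ltW x0); rewrite s0 p0.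
have cs : c / K * - s x <= c / K * `|s x|.
  by rewrite -normrN; apply: ler_wpM2l (ler_norm _); rewrite divr_ge0// ltW.
by rewrite ler_norml => ? ?; apply/andP; split; lra.
Qed.

End weight.

(** * Picard iteration in a weighted norm, and dependence on the coefficients *)

Section linear_ode.
Context {R : realType} {I : finType}.
Implicit Types (A B : I -> I -> R -> R) (Y Z : I -> R -> R).

Definition bounded_coef (M : R) A :=
  (forall i j, continuous (A i j)) /\ forall i j x, `|A i j x| <= M.

Definition ode_rhs A Y i x : R := \sum_j A i j x * Y j x.

(** Two primitives cost a factor N M / K^2, with N the size of the system; K >= 1 and K >= 2 N M
    make it at most 1/2. *)
Definition ode_rate (M : R) : R := 1 + 2 * #|I|%:R * M.

Definition weighted M (c : R) Y :=
  (forall i, continuous (Y i)) /\ forall i x, `|Y i x| <= c * weight (ode_rate M) x.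

(** The system Y'' = A Y with Y(0) = y0 and Y'(0) = y1, integrated twice to become a fixed point
    equation. *)
Definition ode_sol A (y0 y1 : I -> R) Y := forall i x,
  Y i x = y0 i + y1 i * x + prim (prim (ode_rhs A Y i)) x.

Section fixed_bound.
Variable M : R.
Hypothesis M0 : 0 <= M.
Local Notation K := (ode_rate M).
Local Notation w := (weight K).
Local Notation N := (#|I|%:R : R).

Lemma ode_rate_ge1 : 1 <= K.
Proof. by rewrite /ode_rate lerDl !mulr_ge0. Qed.

Lemma ode_rate_contr : N * M / K / K <= 1 / 2.
Proof.
have K1 := ode_rate_ge1.
have K0 : 0 < K by apply: lt_le_trans K1.
have KK : K <= K * K by rewrite ler_peMl// ltW.
have h : 2 * N * M <= K by rewrite /ode_rate lerDr.
rewrite -mulrA -invfM ler_pdivrMr ?mulr_gt0//.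
by move: h KK; rewrite -mulrA; set t := N * M; lra.
Qed.

Lemma ode_rhs_cont A Y i : (forall i j, continuous (A i j)) ->
  (forall i, continuous (Y i)) -> continuous (ode_rhs A Y i).
Proof. by move=> cA cY; apply: cont_sum => j; apply: contM. Qed.

Lemma ode_rhs_bound A (d c : R) Y i x : 0 <= d -> (forall i j x, `|A i j x| <= d) ->
  weighted M c Y -> `|ode_rhs A Y i x| <= N * d * c * w x.
Proof.
move=> d0 Ad [_ Yc]; apply: le_trans (ler_norm_sum _ _ _) _.
apply: (@le_trans _ _ (\sum_(j : I) d * (c * w x))).
  by apply: ler_sum => j _; rewrite normrM; apply: ler_pM.
by rewrite sumr_const -[leLHS]mulr_natl !mulrA.
Qed.

Lemma ode_prim_bound A (d c : R) Y i x : 0 <= d ->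
  (forall i j, continuous (A i j)) -> (forall i j x, `|A i j x| <= d) ->
  weighted M c Y ->
  `|prim (ode_rhs A Y i) x| <= N * d * c / K * w x.
Proof.
move=> d0 cA Ad wY; apply: (prim_weight ode_rate_ge1).
  by apply: ode_rhs_cont => //; case: wY.
by move=> y; exact: ode_rhs_bound.
Qed.

Lemma ode_prim2_cont A Y i : (forall i j, continuous (A i j)) ->
  (forall i, continuous (Y i)) -> continuous (prim (prim (ode_rhs A Y i))).
Proof. by move=> cA cY; do 2 apply: prim_cont; exact: ode_rhs_cont. Qed.

Lemma ode_prim2_bound A (d c : R) Y i x : 0 <= d ->
  (forall i j, continuous (A i j)) -> (forall i j x, `|A i j x| <= d) ->
  weighted M c Y ->
  `|prim (prim (ode_rhs A Y i)) x| <= N * d * c / K / K * w x.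
Proof.
move=> d0 cA Ad wY; apply: (prim_weight ode_rate_ge1).
  by apply: prim_cont; apply: ode_rhs_cont => //; case: wY.
by move=> y; exact: ode_prim_bound.
Qed.

Lemma weighted_ge0 c Y (i : I) : weighted M c Y -> 0 <= c.
Proof.
move=> [_ /(_ i 0)] h; rewrite -(pmulr_lge0 _ (weight_gt0 K 0)).
exact: le_trans h.
Qed.

Lemma ode_prim2_contr A c Y i x : bounded_coef M A -> weighted M c Y ->
  `|prim (prim (ode_rhs A Y i)) x| <= c / 2 * w x.
Proof.
move=> [cA Ad] wY; apply: le_trans (ode_prim2_bound i x M0 cA Ad wY) _.
apply: ler_wpM2r; first exact: ltW (weight_gt0 K _).
have c0 := weighted_ge0 i wY.
have -> : N * M * c / K / K = N * M / K / K * c by ring.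
by rewrite [c / 2]mulrC; apply: ler_wpM2r => //; have := ode_rate_contr; lra.
Qed.

Lemma ode_rhsB A Y Z i : (fun x => ode_rhs A Y i x - ode_rhs A Z i x) =
  ode_rhs A (fun j x => Y j x - Z j x) i.
Proof.
by apply/funext => x; rewrite /ode_rhs -sumrB; apply: eq_bigr => j _; ring.
Qed.

Lemma ode_prim2B A Y Z i x : (forall i j, continuous (A i j)) ->
  (forall i, continuous (Y i)) -> (forall i, continuous (Z i)) ->
  prim (prim (ode_rhs A Y i)) x - prim (prim (ode_rhs A Z i)) x =
  prim (prim (ode_rhs A (fun j x => Y j x - Z j x) i)) x.
Proof.
move=> cA cY cZ; have c1 := ode_rhs_cont (i := i) cA cY; have c2 := ode_rhs_cont (i := i) cA cZ.
by rewrite -ode_rhsB primB// primB//; exact: prim_cont.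
Qed.

Section existence.
Variables (A : I -> I -> R -> R) (y0 y1 : I -> R).
Hypothesis bA : bounded_coef M A.

Let C : R := \sum_i (`|y0 i| + `|y1 i|).

Let start i x : R := y0 i + y1 i * x.

Fixpoint picard_iter n : I -> R -> R :=
  if n is m.+1 then fun i x => start i x + prim (prim (ode_rhs A (picard_iter m) i)) x
  else start.

Let C0 : 0 <= C.
Proof. by apply: sumr_ge0 => i _; rewrite addr_ge0. Qed.

Let start_weighted : weighted M C start.
Proof.
split=> [i|i x]; first by rewrite /start; cont.
have w1 := weight_ge1 K x; have wx := weight_gex ode_rate_ge1 x.
apply: (@le_trans _ _ ((`|y0 i| + `|y1 i|) * w x)); last first.
  apply: ler_wpM2r; first exact: le_trans w1.
  rewrite /C (bigD1 i)//= lerDl; apply: sumr_ge0 => j _; exact: addr_ge0.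
apply: le_trans (ler_normD _ _) _; rewrite mulrDl normrM; apply: lerD.
  by rewrite ler_peMr.
by apply: ler_wpM2l.
Qed.

(** The bound [2 * C] reproduces itself: [C] for the initial data plus half of [2 * C] for the
    double primitive. *)
Let iter_weighted n : weighted M (2 * C) (picard_iter n).
Proof.
have [cs ws] := start_weighted.
have w0 x := weight_gt0 K x.
elim: n => [|n ih] /=.
  split=> // i x; apply: le_trans (ws i x) _; apply: ler_wpM2r; first exact: ltW.
  by have := C0; lra.
split=> [i|i x].
  by apply: contD => //; apply: ode_prim2_cont; [case: bA|case: ih].
apply: le_trans (ler_normD _ _) _.
have -> : 2 * C * w x = C * w x + 2 * C / 2 * w x by field.
by apply: lerD => //; exact: ode_prim2_contr.
Qed.

Let weightedB c d Y Z : weighted M c Y -> weighted M d Z ->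
  weighted M (c + d) (fun i x => Y i x - Z i x).
Proof.
move=> [cY wY] [cZ wZ]; split=> [i|i x]; first by have := cY i; have := cZ i => ? ?; cont.
by apply: le_trans (ler_normB _ _) _; rewrite mulrDl; apply: lerD.
Qed.

Let iter_cauchy n m : weighted M (4 * C / 2 ^+ n)
  (fun i x => picard_iter (n + m) i x - picard_iter n i x).
Proof.
elim: n => [|n ih].
  rewrite expr0 divr1 add0n.
  by have := weightedB (iter_weighted m) (iter_weighted 0); rewrite -mulrDl -natrD.
split=> [i|i x].
  have := (iter_weighted (n.+1 + m)).1 i; have := (iter_weighted n.+1).1 i => ? ?.
  by cont.
have -> : picard_iter (n.+1 + m) i x - picard_iter n.+1 i x =
    prim (prim (ode_rhs A (picard_iter (n + m)) i)) x -
    prim (prim (ode_rhs A (picard_iter n) i)) x.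
  by rewrite /=; ring.
rewrite ode_prim2B//; first last.
- exact: (iter_weighted n).1.
- exact: (iter_weighted (n + m)).1.
- by case: bA.
have -> : 4 * C / 2 ^+ n.+1 = 4 * C / 2 ^+ n / 2 by rewrite exprS invfM; ring.
exact: ode_prim2_contr.
Qed.

Let lim_iter i x : R := lim (picard_iter n i x @[n --> \oo]).

Let small (e : R) x : 0 < e -> exists n, 4 * C / 2 ^+ n * w x < e.
Proof.
move=> e0.
have h : 0 <= 4 * C * w x / e.
  by rewrite divr_ge0 ?mulr_ge0 ?(ltW e0)//; exact: ltW (weight_gt0 K x).
have [n hn] : exists n : nat, 4 * C * w x / e < 2 ^+ n.
  exists (Num.bound (4 * C * w x / e)).
  apply: lt_trans (archi_boundP h) _.
  by rewrite -natrX ltr_nat ltn_expl.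
exists n; have p0 : 0 < 2 ^+ n :> R by rewrite exprn_gt0.
have -> : 4 * C / 2 ^+ n * w x = 4 * C * w x / 2 ^+ n by ring.
by rewrite ltr_pdivrMr// [e * _]mulrC -ltr_pdivrMr.
Qed.

Let iter_cvg i x : cvgn (fun n => picard_iter n i x).
Proof.
apply: cauchy_cvg; apply: cauchy_exP => e e0.
have [n hn] := small x e0.
exists (picard_iter n i x); exists n => // k /= nk.
rewrite /ball/= distrC -(subnKC nk).
exact: le_lt_trans ((iter_cauchy n (k - n)).2 i x) hn.
Qed.

Let lim_dist n i x : `|lim_iter i x - picard_iter n i x| <= 4 * C / 2 ^+ n * w x.
Proof.
have h : (fun k => `|picard_iter k i x - picard_iter n i x|) @ \oo -->
         `|lim_iter i x - picard_iter n i x|.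
  by apply: cvg_norm; apply: cvgB; [exact: iter_cvg|exact: cvg_cst].
apply: (cvgr_to_le h).
exists n => // k /= nk; rewrite -(subnKC nk).
exact: (iter_cauchy n (k - n)).2.
Qed.

Let lim_cont i : continuous (lim_iter i).
Proof.
move=> x; apply/cvgrPdist_lt => e e0.
have e3 : 0 < e / 6 by rewrite divr_gt0.
have [n hn] := small x e3.
have cw := @weight_cont _ K x.
have cn := (iter_weighted n).1 i x.
(* Convergence is uniform only relative to the weight; continuity of the weight carries the error
   bound from [x] to nearby [y]. *)
have h1 : \forall y \near x, 4 * C / 2 ^+ n * w y < e / 3.
  have c : {for x, continuous (fun y => 4 * C / 2 ^+ n * w y)}.
    by apply: continuousM; [exact: cvg_cst|exact: cw].
  move/cvgrPdist_lt: c => /(_ _ e3); apply: filterS => y.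
  by rewrite ltr_norml => /andP[h _]; lra.
have h2 : \forall y \near x, `|picard_iter n i x - picard_iter n i y| < e / 3.
  by move/cvgrPdist_lt: cn; apply; rewrite divr_gt0.
near=> y.
have a1 := lim_dist n i x; have a2 := lim_dist n i y.
have a3 : 4 * C / 2 ^+ n * w y < e / 3 by near: y.
have a4 : `|picard_iter n i x - picard_iter n i y| < e / 3 by near: y.
rewrite [ltLHS](_ : _ = `|(lim_iter i x - picard_iter n i x) +
  (picard_iter n i x - picard_iter n i y) - (lim_iter i y - picard_iter n i y)|).
  apply: le_lt_trans (ler_normB _ _) _.
  have := ler_normD (lim_iter i x - picard_iter n i x)
    (picard_iter n i x - picard_iter n i y).
  lra.
by congr `|_|; ring.
Unshelve. all: by end_near. Qed.

Lemma ode_exists : exists Y, weighted M (2 * C) Y /\ ode_sol A y0 y1 Y.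
Proof.
exists lim_iter; split.
  split; first exact: lim_cont.
  move=> i x.
  have h : (fun k => `|picard_iter k i x|) @ \oo --> `|lim_iter i x|.
    by apply: cvg_norm; exact: iter_cvg.
  apply: (cvgr_to_le h); exists 0%N => // k _.
  exact: (iter_weighted k).2.
move=> i x; apply/eqP; rewrite -subr_eq0 -normr_le0; apply/ler_addgt0Pr => e e0.
rewrite add0r.
have [n hn] := small x e0.
have [cA Ad] := bA.
have d1 := lim_dist n.+1 i x.
have wd : weighted M (4 * C / 2 ^+ n) (fun i x => lim_iter i x - picard_iter n i x).
  split=> [j|j y]; last exact: lim_dist.
  by have := lim_cont (i := j); have := (iter_weighted n).1 j => ? ?; cont.
have d2 := ode_prim2_contr i x bA wd.
rewrite -(ode_prim2B i x cA lim_cont (iter_weighted n).1) in d2.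
rewrite /= in d1.
rewrite [leLHS](_ : _ = `|(lim_iter i x -
   (start i x + prim (prim (ode_rhs A (picard_iter n) i)) x)) -
   (prim (prim (ode_rhs A lim_iter i)) x -
    prim (prim (ode_rhs A (picard_iter n) i)) x)|); last first.
  by congr `|_|; rewrite /start; ring.
apply: le_trans (ler_normB _ _) _.
have e1 : 4 * C / 2 ^+ n.+1 * w x = 4 * C / 2 ^+ n * w x / 2.
  by rewrite exprS invfM; ring.
by rewrite e1 in d1; move: d1 d2 hn; set t := 4 * C / 2 ^+ n; lra.
Qed.

End existence.

(** Iterating c -> c / 2 + d, whose fixed point is 2 d, gives the bound c / 2^n + 2 d for every n,
    so the a priori constant disappears. *)
Lemma weighted_absorb (c d : R) Z : 0 <= d -> weighted M c Z ->
  (forall c, weighted M c Z -> weighted M (c / 2 + d) Z) -> weighted M (2 * d) Z.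
Proof.
move=> d0 wZ h; have cZ : forall i, continuous (Z i) by case: wZ.
split=> // i x; apply/ler_addgt0Pr => e e0.
have c0 := weighted_ge0 i wZ.
have hn n : weighted M (c / 2 ^+ n + 2 * d) Z.
  elim: n => [|n ih].
    split=> // j y; apply: le_trans (wZ.2 j y) _.
    rewrite expr0 divr1; apply: ler_wpM2r; last by rewrite lerDl mulr_ge0.
    exact: ltW (weight_gt0 K _).
  have := h _ ih; rewrite exprS invfM.
  by have -> : (c / 2 ^+ n + 2 * d) / 2 + d = c * (2^-1 / 2 ^+ n) + 2 * d by field.
have w0 := weight_gt0 K x.
have [n cn] : exists n : nat, c * w x / e < 2 ^+ n.
  exists (Num.bound (c * w x / e)).
  apply: lt_trans (archi_boundP _) _; last by rewrite -natrX ltr_nat ltn_expl.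
  by rewrite divr_ge0 ?(ltW e0)// mulr_ge0 ?(ltW w0).
apply: le_trans ((hn n).2 i x) _; rewrite mulrDl addrC lerD2l.
have p0 : 0 < 2 ^+ n :> R by rewrite exprn_gt0.
have -> : c / 2 ^+ n * w x = c * w x / 2 ^+ n by ring.
by rewrite ler_pdivrMr// [e * _]mulrC -ler_pdivrMr// ltW.
Qed.

(** D = Y - Z is the double primitive of A D + (A - B) Z. The first term is a contraction and is
    absorbed; the second is linear in [d]. The outcome is Lipschitz dependence on the coefficients,
    and uniqueness when [d] is 0. *)
Lemma ode_depend A B (c c' d : R) y0 y1 Y Z : 0 <= d ->
  bounded_coef M A -> bounded_coef M B ->
  (forall i j x, `|A i j x - B i j x| <= d) ->
  weighted M c Y -> weighted M c' Z -> 0 <= c' ->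
  ode_sol A y0 y1 Y -> ode_sol B y0 y1 Z ->
  weighted M (2 * (N * d * c' / K / K)) (fun i x => Y i x - Z i x) /\
  forall i x, `|prim (ode_rhs A Y i) x - prim (ode_rhs B Z i) x| <=
    (N * M * (2 * (N * d * c' / K / K)) / K + N * d * c' / K) * w x.
Proof.
move=> d0 bA bB AB wY wZ c'0 sY sZ.
have [cA Ad] := bA; have [cB Bd] := bB; have [cY _] := wY; have [cZ _] := wZ.
have K0 : 0 < K by exact: lt_le_trans ode_rate_ge1.
pose D := fun i x => Y i x - Z i x.
pose AmB := fun i j x => A i j x - B i j x.
have cD i : continuous (D i) by rewrite /D; have := cY i; have := cZ i => ? ?; cont.
have cAB i j : continuous (AmB i j).
  by rewrite /AmB; have := cA i j; have := cB i j => ? ?; cont.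
have rhsE i : (fun x => ode_rhs A Y i x - ode_rhs B Z i x) =
    (fun x => ode_rhs A D i x + ode_rhs AmB Z i x).
  apply/funext => x; rewrite /ode_rhs -sumrB -big_split/=; apply: eq_bigr => j _.
  by rewrite /D /AmB; ring.
have c1 i := ode_rhs_cont (i := i) cA cY; have c2 i := ode_rhs_cont (i := i) cB cZ.
have c3 i := ode_rhs_cont (i := i) cA cD; have c4 i := ode_rhs_cont (i := i) cAB cZ.
have pE i : (fun x => prim (ode_rhs A Y i) x - prim (ode_rhs B Z i) x) =
    (fun x => prim (ode_rhs A D i) x + prim (ode_rhs AmB Z i) x).
  by rewrite -primB// -primD//; congr prim; exact: rhsE.
have ppE i x : prim (prim (ode_rhs A Y i)) x - prim (prim (ode_rhs B Z i)) x =
    prim (prim (ode_rhs A D i)) x + prim (prim (ode_rhs AmB Z i)) x.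
  have := congr1 prim (pE i).
  rewrite primB ?primD//; try exact: prim_cont.
  by move/(congr1 (@^~ x)).
have wD : weighted M (2 * (N * d * c' / K / K)) D.
  apply: (@weighted_absorb (c + c')).
  - by rewrite !divr_ge0 ?mulr_ge0// ltW.
  - split=> // i x; apply: le_trans (ler_normB _ _) _; rewrite mulrDl.
    by apply: lerD; [exact: wY.2|exact: wZ.2].
  - move=> e we; split=> // i x.
    have -> : D i x = prim (prim (ode_rhs A D i)) x + prim (prim (ode_rhs AmB Z i)) x.
      by rewrite -ppE /D sY sZ; ring.
    apply: le_trans (ler_normD _ _) _; rewrite [leRHS]mulrDl; apply: lerD.
      exact: ode_prim2_contr.
    exact: ode_prim2_bound.
split=> // i x.
have := congr1 (@^~ x) (pE i) => /= ->.
apply: le_trans (ler_normD _ _) _; rewrite [leRHS]mulrDl; apply: lerD.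
  exact: ode_prim_bound.
exact: ode_prim_bound.
Qed.

Lemma ode_unique A (c c' : R) y0 y1 Y Z : bounded_coef M A ->
  weighted M c Y -> weighted M c' Z -> ode_sol A y0 y1 Y -> ode_sol A y0 y1 Z ->
  forall i x, Y i x = Z i x.
Proof.
move=> bA wY wZ sY sZ i x.
have AA i' j y : `|A i' j y - A i' j y| <= 0 by rewrite subrr normr0.
have [[_ h] _] := ode_depend (lexx 0) bA bA AA wY wZ (weighted_ge0 i wZ) sY sZ.
by move: (h i x); rewrite !(mulr0, mul0r) normr_le0 subr_eq0 => /eqP.
Qed.

End fixed_bound.

Lemma ode_sol_is_derive A y0 y1 Y : (forall i j, continuous (A i j)) ->
  (forall i, continuous (Y i)) -> ode_sol A y0 y1 Y ->
  forall i, [/\ Y i 0 = y0 i, forall x : R, is_derive x 1 (Y i) (y1 i + prim (ode_rhs A Y i) x) &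
    forall x : R, is_derive x 1 (fun y => y1 i + prim (ode_rhs A Y i) y) (ode_rhs A Y i x)].
Proof.
move=> cA cY sY i.
have c1 := ode_rhs_cont (i := i) cA cY; have c2 := prim_cont c1.
split=> [|x|x].
- by rewrite sY mulr0 prim0// !addr0.
- have ? := prim_is_derive x c2.
  rewrite (_ : Y i = fun x => y0 i + y1 i * x + prim (prim (ode_rhs A Y i)) x).
    by deriv; ring.
  by apply/funext => y; rewrite sY.
- by have ? := prim_is_derive x c1; deriv; ring.
Qed.

End linear_ode.

(** * Boundary value problems on [0, T] *)

Section sturm_liouville.
Context {R : realType}.
Variable T : R.
Hypothesis T0 : 0 < T.
Implicit Types (V f F g G : R -> R) (x : R).

(** The point is to include the ends 0 and T, beyond which [f] is unknown: points of [0, T]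
    accumulating at [x] already determine the slope. *)
Lemma derive_zero f (d : R) x : (forall y, 0 <= y <= T -> f y = 0) -> 0 <= x <= T ->
  is_derive x 1 f d -> d = 0.
Proof.
move=> f0 xT df; have [q [cq <- fq]] := caratheodory df.
apply/eqP/negP => /negP qx0.
have nq : \forall y \near x, q y != 0.
  by apply: (cvgr_neq0 _ cq).
move: nq => /nbhs_ballP[e /= e0 he].
have [y [yT yx exy]] : exists y, [/\ 0 <= y <= T, y != x & `|x - y| < e].
  (* A step of length at most T / 2 towards the farther end stays inside [0, T]. *)
  pose m := Num.min (e / 2) (T / 2).
  have m0 : 0 < m by rewrite lt_min !divr_gt0.
  have me : m < e by apply: (@le_lt_trans _ _ (e / 2)); [rewrite ge_min lexx|lra].
  have mT : m <= T / 2 by rewrite ge_min lexx orbT.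
  have [xl|xr] := leP x (T / 2).
    exists (x + m); split; first by case/andP: xT => ? ?; apply/andP; split; lra.
      by rewrite gt_eqF// ltrDl.
    by rewrite opprD addNKr normrN gtr0_norm.
  exists (x - m); split; first by case/andP: xT => ? ?; apply/andP; split; lra.
    by rewrite lt_eqF// ltrBlDr ltrDl.
  by rewrite opprB addrC subrK gtr0_norm.
have := he y exy; have := fq y; rewrite !f0// add0r => /esym/eqP.
by rewrite mulf_eq0 subr_eq0 (negPf yx) orbF => ->.
Qed.

(** F is the image of f under -d^2 + V on [0, T], so [dot f F] is the quadratic form of this
    operator. Continuity is asked on the whole line for the sake of [prim]. *)
Definition sl_sol V f (f' : R -> R) F := [/\ continuous f, continuous F,
  forall x, 0 <= x <= T -> is_derive x 1 f (f' x) &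
  forall x, 0 <= x <= T -> is_derive x 1 f' (V x * f x - F x)].

Definition bc (neumann : bool) f (f' : R -> R) :=
  if neumann then f' 0 = 0 /\ f' T = 0 else f 0 = 0 /\ f T = 0.

Definition dot f g : R := prim (fun x => f x * g x) T.

Lemma dotC f g : dot f g = dot g f.
Proof. by rewrite /dot; congr (prim _ _); apply/funext => x; rewrite mulrC. Qed.

Lemma dot_lin f g h (a b : R) : continuous f -> continuous g -> continuous h ->
  dot f (fun x => a * g x + b * h x) = a * dot f g + b * dot f h.
Proof.
move=> cf cg ch; rewrite /dot.
have -> : (fun x => f x * (a * g x + b * h x)) =
  (fun x => a * (f x * g x) + b * (f x * h x)) by apply/funext => x; ring.
by rewrite primD ?primZ//; cont.
Qed.

Lemma dotZ f g (a : R) : continuous f -> continuous g ->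
  dot f (fun x => a * g x) = a * dot f g.
Proof.
move=> cf cg; rewrite /dot.
have -> : (fun x => f x * (a * g x)) = (fun x => a * (f x * g x)).
  by apply/funext => x; ring.
by rewrite primZ//; cont.
Qed.

Lemma dotN f g : continuous f -> continuous g ->
  dot f (fun x => - g x) = - dot f g.
Proof.
move=> cf cg; rewrite -mulN1r -dotZ//; congr dot; apply/funext => x.
by rewrite mulN1r.
Qed.

Lemma prim_ftc f F : continuous f -> (forall x, 0 <= x <= T -> is_derive x 1 F (f x)) ->
  prim f T = F T - F 0.
Proof.
move=> cf dF.
have := derive_unique (ltW T0) (fun x _ => prim_is_derive x cf) dF.
by rewrite prim0// subr0.
Qed.

(** Lagrange's identity: f' g - f g' has derivative f G - g F, and either boundary condition makes
    it vanish at 0 and at T. *)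
Lemma sl_sym b V f f' F g g' G : sl_sol V f f' F -> sl_sol V g g' G ->
  bc b f f' -> bc b g g' -> dot f G = dot g F.
Proof.
move=> [cf cF df df'] [cg cG dg dg'] bf bg.
have dW x : 0 <= x <= T ->
    is_derive x 1 (fun x => f' x * g x - f x * g' x) (f x * G x - g x * F x).
  move=> xT; have := df x xT; have := df' x xT; have := dg x xT; have := dg' x xT.
  by move=> ? ? ? ?; deriv; ring.
have cW : continuous (fun x => f x * G x - g x * F x) by cont.
have := prim_ftc cW dW; rewrite primB; [|by cont..].
have -> : f' T * g T - f T * g' T - (f' 0 * g 0 - f 0 * g' 0) = 0.
  by case: b bf bg => -[-> ->] [-> ->]; rewrite !(mulr0, mul0r, subrr).
by rewrite /dot; lra.
Qed.

Lemma sl_lin V f f' F g g' G (a b : R) : sl_sol V f f' F -> sl_sol V g g' G ->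
  sl_sol V (fun x => a * f x + b * g x) (fun x => a * f' x + b * g' x)
    (fun x => a * F x + b * G x).
Proof.
move=> [cf cF df df'] [cg cG dg dg']; split; [by cont..| |] => x xT.
- have := df x xT; have := dg x xT => ? ?; deriv; ring.
- have := df' x xT; have := dg' x xT => ? ?; deriv; ring.
Qed.

Lemma bc_lin b f f' g g' (c d : R) : bc b f f' -> bc b g g' ->
  bc b (fun x => c * f x + d * g x) (fun x => c * f' x + d * g' x).
Proof. by case: b => -[/= -> ->] [/= -> ->]; rewrite !mulr0 addr0. Qed.

Lemma sl_zero V f f' F : sl_sol V f f' F -> (forall x, 0 <= x <= T -> f x = 0) ->
  forall x, 0 <= x <= T -> F x = 0.
Proof.
move=> [_ _ df df'] f0 x xT.
have f'0 y : 0 <= y <= T -> f' y = 0 by move=> yT; exact: derive_zero f0 yT (df y yT).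
have := derive_zero f'0 xT (df' x xT); rewrite f0// mulr0 sub0r => /eqP.
by rewrite oppr_eq0 => /eqP.
Qed.

End sturm_liouville.

(** * Unstable modes of the coupled system, from the signs of the two quadratic forms *)

Section spectrum.
Context {R : realType}.
Variables (T x0 : R) (Vp Vm : R -> R).
Hypothesis T0 : 0 < T.
Implicit Types (f F g G u v w : R -> R) (x : R).
Local Notation sl_sol := (sl_sol T).
Local Notation bc := (bc T).
Local Notation dot := (dot T).

Hypothesis Lm_ge0 : forall b f f' F, sl_sol Vm f f' F -> bc b f f' -> 0 <= dot f F.
Hypothesis Lm_eq0 : forall b f f' F, sl_sol Vm f f' F -> bc b f f' -> dot f F = 0 ->
  forall x, 0 <= x <= T -> f x = 0.
Hypothesis Lp_dirichlet : forall f f' F, sl_sol Vp f f' F -> bc false f f' -> 0 <= dot f F.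
Hypothesis x0T : 0 <= x0 <= T.
Hypothesis Lp_neumann : forall f f' F, sl_sol Vp f f' F -> bc true f f' -> f x0 = 0 ->
  0 <= dot f F.

(* (w1, w2) = JL (u1, u2) on [0, T]; the even and odd parts of a periodic
   function satisfy the Neumann and the Dirichlet conditions respectively. *)
Definition sys b u1 u2 w1 w2 := exists u1' u2' : R -> R,
  [/\ sl_sol Vp u1 u1' (fun x => - w2 x), sl_sol Vm u2 u2' w1, bc b u1 u1' & bc b u2 u2'].

Lemma sys_cont b u1 u2 w1 w2 : sys b u1 u2 w1 w2 ->
  [/\ continuous u1, continuous u2, continuous w1 & continuous w2].
Proof.
move=> [? [? [[? c ? ?] [? ? ? ?] _ _]]]; split => //.
rewrite (_ : w2 = fun x => - - w2 x); first exact: contN.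
by apply/funext => x; rewrite opprK.
Qed.

(** Symmetry of L-; [sys_symp] is the same for L+. The arguments below combine these two identities
    with the signs of the forms. *)
Lemma sys_symm b u1 u2 w1 w2 v1 v2 z1 z2 : sys b u1 u2 w1 w2 -> sys b v1 v2 z1 z2 ->
  dot u2 z1 = dot v2 w1.
Proof. by move=> [? [? [_ su _ bu]]] [? [? [_ sv _ bv]]]; exact: sl_sym su sv bu bv. Qed.

Lemma sys_symp b u1 u2 w1 w2 v1 v2 z1 z2 : sys b u1 u2 w1 w2 -> sys b v1 v2 z1 z2 ->
  dot u1 z2 = dot v1 w2.
Proof.
move=> su sv; have [cu _ _ cw] := sys_cont su; have [cv _ _ cz] := sys_cont sv.
case: su => [? [? [su _ bu _]]]; case: sv => [? [? [sv _ bv _]]].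
have := sl_sym T0 su sv bu bv; rewrite !dotN//; exact: oppr_inj.
Qed.

Lemma sys_lin b u1 u2 w1 w2 v1 v2 z1 z2 (c d : R) :
  sys b u1 u2 w1 w2 -> sys b v1 v2 z1 z2 ->
  sys b (fun x => c * u1 x + d * v1 x) (fun x => c * u2 x + d * v2 x)
    (fun x => c * w1 x + d * z1 x) (fun x => c * w2 x + d * z2 x).
Proof.
move=> [u1' [u2' [su1 su2 bu1 bu2]]] [v1' [v2' [sv1 sv2 bv1 bv2]]].
exists (fun x => c * u1' x + d * v1' x), (fun x => c * u2' x + d * v2' x); split.
- have := sl_lin c d su1 sv1; congr (sl_sol _ _ _ _); apply/funext => x; ring.
- exact: sl_lin.
- exact: bc_lin.
- exact: bc_lin.
Qed.

Lemma sys_ge0 b u1 u2 w1 w2 : sys b u1 u2 w1 w2 -> 0 <= dot u2 w1.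
Proof. by move=> [? [? [_ su _ bu]]]; exact: Lm_ge0 su bu. Qed.

Lemma sys_eq0 b u1 u2 w1 w2 : sys b u1 u2 w1 w2 -> dot u2 w1 = 0 ->
  forall x, 0 <= x <= T -> u2 x = 0 /\ w1 x = 0.
Proof.
move=> [? [? [_ su _ bu]]] d0 x xT; have h := Lm_eq0 su bu d0; split; first exact: h.
exact: (sl_zero T0 su h).
Qed.

Definition zero_on f := forall x, 0 <= x <= T -> f x = 0.

(** a and b are the real and imaginary parts of an eigenfunction for al + i be. The two symmetries
    read be (p + q) = al (r - s) and be (p + q) = al (s - r), so p + q = 0 and r = s unless be = 0.
    The energies of L- at a2 and b2 add up to al (p + q) + be (r - s) = 0; being nonnegative, both
    vanish. *)
Lemma sys_complex b a1 a2 b1 b2 (al be : R) : 0 < al ->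
  sys b a1 a2 (fun x => al * a1 x + - be * b1 x) (fun x => al * a2 x + - be * b2 x) ->
  sys b b1 b2 (fun x => be * a1 x + al * b1 x) (fun x => be * a2 x + al * b2 x) ->
  be = 0 \/ [/\ zero_on a1, zero_on a2, zero_on b1 & zero_on b2].
Proof.
move=> al0 sa sb.
have [ca1 ca2 _ _] := sys_cont sa; have [cb1 cb2 _ _] := sys_cont sb.
have hm := sys_symm sa sb; have hp := sys_symp sa sb.
have pa := sys_ge0 sa; have pb := sys_ge0 sb.
have za := sys_eq0 sa; have zb := sys_eq0 sb.
rewrite !dot_lin// in hm hp pa pb za zb.
rewrite (dotC T a2 a1) (dotC T b2 b1) in hm pa pb za zb.
rewrite (dotC T a2 b1) (dotC T b2 a1) in hm pa pb za zb.
move: hm hp pa pb za zb.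
set p := dot a1 a2; set q := dot b1 b2; set r := dot a1 b2; set s := dot b1 a2.
move=> hm hp pa pb za zb.
have [be0|be0] := eqVneq be 0; [by left|right].
have pq : p + q = 0.
  have : be * (p + q) = 0 by lra.
  by move/eqP; rewrite mulf_eq0 (negPf be0) => /eqP.
have rs : r - s = 0.
  have : al * (r - s) = 0 by lra.
  by move/eqP; rewrite mulf_eq0 (gt_eqF al0) => /eqP.
have e : (al * p + - be * s) + (be * r + al * q) = 0.
  have -> : (al * p + - be * s) + (be * r + al * q) = al * (p + q) + be * (r - s) by ring.
  by rewrite pq rs !mulr0 addr0.
have ea : al * p + - be * s = 0 by lra.
have eb : be * r + al * q = 0 by lra.
(* The vanishing of L- a2 and L- b2 is a linear system for (a1, b1), of determinant al^2 + be^2. *)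
have n0 : al ^+ 2 + be ^+ 2 != 0 by rewrite gt_eqF// ltr_wpDr ?sqr_ge0// exprn_gt0.
have k x : 0 <= x <= T -> a1 x = 0 /\ b1 x = 0.
  move=> xT; have [_ h1] := za ea x xT; have [_ h2] := zb eb x xT.
  split; apply: (mulfI n0); rewrite mulr0.
    have -> : (al ^+ 2 + be ^+ 2) * a1 x = al * (al * a1 x + - be * b1 x) +
      be * (be * a1 x + al * b1 x) by ring.
    by rewrite h1 h2 !mulr0 addr0.
  have -> : (al ^+ 2 + be ^+ 2) * b1 x = - be * (al * a1 x + - be * b1 x) +
    al * (be * a1 x + al * b1 x) by ring.
  by rewrite h1 h2 !mulr0 addr0.
split=> x xT.
- by case: (k x xT).
- by case: (za ea x xT).
- by case: (k x xT).
- by case: (zb eb x xT).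
Qed.

(** The form of L- at [u2] equals [mu * dot u1 u2]. When it vanishes, [u2] is 0, and then so is mu
    u1 = L- u2. *)
Lemma sys_eig0 b u1 u2 (mu : R) : 0 < mu ->
  sys b u1 u2 (fun x => mu * u1 x) (fun x => mu * u2 x) -> dot u1 u2 = 0 ->
  zero_on u1 /\ zero_on u2.
Proof.
move=> mu0 su d0; have [cu1 cu2 _ _] := sys_cont su.
have h : dot u2 (fun x => mu * u1 x) = 0 by rewrite dotZ// dotC d0 mulr0.
split=> x xT; have [h2 h1] := sys_eq0 su h xT => //.
by apply: (mulfI (lt0r_neq0 mu0)); rewrite mulr0.
Qed.

Lemma sys_eig_ge0 b u1 u2 (mu : R) : 0 < mu ->
  sys b u1 u2 (fun x => mu * u1 x) (fun x => mu * u2 x) -> 0 <= dot u1 u2.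
Proof.
move=> mu0 su; have [cu1 cu2 _ _] := sys_cont su.
by have := sys_ge0 su; rewrite dotZ// dotC pmulr_rge0.
Qed.

(** The form of L- at u2 is mu <u1, u2>, that of L+ at u1 is - mu <u1, u2>; both can be nonnegative
    only if <u1, u2> = 0. *)
Lemma sys_odd u1 u2 (mu : R) : 0 < mu ->
  sys false u1 u2 (fun x => mu * u1 x) (fun x => mu * u2 x) -> zero_on u1 /\ zero_on u2.
Proof.
move=> mu0 su; apply: (sys_eig0 mu0 su).
have := sys_eig_ge0 mu0 su; have [cu1 cu2 _ _] := sys_cont su.
case: (su) => [u1' [u2' [s1 _ b1 _]]].
have := Lp_dirichlet s1 b1; rewrite dotN//; last by cont.
rewrite dotZ// oppr_ge0 pmulr_rle0// => h1 h2.
by apply/eqP; rewrite eq_le h1 h2.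
Qed.

(** The same conflict of signs as for odd functions. It makes u1(x0) an injective coordinate on the
    even eigenfunctions for [mu]. *)
Lemma sys_neumann_vanish u1 u2 (mu : R) : 0 < mu -> u1 x0 = 0 ->
  sys true u1 u2 (fun x => mu * u1 x) (fun x => mu * u2 x) -> zero_on u1 /\ zero_on u2.
Proof.
move=> mu0 ux0 su; apply: (sys_eig0 mu0 su).
have := sys_eig_ge0 mu0 su; have [cu1 cu2 _ _] := sys_cont su.
case: (su) => [u1' [u2' [s1 _ b1 _]]].
have := Lp_neumann s1 b1 ux0; rewrite dotN//; last by cont.
rewrite dotZ// oppr_ge0 pmulr_rle0// => h1 h2.
by apply/eqP; rewrite eq_le h1 h2.
Qed.

Lemma sys_proportional u1 u2 w1 w2 (mu : R) : 0 < mu ->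
  sys true u1 u2 (fun x => mu * u1 x) (fun x => mu * u2 x) ->
  sys true w1 w2 (fun x => mu * w1 x) (fun x => mu * w2 x) ->
  forall x, 0 <= x <= T ->
    w1 x0 * u1 x = u1 x0 * w1 x /\ w1 x0 * u2 x = u1 x0 * w2 x.
Proof.
move=> mu0 su sw x xT.
have := sys_lin (w1 x0) (- u1 x0) su sw.
set f1 := (fun x => _ + _); set f2 := (fun x => _ + _).
set g1 := (fun x => _ + _); set g2 := (fun x => _ + _) => sg.
have e1 : g1 = (fun x => mu * f1 x) by apply/funext => y; rewrite /g1 /f1; ring.
have e2 : g2 = (fun x => mu * f2 x) by apply/funext => y; rewrite /g2 /f2; ring.
rewrite e1 e2 in sg.
have f0 : f1 x0 = 0 by rewrite /f1; ring.
have [/(_ x xT) z1 /(_ x xT) z2] := sys_neumann_vanish mu0 f0 sg.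
by move: z1 z2; rewrite /f1 /f2 !mulNr => /subr0_eq -> /subr0_eq ->.
Qed.

Lemma sys_same_eigenvalue u1 u2 w1 w2 (mu la : R) : 0 < mu -> 0 < la ->
  sys true u1 u2 (fun x => mu * u1 x) (fun x => mu * u2 x) ->
  sys true w1 w2 (fun x => la * w1 x) (fun x => la * w2 x) ->
  ~ (zero_on u1 /\ zero_on u2) -> ~ (zero_on w1 /\ zero_on w2) -> mu = la.
Proof.
move=> mu0 la0 su sw nu nw.
have [//|mula] := eqVneq mu la.
have [cu1 cu2 _ _] := sys_cont su; have [cw1 cw2 _ _] := sys_cont sw.
have hm := sys_symm su sw; have hp := sys_symp su sw.
rewrite !dotZ// in hm hp.
rewrite (dotC T u2 w1) (dotC T w2 u1) in hm.
(* The symmetries give la <w1, u2> = mu <u1, w2> and la <u1, w2> = mu <w1, u2>, so (mu^2 - la^2)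
   <u1, w2> = 0. *)
have n0 : mu ^+ 2 - la ^+ 2 != 0.
  rewrite subr_sqr mulf_neq0 ?subr_eq0//.
  by rewrite gt_eqF// addr_gt0.
have uw : dot u1 w2 = 0.
  apply: (mulfI n0); rewrite mulr0 mulrBl.
  have -> : la ^+ 2 * dot u1 w2 = la * (la * dot u1 w2) by ring.
  by rewrite hp mulrCA hm; ring.
have wu : dot w1 u2 = 0.
  by move: hm => /eqP; rewrite uw mulr0 mulf_eq0 gt_eqF//= => /eqP.
have al0 : w1 x0 != 0.
  by apply/eqP => w0; apply: nw; exact: sys_neumann_vanish la0 w0 sw.
(* [g] vanishes at [x0]. Without the cross terms its L+ form is -(w1(x0)^2 mu <u1, u2> + u1(x0)^2 la
   <w1, w2>); since it is nonnegative and w1(x0) is nonzero, <u1, u2> = 0. *)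
pose g x := w1 x0 * u1 x + - u1 x0 * w1 x.
have cg : continuous g by rewrite /g; cont.
have [g1' [g2' [s1 _ b1 _]]] := sys_lin (w1 x0) (- u1 x0) su sw.
have := Lp_neumann s1 b1; rewrite -/g => /(_ _)/=.
have g0 : g x0 = 0 by rewrite /g; ring.
move=> /(_ g0); rewrite dotN//; last by cont.
rewrite dot_lin//; [|by cont..].
rewrite !dotZ// ![dot g _]dotC !dot_lin// (dotC T u2 u1) (dotC T u2 w1).
rewrite (dotC T w2 u1) (dotC T w2 w1) uw wu !mulr0 add0r addr0 => h.
have P0 := sys_eig_ge0 mu0 su; have Q0 := sys_eig_ge0 la0 sw.
exfalso; apply: nu; apply: (sys_eig0 mu0 su).
have h1 : 0 <= w1 x0 ^+ 2 * (mu * dot u1 u2).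
  by rewrite mulr_ge0 ?sqr_ge0// mulr_ge0// ltW.
have h2 : 0 <= u1 x0 ^+ 2 * (la * dot w1 w2).
  by rewrite mulr_ge0 ?sqr_ge0// mulr_ge0// ltW.
have h3 : w1 x0 ^+ 2 * (mu * dot u1 u2) == 0.
  by rewrite eq_le h1 andbT; move: h h2; rewrite !expr2; lra.
move: h3; rewrite mulf_eq0 sqrf_eq0 (negPf al0) mulf_eq0 (gt_eqF mu0)/=.
by move/eqP.
Qed.

(** In the sum of the two symmetry relations the terms <v1, e2> and <e1, v2> cancel, leaving 2 p
    <e1, e2> = 0. *)
Lemma sys_jordan b e1 e2 v1 v2 (la p : R) : 0 < la -> p != 0 ->
  sys b e1 e2 (fun x => la * e1 x) (fun x => la * e2 x) ->
  sys b v1 v2 (fun x => la * v1 x + p * e1 x) (fun x => la * v2 x + p * e2 x) ->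
  zero_on e1 /\ zero_on e2.
Proof.
move=> la0 p0 se sv; apply: (sys_eig0 la0 se).
have [ce1 ce2 _ _] := sys_cont se; have [cv1 cv2 _ _] := sys_cont sv.
have hm := sys_symm se sv; have hp := sys_symp se sv.
rewrite !dot_lin// !dotZ// in hm hp.
rewrite (dotC T e2 v1) (dotC T e2 e1) (dotC T v2 e1) in hm.
by apply: (mulfI p0); rewrite mulr0; lra.
Qed.

End spectrum.

(** * Shooting *)

Section clamp.
Context {R : realType}.
Implicit Types a b x y : R.

(** Composition with this retraction onto [a, b] turns data on an interval into continuous functions
    on the line. *)
Definition clamp a b x : R := Num.max a (Num.min b x).

Lemma clamp_in a b x : a <= b -> a <= clamp a b x <= b.
Proof. by move=> ab; rewrite /clamp le_max lexx ge_max ab ge_min lexx. Qed.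

Lemma clamp_id a b x : a <= x <= b -> clamp a b x = x.
Proof. by move=> /andP[ax xb]; rewrite /clamp (min_idPr xb) (max_idPr ax). Qed.

Lemma clamp_opp b x : 0 <= b -> clamp (- b) b (- x) = - clamp (- b) b x.
Proof.
move=> b0; rewrite /clamp /Num.max /Num.min.
case: (ltP b (- x)) => ?; case: (ltP b x) => ?;
  by (case: ltP => ?; try case: ltP => ?); lra.
Qed.

Lemma clamp_lip a b x y : `|clamp a b x - clamp a b y| <= `|x - y|.
Proof.
rewrite /clamp /Num.max /Num.min.
have h (z t : R) : `|z - t| = Num.max (z - t) (t - z).
  rewrite /Num.max; case: ltP => h; first by rewrite ler0_norm; lra.
  by rewrite ger0_norm; lra.
rewrite ler_norml; have h1 := ler_norm (x - y); have h2 := ler_norm (y - x).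
rewrite distrC in h2.
case: (ltP b x) => ?; case: (ltP b y) => ?; case: ltP => ?; case: ltP => ?;
  by apply/andP; split; lra.
Qed.

Lemma lipschitz_cont (f : R -> R) (L : R) :
  (forall x y, `|f x - f y| <= L * `|x - y|) -> continuous f.
Proof.
move=> fL x; apply/cvgrPdist_lt => e e0.
have L0 : 0 < `|L| + 1 by rewrite ltr_wpDl.
exists (e / (`|L| + 1)) => /=; first by rewrite divr_gt0.
move=> y /= xy; apply: le_lt_trans (fL x y) _.
apply: (@le_lt_trans _ _ ((`|L| + 1) * `|x - y|)).
  by apply: ler_wpM2r => //; have := ler_norm L; lra.
by rewrite mulrC -ltr_pdivlMr.
Qed.

Lemma clamp_cont a b : continuous (clamp a b).
Proof. by apply: (@lipschitz_cont _ 1) => x y; rewrite mul1r clamp_lip. Qed.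

Lemma ivt_zero (f : R -> R) a b : a <= b -> {within `[a, b], continuous f} ->
  f a <= 0 <= f b \/ f b <= 0 <= f a -> exists2 c, a <= c <= b & f c = 0.
Proof.
move=> ab cf h; have [|c] := @IVT _ f a b 0 ab cf; last by rewrite in_itv/=; exists c.
by rewrite ge_min le_max; case: h => /andP[-> ->]; rewrite ?orbT.
Qed.

End clamp.

Section shooting.
Context {R : realType}.
Variables (T M : R) (Vp Vm : R -> R).
Hypotheses (T0 : 0 < T) (M0 : 0 <= M).
Hypotheses (cVp : continuous Vp) (cVm : continuous Vm).
Hypotheses (bVp : forall x, `|Vp x| <= M) (bVm : forall x, `|Vm x| <= M).
Hypothesis Vm_pos : forall y y' : R -> R,
  (forall x : R, 0 <= x <= T -> is_derive x 1 y (y' x)) ->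
  (forall x : R, 0 <= x <= T -> is_derive x 1 y' (Vm x * y x)) ->
  y 0 = 1 -> y' 0 = 0 -> 0 < y' T.
Hypothesis Vp_neg : forall y y' : R -> R,
  (forall x : R, 0 <= x <= T -> is_derive x 1 y (y' x)) ->
  (forall x : R, 0 <= x <= T -> is_derive x 1 y' (Vp x * y x)) ->
  y 0 = 1 -> y' 0 = 0 -> y' T < 0.

(** Index [true] stands for u1 and [false] for u2. At [s = 1] the system Y'' = coef Y says JL u = la
    u; lowering [s] to 0 deforms L+ into L-. *)
Definition coef (la s : R) (i j : bool) (x : R) : R :=
  match i, j with
  | true, true => Vm x + s * (Vp x - Vm x)
  | true, false => la
  | false, true => - la
  | false, false => Vm x
  end.

(** Since |s (Vp - Vm) u1 u2| <= M (u1^2 + u2^2), the choice la = M + 1 leaves the surplus u1^2 +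
    u2^2 in [shoot_det_top]. *)
Let top : R := M + 1.
Let B : R := 2 * M + 1.

Let B0 : 0 <= B. Proof. by have := M0; rewrite /B; lra. Qed.

Definition admissible (p : R * R) := 0 <= p.1 <= top /\ 0 <= p.2 <= 1.

Lemma coef_bounded p : admissible p -> bounded_coef B (coef p.1 p.2).
Proof.
move=> [/andP[l0 l1] /andP[s0 s1]]; split=> [i j|i j x].
  by case: i; case: j; rewrite /coef; cont.
have := M0; have := bVp x; have := bVm x; rewrite !ler_norml /B => /andP[m1 m2] /andP[p1 p2] M0'.
case: i; case: j => /=; apply/andP; rewrite /top in l1; split; try lra.
  nra.
nra.
Qed.

Lemma coef_lip p q i j x : `|coef p.1 p.2 i j x - coef q.1 q.2 i j x| <=
  `|p.1 - q.1| + 2 * M * `|p.2 - q.2|.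
Proof.
have h1 := normr_ge0 (p.1 - q.1); have h2 : 0 <= M * `|p.2 - q.2| by rewrite mulr_ge0.
case: i; case: j => /=.
- have -> : Vm x + p.2 * (Vp x - Vm x) - (Vm x + q.2 * (Vp x - Vm x)) =
    (p.2 - q.2) * (Vp x - Vm x) by ring.
  rewrite normrM.
  have h3 : `|Vp x - Vm x| <= 2 * M.
    by apply: le_trans (ler_normB _ _) _; have := bVp x; have := bVm x; lra.
  have h4 : `|p.2 - q.2| * `|Vp x - Vm x| <= `|p.2 - q.2| * (2 * M) by exact: ler_wpM2l.
  lra.
- lra.
- by rewrite -opprD normrN; lra.
- by rewrite subrr normr0; lra.
Qed.

(** Initial values: unit vectors with zero derivative, so that the two solutions span the even
    ones. *)
Let e (k i : bool) : R := (i == k)%:R.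
Let o (i : bool) : R := 0.
Let C k : R := 2 * \sum_i (`|e k i| + `|o i|).

Let shoot_spec p k Y := admissible p ->
  weighted B (C k) Y /\ ode_sol (coef p.1 p.2) (e k) o Y.

Let shoot_exists p k : exists Y, shoot_spec p k Y.
Proof.
have [ap|nap] := pselect (admissible p); last by exists (fun _ _ => 0) => /nap.
by have [Y hY] := ode_exists B0 (e k) o (coef_bounded ap); exists Y.
Qed.

Definition shoot p k : bool -> R -> R := projT1 (cid (shoot_exists p k)).

Let shootP p k : admissible p ->
  weighted B (C k) (shoot p k) /\ ode_sol (coef p.1 p.2) (e k) o (shoot p k).
Proof. by rewrite /shoot; case: cid => Y /=; apply. Qed.

Definition shoot' p k i x : R := prim (ode_rhs (coef p.1 p.2) (shoot p k) i) x.

Lemma shoot_derive p k i : admissible p -> [/\ shoot p k i 0 = e k i,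
  shoot' p k i 0 = 0,
  forall x : R, is_derive x 1 (shoot p k i) (shoot' p k i x) &
  forall x : R, is_derive x 1 (shoot' p k i) (ode_rhs (coef p.1 p.2) (shoot p k) i x)].
Proof.
move=> ap; have [[cY wY] sY] := shootP k ap; have [cA _] := coef_bounded ap.
have [h1 h2 h3] := ode_sol_is_derive cA cY sY i.
split=> //; first by rewrite /shoot' prim0//; exact: ode_rhs_cont.
- by move=> x; have := h2 x; rewrite add0r.
- move=> x; apply: prim_is_derive; exact: ode_rhs_cont.
Qed.

Definition shoot_det p : R :=
  shoot' p true true T * shoot' p false false T - shoot' p true false T * shoot' p false true T.

Let C0 k : 0 <= C k.
Proof. by rewrite mulr_ge0//; apply: sumr_ge0 => i _; rewrite addr_ge0. Qed.

Lemma shoot'_lip k i : exists L : R, forall p q, admissible p -> admissible q ->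
  `|shoot' p k i T - shoot' q k i T| <= L * (`|p.1 - q.1| + 2 * M * `|p.2 - q.2|).
Proof.
pose K : R := ode_rate (I := bool) B.
pose N : R := #|{: bool}|%:R.
exists ((N * B * (2 * (N * C k / K / K)) / K + N * C k / K) * weight K T).
move=> p q ap aq.
have [wp sp] := shootP k ap; have [wq sq] := shootP k aq.
have d0 : 0 <= `|p.1 - q.1| + 2 * M * `|p.2 - q.2| by rewrite addr_ge0// mulr_ge0// mulr_ge0.
have [_ h] := ode_depend B0 d0 (coef_bounded ap) (coef_bounded aq)
  (coef_lip p q) wp wq (C0 k) sp sq.
apply: le_trans (h i T) _.
rewrite le_eqVlt; apply/orP; left; apply/eqP; rewrite -/K -/N.
have K0 : K != 0 by rewrite gt_eqF//; exact: lt_le_trans (ode_rate_ge1 B0).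
by field.
Qed.

Lemma shoot_det_ivt (path : R -> R * R) (a b L : R) : a <= b ->
  (forall t, a <= t <= b -> admissible (path t)) ->
  (forall t u, `|(path t).1 - (path u).1| + 2 * M * `|(path t).2 - (path u).2| <= L * `|t - u|) ->
  shoot_det (path a) <= 0 <= shoot_det (path b) \/
  shoot_det (path b) <= 0 <= shoot_det (path a) ->
  exists2 c, a <= c <= b & shoot_det (path c) = 0.
Proof.
move=> ab ap Lp h.
(* Clamping keeps the parameter in [a, b], where the path is known to be admissible. *)
have c k i : continuous (fun t => shoot' (path (clamp a b t)) k i T).
  have [L' hL'] := shoot'_lip k i.
  apply: (@lipschitz_cont _ _ (`|L'| * `|L|)) => t u.
  have at_ := ap _ (clamp_in t ab); have au := ap _ (clamp_in u ab).
  apply: le_trans (hL' _ _ at_ au) _; rewrite -[leRHS]mulrA.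
  have p0 t' u' : 0 <= `|(path t').1 - (path u').1| + 2 * M * `|(path t').2 - (path u').2|.
    by rewrite addr_ge0// mulr_ge0// mulr_ge0.
  apply: le_trans (ler_wpM2r (p0 _ _) (ler_norm L')) _.
  apply: ler_wpM2l => //; apply: le_trans (Lp _ _) _.
  apply: le_trans (ler_wpM2r (normr_ge0 _) (ler_norm L)) _.
  by apply: ler_wpM2l => //; exact: clamp_lip.
have cc : continuous (fun t => shoot_det (path (clamp a b t))).
  have c1 := c true true; have c2 := c true false.
  have c3 := c false true; have c4 := c false false.
  by rewrite /shoot_det; cont.
have [|x xab] := ivt_zero ab (continuous_subspaceT cc).
  by rewrite /= !clamp_id ?lexx ?ab.
by rewrite clamp_id//; exists x.
Qed.

Let shoot_comb p (c d : R) (i : bool) (x : R) : R :=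
  c * shoot p true i x + d * shoot p false i x.
Let shoot_comb' p (c d : R) (i : bool) (x : R) : R :=
  c * shoot' p true i x + d * shoot' p false i x.

Lemma shoot_comb_derive p c d i : admissible p ->
  [/\ shoot_comb p c d i 0 = c * e true i + d * e false i, shoot_comb' p c d i 0 = 0,
  forall x : R, is_derive x 1 (shoot_comb p c d i) (shoot_comb' p c d i x) &
  forall x : R, is_derive x 1 (shoot_comb' p c d i)
     (coef p.1 p.2 i true x * shoot_comb p c d true x +
      coef p.1 p.2 i false x * shoot_comb p c d false x)].
Proof.
move=> ap.
have [t0 t0' dt dt'] := shoot_derive true i ap.
have [f0 f0' df df'] := shoot_derive false i ap.
split.
- by rewrite /shoot_comb t0 f0.
- by rewrite /shoot_comb' t0' f0' !mulr0 addr0.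
- by move=> x; have := dt x; have := df x => ? ?; rewrite /shoot_comb /shoot_comb'; deriv; ring.
- move=> x; have := dt' x; have := df' x; rewrite /ode_rhs !big_bool => ? ?.
  by rewrite /shoot_comb'; deriv; rewrite /shoot_comb; ring.
Qed.

Lemma shoot_det_kernel p : shoot_det p = 0 -> exists c d : R, [/\ (c, d) != (0, 0),
  shoot_comb' p c d true T = 0 & shoot_comb' p c d false T = 0].
Proof.
rewrite /shoot_det /shoot_comb'.
set a := shoot' p true true T; set b := shoot' p false false T.
set q := shoot' p true false T; set r := shoot' p false true T => h.
have [a0|a0] := eqVneq a 0.
  have [q0|q0] := eqVneq q 0.
    exists 1, 0; rewrite a0 q0 !(mulr0, mul0r, addr0); split=> //.
    by rewrite xpair_eqE oner_eq0.
  exists b, (- q); split; last by ring.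
    by rewrite xpair_eqE oppr_eq0 (negPf q0) andbF.
  by move: h; lra.
exists r, (- a); split.
- by rewrite xpair_eqE oppr_eq0 (negPf a0) andbF.
- by ring.
- by move: h; lra.
Qed.

(** G is nondecreasing with equal end values, hence constant; [derive_zero] then gives g = 0, end
    points included. *)
Lemma mono_const (G g : R -> R) : G 0 = G T ->
  (forall x, 0 <= x <= T -> is_derive x 1 G (g x)) ->
  (forall x, 0 <= x <= T -> 0 <= g x) -> forall x, 0 <= x <= T -> g x = 0.
Proof.
move=> G0T dG g0.
have mono a b : 0 <= a -> a <= b -> b <= T -> G a <= G b.
  move=> a0 ab bT; apply: (@derive_ge0_le _ G g) => //.
  - by move=> x /andP[ax xb]; apply: dG; rewrite (le_trans a0 (ltW ax)) (le_trans (ltW xb)).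
  - apply: is_derive_within => x /andP[ax xb].
    by apply: dG; rewrite (le_trans a0 ax) (le_trans xb).
  - by move=> x /andP[ax xb]; apply: g0; rewrite (le_trans a0 (ltW ax)) (le_trans (ltW xb)).
have cst x : 0 <= x <= T -> G x - G 0 = 0.
  move=> /andP[x0 xT]; have := mono 0 x (lexx _) x0 xT; have := mono x T x0 xT (lexx _).
  by rewrite -G0T => h1 h2; apply/eqP; rewrite subr_eq0 eq_le h1 h2.
move=> x xT; have := dG x xT => ?.
have d : is_derive x 1 (fun y => G y - G 0) (g x) by deriv; ring.
exact: (derive_zero T0 cst xT d).
Qed.

(** For a Neumann solution the bracket u1' u2 - u1 u2' vanishes at 0 and T, while its derivative la
    (u1^2 + u2^2) + s (Vp - Vm) u1 u2 is at least u1^2 + u2^2 for la = M + 1. Hence u vanishes at 0,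
    where its value is (c, d). *)
Lemma shoot_det_top s : 0 <= s <= 1 -> shoot_det (top, s) != 0.
Proof.
move=> s01; apply/eqP => /shoot_det_kernel[c [d [cd ct cf]]].
have ap : admissible (top, s).
  by split=> //=; rewrite lexx andbT /top; have := M0; lra.
have [t0 t0' dt dt'] := shoot_comb_derive c d true ap.
have [f0 f0' df df'] := shoot_comb_derive c d false ap.
set u1 := shoot_comb _ _ _ true in t0 dt dt' df'.
set u2 := shoot_comb _ _ _ false in f0 df dt' df'.
set v1 := shoot_comb' _ _ _ true in ct t0' dt dt'.
set v2 := shoot_comb' _ _ _ false in cf f0' df df'.
pose g x := top * (u1 x ^+ 2 + u2 x ^+ 2) + s * (Vp x - Vm x) * (u1 x * u2 x).
have gle x : u1 x ^+ 2 + u2 x ^+ 2 <= g x.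
  have k : `|s * (Vp x - Vm x)| <= 2 * M.
    have [s0 s1] := andP s01; rewrite normrM (ger0_norm s0).
    have h : `|Vp x - Vm x| <= 2 * M.
      by apply: le_trans (ler_normB _ _) _; have := bVp x; have := bVm x; lra.
    by apply: le_trans h; rewrite ler_piMl.
  move: k; rewrite /g /top; set z := s * _.
  rewrite ler_norml => /andP[z1 z2].
  have q1 := sqr_ge0 (u1 x + u2 x); have q2 := sqr_ge0 (u1 x - u2 x).
  have p1 : 0 <= (2 * M - z) * (u1 x - u2 x) ^+ 2 by rewrite mulr_ge0//; lra.
  have p2 : 0 <= (2 * M + z) * (u1 x + u2 x) ^+ 2 by rewrite mulr_ge0//; lra.
  rewrite -subr_ge0.
  have -> : (M + 1) * (u1 x ^+ 2 + u2 x ^+ 2) + z * (u1 x * u2 x) -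
    (u1 x ^+ 2 + u2 x ^+ 2) = ((2 * M - z) * (u1 x - u2 x) ^+ 2 +
      (2 * M + z) * (u1 x + u2 x) ^+ 2) / 4 by field.
  by rewrite divr_ge0// addr_ge0.
have dG x : 0 <= x <= T -> is_derive x 1 (fun y => v1 y * u2 y - u1 y * v2 y) (g x).
  move=> _; have := dt x; have := dt' x; have := df x; have := df' x => /= ? ? ? ?.
  by deriv; rewrite /g; ring.
have g0 x : 0 <= x <= T -> 0 <= g x.
  by move=> _; apply: le_trans (gle x); rewrite addr_ge0// sqr_ge0.
have z0 : 0 <= (0 : R) <= T by rewrite lexx ltW.
have bdry : v1 0 * u2 0 - u1 0 * v2 0 = v1 T * u2 T - u1 T * v2 T.
  by rewrite t0' f0' ct cf !(mul0r, mulr0).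
have := mono_const bdry dG g0 z0.
have := gle 0; rewrite t0 f0 /e /= !(mulr0, mulr1, addr0, add0r) => h1 h2.
move: h1; rewrite h2 => h1.
have hc : c ^+ 2 == 0 by rewrite eq_le sqr_ge0 andbT; have := sqr_ge0 d; lra.
have hd : d ^+ 2 == 0 by rewrite eq_le sqr_ge0 andbT; have := sqr_ge0 c; lra.
by move: cd hc hd; rewrite xpair_eqE !sqrf_eq0 => /negP h3 hc hd; apply: h3; rewrite hc hd.
Qed.

Lemma shoot_det_top0 : 0 < shoot_det (top, 0).
Proof.
have top0 : 0 <= top by rewrite /top; have := M0; lra.
have ap : admissible (top, 0) by split; rewrite /= lexx ?top0 ?ler01.
have n0 : shoot_det (top, 0) != 0 by apply: shoot_det_top; rewrite lexx ler01.
rewrite lt_neqAle eq_sym n0 /=.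
have [wt st] := shootP true ap; have [wf sf] := shootP false ap.
(* This is multiplication of u1 + i u2 by i, which commutes with the system when s = 0. By
   uniqueness it carries the solution with data (1, 0) to the one with data (0, 1). *)
pose Z (i : bool) x := if i then - shoot (top, 0) true false x else shoot (top, 0) true true x.
have bA := coef_bounded ap; have [cA _] := bA; have [ct _] := wt.
have wZ : weighted B (C true) Z.
  split=> [i|i x].
    by case: i; rewrite /Z; [have := ct false => ?; cont|exact: ct].
  by case: i; rewrite /Z ?normrN; apply: wt.2.
have rE x : ode_rhs (coef top 0) Z true x = -1 * ode_rhs (coef top 0) (shoot (top, 0) true) false x.
  by rewrite /ode_rhs !big_bool /Z /=; ring.
have rE' x : ode_rhs (coef top 0) Z false x = ode_rhs (coef top 0) (shoot (top, 0) true) true x.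
  by rewrite /ode_rhs !big_bool /Z /=; ring.
have pE : prim (ode_rhs (coef top 0) Z true) =
    (fun x => -1 * prim (ode_rhs (coef top 0) (shoot (top, 0) true) false) x).
  rewrite -primZ; last exact: ode_rhs_cont.
  by congr prim; apply/funext => x; exact: rE.
have pE' : prim (ode_rhs (coef top 0) Z false) =
    prim (ode_rhs (coef top 0) (shoot (top, 0) true) true).
  by congr prim; apply/funext => x; exact: rE'.
have sZ : ode_sol (coef top 0) (e false) o Z.
  move=> i x; case: i.
    rewrite pE primZ; last by apply: prim_cont; exact: ode_rhs_cont.
    by rewrite /Z (st false x) /e /o /=; ring.
  by rewrite pE' /Z (st true x) /e /o /=; ring.
have ZE : shoot (top, 0) false = Z.
  apply/funext => i; apply/funext => x.
  exact: (ode_unique B0 bA wf wZ sf sZ).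
rewrite /shoot_det /shoot' /= ZE pE pE'.
set a := prim _ T; set b := prim _ T.
have -> : a * a - b * (-1 * b) = a ^+ 2 + b ^+ 2 by ring.
by rewrite addr_ge0// sqr_ge0.
Qed.

Lemma shoot_det_0 : shoot_det (0, 1) < 0.
Proof.
have ap : admissible (0, 1).
  by split; rewrite /= lexx ?ler01// andTb /top; have := M0; lra.
have [tt0 tt0' dtt dtt'] := shoot_derive true true ap.
have [tf0 tf0' dtf dtf'] := shoot_derive true false ap.
have [ff0 ff0' dff dff'] := shoot_derive false false ap.
have {dtt'} dtt' (x : R) : is_derive x 1 (shoot' (0, 1) true true) (Vp x * shoot (0, 1) true true x).
  have := dtt' x; rewrite /ode_rhs big_bool /= mul0r addr0.
  by have -> : Vm x + 1 * (Vp x - Vm x) = Vp x by ring.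
have {dtf'} dtf' (x : R) : is_derive x 1 (shoot' (0, 1) true false) (Vm x * shoot (0, 1) true false x).
  by have := dtf' x; rewrite /ode_rhs big_bool /= oppr0 mul0r add0r.
have {dff'} dff' (x : R) : is_derive x 1 (shoot' (0, 1) false false) (Vm x * shoot (0, 1) false false x).
  by have := dff' x; rewrite /ode_rhs big_bool /= oppr0 mul0r add0r.
rewrite /e /= in tt0 tf0 ff0.
have nt : shoot' (0, 1) true true T < 0.
  by apply: (Vp_neg (fun x _ => dtt x) (fun x _ => dtt' x)).
have pf : 0 < shoot' (0, 1) false false T.
  by apply: (Vm_pos (fun x _ => dff x) (fun x _ => dff' x)).
(* This component solves the L- equation with zero data. Were its slope at T nonzero, a multiple of
   it could be added to the normalized solution to cancel the slope there, against [Vm_pos]. *)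
have z : shoot' (0, 1) true false T = 0.
  apply/eqP/negP => /negP nz.
  pose k := - shoot' (0, 1) false false T / shoot' (0, 1) true false T.
  have d1 (x : R) : is_derive x 1 (fun y => shoot (0, 1) false false y + k * shoot (0, 1) true false y)
     (shoot' (0, 1) false false x + k * shoot' (0, 1) true false x).
    by have := dff x; have := dtf x => ? ?; deriv; ring.
  have d2 (x : R) : is_derive x 1 (fun y => shoot' (0, 1) false false y + k * shoot' (0, 1) true false y)
     (Vm x * (shoot (0, 1) false false x + k * shoot (0, 1) true false x)).
    by have := dff' x; have := dtf' x => ? ?; deriv; ring.
  have := Vm_pos (fun x _ => d1 x) (fun x _ => d2 x).
  rewrite ff0 tf0 ff0' tf0' !mulr0 !addr0 => /(_ erefl erefl).
  by rewrite /k divfK// subrr ltxx.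
by rewrite /shoot_det z mul0r subr0 nmulr_rlt0.
Qed.

Hypotheses (eVp : forall x, Vp (- x) = Vp x) (eVm : forall x, Vm (- x) = Vm x).

Lemma shoot_even p k i x : admissible p -> shoot p k i (- x) = shoot p k i x.
Proof.
move=> ap; have [wY sY] := shootP k ap; have [cY _] := wY.
have bA := coef_bounded ap; have [cA _] := bA.
pose Z i x := shoot p k i (- x).
have wZ : weighted B (C k) Z.
  split=> [j|j y]; first exact: cont_opp.
  by rewrite /Z -weight_even; exact: wY.2.
have sZ : ode_sol (coef p.1 p.2) (e k) o Z.
  move=> j y; have cr := ode_rhs_cont (i := j) cA cY; have cr' := prim_cont cr.
  rewrite (_ : ode_rhs _ Z j = (fun z => ode_rhs (coef p.1 p.2) (shoot p k) j (- z))).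
    rewrite prim_opp// (_ : (fun z => _) = (fun z => -1 * prim (ode_rhs (coef p.1 p.2)
      (shoot p k) j) (- z))); last by apply/funext => z; rewrite mulN1r.
    rewrite primZ; last exact: cont_opp.
    by rewrite prim_opp// /Z sY /o; ring.
  apply/funext => z; rewrite /ode_rhs !big_bool /Z.
  by case: j {cr cr'}; rewrite /= !eVm ?eVp.
exact: (ode_unique B0 bA wZ wY sZ sY).
Qed.

Lemma unstable_mode_exists : exists (la : R) (u1 u1' u2 u2' : R -> R),
  [/\ 0 < la, (u1 0, u2 0) != (0, 0), u1' 0 = 0 /\ u1' T = 0, u2' 0 = 0 /\ u2' T = 0 &
    (forall x : R, [/\ is_derive x 1 u1 (u1' x), is_derive x 1 u2 (u2' x),
      is_derive x 1 u1' (Vp x * u1 x + la * u2 x) &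
      is_derive x 1 u2' (Vm x * u2 x - la * u1 x)]) /\
    forall x, u1 (- x) = u1 x /\ u2 (- x) = u2 x].
Proof.
have top0 : 0 <= top by rewrite /top; have := M0; lra.
(* The determinant has no zero on the segment la = M + 1, 0 <= s <= 1, so its sign at s = 0
   persists. *)
have D1 : 0 < shoot_det (top, 1).
  rewrite ltNge; apply/negP => D1.
  have [||||c c01] := @shoot_det_ivt (fun t => (top, t)) 0 1 (2 * M) => //=.
  - by move=> t t01; split=> //=; rewrite top0 lexx.
  - by move=> t u; rewrite subrr normr0 add0r.
  - by right; rewrite D1 ltW// shoot_det_top0.
  - by move=> /eqP; rewrite (negPf (shoot_det_top c01)).
have [||||la lat D0] := @shoot_det_ivt (fun t => (t, 1)) 0 top 1 => //=.
- by move=> t t01; split=> //=; rewrite ler01 lexx.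
- by move=> t u; rewrite subrr normr0 mulr0 addr0 mul1r.
- by left; rewrite (ltW D1) ltW// shoot_det_0.
have ap : admissible (la, 1) by split=> //=; rewrite ler01 lexx.
have [c [d [cd ct cf]]] := shoot_det_kernel D0.
have [t0 t0' dt dt'] := shoot_comb_derive c d true ap.
have [f0 f0' df df'] := shoot_comb_derive c d false ap.
exists la, (shoot_comb (la, 1) c d true), (shoot_comb' (la, 1) c d true),
  (shoot_comb (la, 1) c d false), (shoot_comb' (la, 1) c d false).
split=> //.
- have [l0 _] := andP lat; rewrite lt_neqAle l0 andbT eq_sym.
  by apply/eqP => la0; have := shoot_det_0; rewrite la0 in D0; rewrite D0 ltxx.
- by rewrite t0 f0 /e /= !(mulr0, mulr1, addr0, add0r).
- split=> [x|x]; last by rewrite /shoot_comb !shoot_even.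
  split=> //.
  + have := dt' x; rewrite /=.
    by have -> : Vm x + 1 * (Vp x - Vm x) = Vp x by ring.
  + have := df' x; rewrite /=.
    by congr is_derive; ring.
Qed.

End shooting.

(** * The periodic Sobolev space *)

Section almost_everywhere.
Context {R : realType}.
Local Notation mu := (@lebesgue_measure R).

Lemma clamp_extend (f : R -> R) a b : a <= b -> {within `[a, b], continuous f} ->
  continuous (fun x => f (clamp a b x)).
Proof.
move=> ab /subspace_continuousP cf x.
have xab : `[a, b]%classic (clamp a b x) by rewrite /= in_itv/= clamp_in.
apply/cvgrPdist_lt => e e0.
have /cvgrPdist_lt/(_ e e0) := cf _ xab; rewrite near_withinE => h.
have /= := @clamp_cont _ a b x _ h.
rewrite !near_simpl => h'; near=> y.
have : `[a, b]%classic (clamp a b y) by rewrite /= in_itv/= clamp_in.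
by near: y.
Unshelve. all: by end_near.
Qed.

Lemma ae_eq_continuous (T : R) (f g : R -> R) : 0 < T -> continuous f -> continuous g ->
  ae_eq_on T f g -> forall x : R, x \in `[- T, T] -> f x = g x.
Proof.
move=> T0 cf cg fg x xT; apply/eqP/negP => /negP neq.
have : \forall y \near x, f y - g y != 0.
  by apply: (cvgr_neq0 _ (cvgB (cf x) (cg x))); rewrite subr_eq0.
move=> /nbhs_ballP[e /= e0 he].
move: xT; rewrite in_itv/= => /andP[xl xr].
pose a := Num.max (- T) (x - e); pose b := Num.min T (x + e).
have ab : a < b by rewrite /a /b lt_min !gt_max; lra.
have sub : `]a, b[%classic `<=` ~` [set y | y \in `[- T, T] -> f y = g y].
  move=> y /=; rewrite in_itv/= /a /b gt_max lt_min => /andP[/andP[y1 y2] /andP[y3 y4]] h.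
  have := he y; rewrite /ball/= h ?subrr ?eqxx.
    by move=> /(_ _)/negP; apply=> //; rewrite ltr_norml; apply/andP; split; lra.
  by rewrite in_itv/=; apply/andP; split; lra.
have ng : mu.-negligible (~` [set y : R | y \in `[- T, T] -> f y = g y]) by exact: fg.
have : mu `]a, b[%classic = 0%E.
  apply: measure_negligible; first exact: measurable_itv.
  case: ng => N [mN N0 sN]; exists N; split => //; exact: subset_trans sub sN.
rewrite lebesgue_measure_itv/= lte_fin ab -EFinB => -[] /eqP.
by rewrite subr_eq0 gt_eqF.
Qed.

(** On a bounded interval |f| <= |f|^2 + 1 is enough. *)
Lemma L2_integrable (T : R) (f : R -> R) : f \_ `[- T, T] \in Lfun mu 2%:E ->
  mu.-integrable `[- T, T] (EFin \o f).
Proof.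
move=> Lf.
have i1 : mu.-integrable `[- T, T] (fun x => (`|(f \_ `[- T, T]) x| `^ 2)%:E).
  by apply: integrableS (Lfun_integrable _ Lf) => //; rewrite ler1n.
have i2 : mu.-integrable `[- T, T] (EFin \o cst (1 : R)).
  by apply: cont_integrable => x; exact: cvg_cst.
have mf : measurable_fun setT (f \_ `[- T, T]).
  by move: Lf; rewrite inE => /andP[/[!inE]].
apply: le_integrable (integrableD _ i2 i1) => //.
  apply/measurable_EFinP; apply/(measurable_restrictT _ _).2 => //.
move=> x xT /=; rewrite lee_fin patchE mem_set//.
rewrite powR_mulrn//.
set z := `|f x|; have z0 : 0 <= z := normr_ge0 _. 
rewrite [leRHS]ger0_norm; last by apply: addr_ge0 => //; exact: sqr_ge0.
have := sqr_ge0 (z - 1); have : 0 <= z by []; have := sqr_ge0 z.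
by rewrite sqrrB1 mulr2n; lra.
Qed.

Lemma continuous_L2 (T : R) (f : R -> R) : continuous f ->
  f \_ `[- T, T] \in Lfun mu 2%:E.
Proof.
move=> cf.
have mf : measurable_fun setT (f \_ `[- T, T]).
  apply/(measurable_restrictT _ _).1 => //.
  by apply: measurable_funTS; exact: continuous_measurable_fun.
rewrite inE; apply/andP; split; rewrite inE//=.
rewrite /finite_norm unlock poweR_lty//.
have ci : continuous (fun x => f x ^+ 2) by cont.
have i : mu.-integrable [set: R] (EFin \o ((fun x => f x ^+ 2) \_ `[- T, T])).
  rewrite -restrict_EFin; apply/integrable_restrict => //=; rewrite setTI.
  exact: cont_integrable.
under eq_integral => x _.
  rewrite /= powR_mulrn//. 
  rewrite (_ : `|(f \_ `[- T, T]) x| ^+ 2 = ((fun x => f x ^+ 2) \_ `[- T, T]) x); last first.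
    by rewrite real_normK ?num_real// !patchE; case: ifP => // _; rewrite expr0n.
  over.
exact: integrable_lty i.
Qed.

End almost_everywhere.

Section periodic_sobolev.
Context {R : realType}.
Local Notation mu := (@lebesgue_measure R).
Variable T : R.
Hypothesis T0 : 0 < T.

Let TT : - T <= T. Proof. by have := T0; lra. Qed.

Lemma H2per_continuous f f2 : H2per T f f2 ->
  exists2 F : R -> R, continuous F & forall x : R, x \in `[- T, T] -> f x = F x.
Proof.
move=> [f1 [Lf2 f1E fE _ _]].
have i2 := L2_integrable Lf2.
have c1 := clamp_extend TT (parameterized_integral_continuous TT i2).
pose F1 x := f1 (- T) + parameterized_integral mu (- T) (clamp (- T) T x) f2.
have cF1 : continuous F1 by rewrite /F1; apply: contD => //; exact: contC.
exists (fun x => f (- T) + (prim F1 x - prim F1 (- T))).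
  by have := prim_cont cF1 => ?; cont.
move=> x xT; rewrite fE//; congr (_ + _).
rewrite -integral_prim//; last by move: xT; rewrite in_itv/= => /andP[].
apply: eq_Rintegral => y; rewrite inE/= in_itv/= => /andP[yl yx].
have yT : - T <= y <= T.
  by move: xT; rewrite in_itv/= yl/= => /andP[_]; exact: le_trans.
by rewrite f1E ?in_itv//= /F1 clamp_id.
Qed.

Lemma ae_eq_Rintegral (a b : R) (f g : R -> R) :
  mu.-integrable `[a, b] (EFin \o f) -> mu.-integrable `[a, b] (EFin \o g) ->
  {ae mu, forall x : R, x \in `[a, b] -> f x = g x} ->
  \int[mu]_(x in `[a, b]) f x = \int[mu]_(x in `[a, b]) g x.
Proof.
move=> /integrableP[mf _] /integrableP[mg _] fg; rewrite /Rintegral; congr fine.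
apply: ae_eq_integral => //.
case: fg => N [mN N0 sN]; exists N; split => //; apply: subset_trans sN => x /=.
by apply: contra_not => h xab; congr EFin; exact: h.
Qed.

(** Regularity: primitives of the continuous [G] replace those of [f2]. They also extend [f] beyond
    [-T, T], which provides two-sided derivatives at the end points. *)
Lemma H2per_classical f f2 (G : R -> R) : H2per T f f2 -> continuous G ->
  ae_eq_on T f2 G -> exists F F1 : R -> R,
  [/\ forall x : R, is_derive x 1 F (F1 x), forall x : R, is_derive x 1 F1 (G x),
     forall x : R, x \in `[- T, T] -> f x = F x, F T = F (- T) & F1 T = F1 (- T)].
Proof.
move=> [f1 [Lf2 f1E fE fT f1T]] cG f2G.
have i2 := L2_integrable Lf2.
pose F1 x := f1 (- T) + (prim G x - prim G (- T)).
have dF1 (x : R) : is_derive x 1 F1 (G x).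
  by have ? := prim_is_derive x cG; rewrite /F1; deriv; ring.
have cF1 : continuous F1 by exact: is_derive_continuous dF1.
pose F x := f (- T) + (prim F1 x - prim F1 (- T)).
have dF (x : R) : is_derive x 1 F (F1 x).
  by have ? := prim_is_derive x cF1; rewrite /F; deriv; ring.
have f1F x : x \in `[- T, T] -> f1 x = F1 x.
  move=> xT; rewrite f1E//; congr (_ + _).
  move: xT; rewrite in_itv/= => /andP[xl xr].
  have sub : `[- T, x]%classic `<=` `[- T, T]%classic by apply: subset_itvl; rewrite bnd_simp.
  rewrite -integral_prim//; apply: ae_eq_Rintegral.
  - by apply: integrableS i2.
  - exact: cont_integrable.
  - case: f2G => N [mN N0 sN]; exists N; split => //; apply: subset_trans sN => y /=.
    by apply: contra_not => h yx; apply: h; exact: sub.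
have fF x : x \in `[- T, T] -> f x = F x.
  move=> xT; rewrite fE//; congr (_ + _).
  rewrite -integral_prim//; last by move: xT; rewrite in_itv/= => /andP[].
  apply: eq_Rintegral => y; rewrite inE/= in_itv/= => /andP[yl yx]; apply: f1F.
  move: xT; rewrite !in_itv/= yl/= => /andP[_]; exact: le_trans.
have inl : - T \in `[- T, T] by rewrite in_itv/= lexx TT.
have inr : T \in `[- T, T] by rewrite in_itv/= lexx TT.
by exists F, F1; split => //; rewrite -?fF -?f1F.
Qed.

Lemma classical_H2per (F F1 G : R -> R) : continuous G ->
  (forall x : R, is_derive x 1 F (F1 x)) -> (forall x : R, is_derive x 1 F1 (G x)) ->
  F T = F (- T) -> F1 T = F1 (- T) -> H2per T F G.
Proof.
move=> cG dF dF1 FT F1T.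
have cF1 : continuous F1 by exact: is_derive_continuous dF1.
exists F1; split => //; first exact: continuous_L2.
- move=> x; rewrite in_itv/= => /andP[xl _]; rewrite integral_prim//.
  have := derive_unique xl (fun y _ => prim_is_derive y cG) (fun y _ => dF1 y).
  by move=> ->; ring.
- move=> x; rewrite in_itv/= => /andP[xl _]; rewrite integral_prim//.
  have := derive_unique xl (fun y _ => prim_is_derive y cF1) (fun y _ => dF y).
  by move=> ->; ring.
Qed.

End periodic_sobolev.

(** * Reduction of JL to real systems *)

Section complex_vectors.
Local Open Scope complex_scope.
Context {R : realType}.
Local Notation mu := (@lebesgue_measure R).
Implicit Types (a b c d : R -> R).

Definition cvec a1 a2 b1 b2 (x : R) : 'cV[R[i]]_2 :=
  \col_i (if i == 0 then a1 x +i* b1 x else a2 x +i* b2 x).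

Lemma cvec_eqP (v : 'cV[R[i]]_2) a1 a2 b1 b2 x :
  v = cvec a1 a2 b1 b2 x <->
  [/\ complex.Re (v 0 0) = a1 x, complex.Im (v 0 0) = b1 x,
      complex.Re (v 1 0) = a2 x & complex.Im (v 1 0) = b2 x].
Proof.
split=> [->|[h1 h2 h3 h4]]; first by rewrite !mxE.
apply/matrixP => i j; rewrite (ord1 j) !mxE.
have [->|i0] := eqVneq i 0; first by rewrite -h1 -h2; case: (v 0 0).
have -> : i = 1 by apply: val_inj; move: i0; case: i => -[|[|]].
by rewrite -h3 -h4; case: (v 1 0).
Qed.

Lemma J_mxE (w : 'cV[R[i]]_2) : (J_mx *m w) 0 0 = w 1 0 /\ (J_mx *m w) 1 0 = - w 0 0.
Proof.
have l01 : lift ord0 ord0 = 1 :> 'I_2 by apply: val_inj.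
split; rewrite !mxE big_ord_recl big_ord1 !mxE /= l01; first by ring.
by have -> : ord0 = 0 :> 'I_2 by []; ring.
Qed.

Lemma ReN (z : R[i]) : complex.Re (- z) = - complex.Re z.
Proof. by case: z. Qed.

Lemma ImN (z : R[i]) : complex.Im (- z) = - complex.Im z.
Proof. by case: z. Qed.

Lemma Re_L_plus phi f f2 (x : R) : complex.Re (L_plus phi f f2 x) =
  - complex.Re (f2 x) + complex.Re (f x) - 6 * phi x ^+ 2 * complex.Re (f x).
Proof. by rewrite /L_plus; case: (f x) => ? ?; case: (f2 x) => ? ? /=; ring. Qed.

Lemma Im_L_plus phi f f2 (x : R) : complex.Im (L_plus phi f f2 x) =
  - complex.Im (f2 x) + complex.Im (f x) - 6 * phi x ^+ 2 * complex.Im (f x).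
Proof. by rewrite /L_plus; case: (f x) => ? ?; case: (f2 x) => ? ? /=; ring. Qed.

Lemma Re_L_minus phi f f2 (x : R) : complex.Re (L_minus phi f f2 x) =
  - complex.Re (f2 x) + complex.Re (f x) - 2 * phi x ^+ 2 * complex.Re (f x).
Proof. by rewrite /L_minus; case: (f x) => ? ?; case: (f2 x) => ? ? /=; ring. Qed.

Lemma Im_L_minus phi f f2 (x : R) : complex.Im (L_minus phi f f2 x) =
  - complex.Im (f2 x) + complex.Im (f x) - 2 * phi x ^+ 2 * complex.Im (f x).
Proof. by rewrite /L_minus; case: (f x) => ? ?; case: (f2 x) => ? ? /=; ring. Qed.

Lemma JL_L_diagE phi v v2 (x : R) (w : 'cV[R[i]]_2) :
  w = J_mx *m L_diag phi v v2 x <->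
  w 0 0 = L_minus phi (fun y => v y 1 0) (fun y => v2 y 1 0) x /\
  w 1 0 = - L_plus phi (fun y => v y 0 0) (fun y => v2 y 0 0) x.
Proof.
have [h1 h2] := J_mxE (L_diag phi v v2 x).
have -> : L_minus phi (fun y => v y 1 0) (fun y => v2 y 1 0) x =
  (J_mx *m L_diag phi v v2 x) 0 0 by rewrite h1 !mxE.
have -> : - L_plus phi (fun y => v y 0 0) (fun y => v2 y 0 0) x =
  (J_mx *m L_diag phi v v2 x) 1 0 by rewrite h2 !mxE.
split=> [->//|[w0 w1]]; apply/matrixP => i j; rewrite (ord1 j).
have [->//|i0] := eqVneq i 0.
by have -> : i = 1 by apply: val_inj; move: i0; case: i => -[|[|]].
Qed.

End complex_vectors.

Section classical_system.
Local Open Scope complex_scope.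
Context {R : realType}.
Local Notation mu := (@lebesgue_measure R).
Variables (T : R) (phi Vp Vm : R -> R).
Hypothesis T0 : 0 < T.
Hypotheses (cVp : continuous Vp) (cVm : continuous Vm).
Hypothesis VpE : forall x : R, x \in `[- T, T] -> Vp x = 1 - 6 * phi x ^+ 2.
Hypothesis VmE : forall x : R, x \in `[- T, T] -> Vm x = 1 - 2 * phi x ^+ 2.
Hypotheses (Vp_even : forall x, Vp (- x) = Vp x) (Vm_even : forall x, Vm (- x) = Vm x).
Implicit Types u w : R -> R.

(** Real form of w = JL u on a whole period, in the classical sense: w1 = L- u2 and w2 = - L+ u1 on
    [-T, T]. *)
Definition psys u1 u2 w1 w2 := [/\ continuous w1, continuous w2 &
  exists u1' u2' : R -> R,
  [/\ forall x : R, is_derive x 1 u1 (u1' x) /\ is_derive x 1 u2 (u2' x),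
      forall x : R, x \in `[- T, T] -> is_derive x 1 u1' (Vp x * u1 x + w2 x) /\
        is_derive x 1 u2' (Vm x * u2 x - w1 x),
      u1 T = u1 (- T) /\ u2 T = u2 (- T) & u1' T = u1' (- T) /\ u2' T = u2' (- T)]].

Lemma psys_cont u1 u2 w1 w2 : psys u1 u2 w1 w2 -> continuous u1 /\ continuous u2.
Proof.
move=> [_ _ [u1' [u2' [d _ _ _]]]]; split.
  by apply: (@is_derive_continuous _ _ u1') => x; case: (d x).
by apply: (@is_derive_continuous _ _ u2') => x; case: (d x).
Qed.

Lemma psys_ext u1 u2 w1 w2 z1 z2 : psys u1 u2 w1 w2 -> continuous z1 -> continuous z2 ->
  (forall x : R, x \in `[- T, T] -> w1 x = z1 x /\ w2 x = z2 x) -> psys u1 u2 z1 z2.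
Proof.
move=> [_ _ [u1' [u2' [d d' p p']]]] cz1 cz2 wz; split=> //; exists u1', u2'; split=> // x xT.
by have [<- <-] := wz x xT; exact: d'.
Qed.

(** Bootstrap: elements of the Sobolev space are continuous on [-T, T], so the equation makes their
    second derivatives continuous up to a null set. *)
Lemma H2per_psys f1 f2 g1 g2 (c1 c2 : R -> R) :
  H2per T f1 g1 -> H2per T f2 g2 -> continuous c1 -> continuous c2 ->
  {ae mu, forall x : R, x \in `[- T, T] ->
    c1 x = - g2 x + f2 x - 2 * phi x ^+ 2 * f2 x /\
    c2 x = g1 x - f1 x + 6 * phi x ^+ 2 * f1 x} ->
  exists u1 u2, psys u1 u2 c1 c2 /\
    forall x : R, x \in `[- T, T] -> f1 x = u1 x /\ f2 x = u2 x.
Proof.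
move=> h1 h2 cc1 cc2 ae.
have [F1 cF1 fF1] := H2per_continuous T0 h1; have [F2 cF2 fF2] := H2per_continuous T0 h2.
have cG1 : continuous (fun x => Vp x * F1 x + c2 x) by cont.
have cG2 : continuous (fun x => Vm x * F2 x - c1 x) by cont.
have ae1 : ae_eq_on T g1 (fun x => Vp x * F1 x + c2 x).
  apply: filterS ae; first exact: (ae_filter_ringOfSetsType mu).
  by move=> x h xT; have [_ ->] := h xT; rewrite VpE// -fF1//; ring.
have ae2 : ae_eq_on T g2 (fun x => Vm x * F2 x - c1 x).
  apply: filterS ae; first exact: (ae_filter_ringOfSetsType mu).
  by move=> x h xT; have [-> _] := h xT; rewrite VmE// -fF2//; ring.
have [u1 [u1' [d1 d1' e1 p1 p1']]] := H2per_classical T0 h1 cG1 ae1.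
have [u2 [u2' [d2 d2' e2 p2 p2']]] := H2per_classical T0 h2 cG2 ae2.
exists u1, u2; split; last by move=> x xT; rewrite e1// e2.
split=> //; exists u1', u2'; split=> // x xT.
have := d1' x; have := d2' x.
by rewrite -fF1// -fF2// e1// e2.
Qed.

Lemma JL_continuous v W : JL T phi v W -> exists a1 a2 b1 b2 : R -> R,
  [/\ continuous a1, continuous a2, continuous b1 & continuous b2] /\
  forall x : R, x \in `[- T, T] -> v x = cvec a1 a2 b1 b2 x.
Proof.
move=> [v2 [h _]].
have [/(H2per_continuous T0)[a1 ca1 e1] /(H2per_continuous T0)[b1 cb1 k1]] := h 0.
have [/(H2per_continuous T0)[a2 ca2 e2] /(H2per_continuous T0)[b2 cb2 k2]] := h 1.
exists a1, a2, b1, b2; split=> // x xT; apply/cvec_eqP.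
by rewrite e1// k1// e2// k2.
Qed.

Lemma JL_psys v W (c1 c2 d1 d2 : R -> R) : JL T phi v W ->
  continuous c1 -> continuous c2 -> continuous d1 -> continuous d2 ->
  ae_eq_on T W (cvec c1 c2 d1 d2) ->
  exists a1 a2 b1 b2 : R -> R, [/\ psys a1 a2 c1 c2, psys b1 b2 d1 d2 &
    forall x : R, x \in `[- T, T] -> v x = cvec a1 a2 b1 b2 x].
Proof.
move=> [v2 [h ae]] cc1 cc2 cd1 cd2 aW.
have [h1 k1] := h 0; have [h2 k2] := h 1.
have ae2 : {ae mu, forall x : R, x \in `[- T, T] ->
    cvec c1 c2 d1 d2 x = J_mx *m L_diag phi v v2 x}.
  apply: filterS2 ae aW; first exact: (ae_filter_ringOfSetsType mu).
  by move=> x e1 e2 xT; rewrite -e1// e2.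
have [|a1 [a2 [sa ea]]] := H2per_psys h1 h2 cc1 cc2.
  apply: filterS ae2; first exact: (ae_filter_ringOfSetsType mu).
  move=> x e xT; have /JL_L_diagE := e xT; rewrite !mxE/= => -[].
  move=> /(congr1 (@complex.Re R)); rewrite Re_L_minus/= => ->.
  move=> /(congr1 (@complex.Re R)); rewrite ReN Re_L_plus/= => ->.
  by split=> //; ring.
have [|b1 [b2 [sb eb]]] := H2per_psys k1 k2 cd1 cd2.
  apply: filterS ae2; first exact: (ae_filter_ringOfSetsType mu).
  move=> x e xT; have /JL_L_diagE := e xT; rewrite !mxE/= => -[].
  move=> /(congr1 (@complex.Im R)); rewrite Im_L_minus/= => ->.
  move=> /(congr1 (@complex.Im R)); rewrite ImN Im_L_plus/= => ->.
  by split=> //; ring.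
exists a1, a2, b1, b2; split=> // x xT; apply/cvec_eqP.
by have [-> ->] := ea x xT; have [-> ->] := eb x xT.
Qed.

(** Real and imaginary parts of (JL - la) v = w. As v also occurs on the right, it is first replaced
    there by a continuous representative; the functions that the equation then yields agree with
    this one on [-T, T]. *)
Lemma JL_shift_psys v (w : R -> 'cV[R[i]]_2) (la : R[i]) (r1 r2 s1 s2 : R -> R) :
  JL T phi v (fun x => la *: v x + w x) ->
  continuous r1 -> continuous r2 -> continuous s1 -> continuous s2 ->
  ae_eq_on T w (cvec r1 r2 s1 s2) ->
  let al := complex.Re la in let be := complex.Im la in
  exists a1 a2 b1 b2 : R -> R,
  [/\ psys a1 a2 (fun x => al * a1 x + - be * b1 x + r1 x)
                 (fun x => al * a2 x + - be * b2 x + r2 x),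
      psys b1 b2 (fun x => be * a1 x + al * b1 x + s1 x)
                 (fun x => be * a2 x + al * b2 x + s2 x) &
    forall x : R, x \in `[- T, T] -> v x = cvec a1 a2 b1 b2 x].
Proof.
move=> jl cr1 cr2 cs1 cs2 aw al be.
have [a1 [a2 [b1 [b2 [[ca1 ca2 cb1 cb2] vE]]]]] := JL_continuous jl.
have [|||||a1' [a2' [b1' [b2' [sa sb vE']]]]] := @JL_psys _ _
  (fun x => al * a1 x + - be * b1 x + r1 x) (fun x => al * a2 x + - be * b2 x + r2 x)
  (fun x => be * a1 x + al * b1 x + s1 x) (fun x => be * a2 x + al * b2 x + s2 x) jl;
  [by cont..| |].
  apply: filterS aw; first exact: (ae_filter_ringOfSetsType mu).
  move=> x e xT; rewrite e// vE//; apply/cvec_eqP.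
  by rewrite /al /be !mxE/=; case: la {jl al be} => p q /=; split; ring.
have ab x : x \in `[- T, T] -> [/\ a1 x = a1' x, b1 x = b1' x, a2 x = a2' x & b2 x = b2' x].
  by move=> xT; have := vE' x xT; rewrite vE// => /cvec_eqP; rewrite !mxE.
have [ca1' ca2'] := psys_cont sa; have [cb1' cb2'] := psys_cont sb.
exists a1', a2', b1', b2'; split=> //.
  by apply: psys_ext sa _ _ _; [by cont..|] => x xT; have [-> -> -> ->] := ab x xT.
by apply: psys_ext sb _ _ _; [by cont..|] => x xT; have [-> -> -> ->] := ab x xT.
Qed.

Definition even_part u (x : R) : R := 2^-1 * (u x + u (- x)).
Definition odd_part u (x : R) : R := 2^-1 * (u x - u (- x)).

(** The derivative of an even part is the odd part of the derivative, which vanishes at 0, and at T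
    by periodicity. In [psys_odd] the functions themselves vanish there. *)
Lemma psys_even u1 u2 w1 w2 : psys u1 u2 w1 w2 ->
  sys T Vp Vm true (even_part u1) (even_part u2) (even_part w1) (even_part w2).
Proof.
move=> hs; have [cu1 cu2] := psys_cont hs.
have [cw1 cw2 [u1' [u2' [d d' [p1 p2] [p1' p2']]]]] := hs.
have ce u : continuous u -> continuous (even_part u).
  by move=> cu; have := cont_opp cu => ?; rewrite /even_part; cont.
have itv x : 0 <= x <= T -> x \in `[- T, T] /\ - x \in `[- T, T].
  by move=> /andP[x0 xT]; rewrite !in_itv/=; split; apply/andP; split; have := T0; lra.
exists (odd_part u1'), (odd_part u2'); split.
- split; [exact: ce|by have := ce _ cw2 => ?; cont| |] => x xT; have [i1 i2] := itv x xT.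
    have [h1 _] := d x; have [/is_derive_opp h2 _] := d (- x).
    by rewrite /even_part /odd_part; deriv; ring.
  have [h1 _] := d' x i1; have [h2 _] := d' (- x) i2.
  have h3 := is_derive_opp h2.
  by rewrite /even_part /odd_part; deriv; rewrite Vp_even; ring.
- split; [exact: ce|exact: ce| |] => x xT; have [i1 i2] := itv x xT.
    have [_ h1] := d x; have [_ /is_derive_opp h2] := d (- x).
    by rewrite /even_part /odd_part; deriv; ring.
  have [_ h1] := d' x i1; have [_ h2] := d' (- x) i2.
  have h3 := is_derive_opp h2.
  by rewrite /even_part /odd_part; deriv; rewrite Vm_even; ring.
- by rewrite /bc /odd_part oppr0 subrr p1' subrr mulr0.
- by rewrite /bc /odd_part oppr0 subrr p2' subrr mulr0.
Qed.

Lemma psys_odd u1 u2 w1 w2 : psys u1 u2 w1 w2 ->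
  sys T Vp Vm false (odd_part u1) (odd_part u2) (odd_part w1) (odd_part w2).
Proof.
move=> hs; have [cu1 cu2] := psys_cont hs.
have [cw1 cw2 [u1' [u2' [d d' [p1 p2] [p1' p2']]]]] := hs.
have ce u : continuous u -> continuous (odd_part u).
  by move=> cu; have := cont_opp cu => ?; rewrite /odd_part; cont.
have itv x : 0 <= x <= T -> x \in `[- T, T] /\ - x \in `[- T, T].
  by move=> /andP[x0 xT]; rewrite !in_itv/=; split; apply/andP; split; have := T0; lra.
exists (even_part u1'), (even_part u2'); split.
- split; [exact: ce|by have := ce _ cw2 => ?; cont| |] => x xT; have [i1 i2] := itv x xT.
    have [h1 _] := d x; have [/is_derive_opp h2 _] := d (- x).
    by rewrite /even_part /odd_part; deriv; ring.
  have [h1 _] := d' x i1; have [h2 _] := d' (- x) i2.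
  have h3 := is_derive_opp h2.
  by rewrite /even_part /odd_part; deriv; rewrite Vp_even; ring.
- split; [exact: ce|exact: ce| |] => x xT; have [i1 i2] := itv x xT.
    have [_ h1] := d x; have [_ /is_derive_opp h2] := d (- x).
    by rewrite /even_part /odd_part; deriv; ring.
  have [_ h1] := d' x i1; have [_ h2] := d' (- x) i2.
  have h3 := is_derive_opp h2.
  by rewrite /even_part /odd_part; deriv; rewrite Vm_even; ring.
- by rewrite /bc /odd_part oppr0 subrr p1 subrr mulr0.
- by rewrite /bc /odd_part oppr0 subrr p2 subrr mulr0.
Qed.

End classical_system.

(** * The unstable eigenvalue *)

Section instability.
Local Open Scope complex_scope.
Context {R : realType}.
Local Notation mu := (@lebesgue_measure R).
Variables (T M x0 : R) (phi Vp Vm : R -> R).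
Hypotheses (T0 : 0 < T) (M0 : 0 <= M).
Hypotheses (cVp : continuous Vp) (cVm : continuous Vm).
Hypotheses (bVp : forall x, `|Vp x| <= M) (bVm : forall x, `|Vm x| <= M).
Hypothesis VpE : forall x : R, x \in `[- T, T] -> Vp x = 1 - 6 * phi x ^+ 2.
Hypothesis VmE : forall x : R, x \in `[- T, T] -> Vm x = 1 - 2 * phi x ^+ 2.
Hypotheses (Vp_even : forall x, Vp (- x) = Vp x) (Vm_even : forall x, Vm (- x) = Vm x).
Hypothesis Vm_pos : forall y y' : R -> R,
  (forall x : R, 0 <= x <= T -> is_derive x 1 y (y' x)) ->
  (forall x : R, 0 <= x <= T -> is_derive x 1 y' (Vm x * y x)) ->
  y 0 = 1 -> y' 0 = 0 -> 0 < y' T.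
Hypothesis Vp_neg : forall y y' : R -> R,
  (forall x : R, 0 <= x <= T -> is_derive x 1 y (y' x)) ->
  (forall x : R, 0 <= x <= T -> is_derive x 1 y' (Vp x * y x)) ->
  y 0 = 1 -> y' 0 = 0 -> y' T < 0.
Hypothesis Lm_ge0 : forall b f f' F, sl_sol T Vm f f' F -> bc T b f f' -> 0 <= dot T f F.
Hypothesis Lm_eq0 : forall b f f' F, sl_sol T Vm f f' F -> bc T b f f' -> dot T f F = 0 ->
  forall x, 0 <= x <= T -> f x = 0.
Hypothesis Lp_dirichlet : forall f f' F, sl_sol T Vp f f' F -> bc T false f f' -> 0 <= dot T f F.
Hypothesis x0T : 0 <= x0 <= T.
Hypothesis Lp_neumann : forall f f' F, sl_sol T Vp f f' F -> bc T true f f' -> f x0 = 0 ->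
  0 <= dot T f F.

Let inT x : 0 <= x <= T -> x \in `[- T, T] /\ - x \in `[- T, T].
Proof. by move=> /andP[h1 h2]; rewrite !in_itv/=; split; apply/andP; split; have := T0; lra. Qed.

Let zero_parts u : zero_on T (even_part u) -> zero_on T (odd_part u) ->
  forall x : R, x \in `[- T, T] -> u x = 0.
Proof.
move=> ze zo x; rewrite in_itv/= => /andP[xl xr].
have [h|h] := leP 0 x.
  have xT : 0 <= x <= T by rewrite h.
  by have := ze x xT; have := zo x xT; rewrite /even_part /odd_part; lra.
have xT : 0 <= - x <= T by apply/andP; split; lra.
by have := ze _ xT; have := zo _ xT; rewrite /even_part /odd_part opprK; lra.
Qed.

Let even_odd u : zero_on T (odd_part u) -> forall x : R, x \in `[- T, T] -> u x = even_part u x.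
Proof.
move=> zo x; rewrite in_itv/= => /andP[xl xr].
have [h|h] := leP 0 x.
  have xT : 0 <= x <= T by rewrite h.
  by have := zo x xT; rewrite /even_part /odd_part; lra.
have xT : 0 <= - x <= T by apply/andP; split; lra.
by have := zo _ xT; rewrite /even_part /odd_part opprK; lra.
Qed.

Let even_part_even (u : R -> R) (x : R) : even_part u (- x) = even_part u x.
Proof. by rewrite /even_part opprK addrC. Qed.

Theorem single_real_unstable_eigenvalue : exists lam : R[i],
  [/\ is_eigenvalue T phi lam, 0 < complex.Re lam, complex.Im lam = 0,
    algebraic_multiplicity T phi lam 1 &
    forall m : R[i], is_eigenvalue T phi m -> 0 < complex.Re m -> m = lam].
Proof.
have [la [e1 [e1' [e2 [e2' [la0 e00 [p1 q1] [p2 q2] [de ee]]]]]]] :=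
  unstable_mode_exists T0 M0 cVp cVm bVp bVm Vm_pos Vp_neg Vp_even Vm_even.
have ce1 : continuous e1 by apply: (@is_derive_continuous _ _ e1') => x; case: (de x).
have ce2 : continuous e2 by apply: (@is_derive_continuous _ _ e2') => x; case: (de x).
(* The derivative of an even function is odd, so the Neumann condition also holds at -T and the mode
   is periodic. *)
have odd (u u' : R -> R) : (forall x : R, is_derive x 1 u (u' x)) ->
    (forall x : R, u (- x) = u x) -> u' T = 0 -> u' (- T) = 0.
  move=> du eu uT; have := is_derive_opp (du (- T)).
  rewrite (_ : (fun y => u (- y)) = u); last by apply/funext => y; rewrite eu.
  move=> h; have h' := du (- T).
  have h2 := is_derive_opp (du (- - T)).
  rewrite opprK (_ : (fun y => u (- y)) = u) in h2; last by apply/funext => y; rewrite eu.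
  rewrite uT oppr0 in h2.
  by rewrite -(@derive_val _ _ _ _ _ _ _ h') (@derive_val _ _ _ _ _ _ _ h2).
have r1 : e1' (- T) = 0.
  by apply: (odd e1) => // x; [case: (de x)|case: (ee x)].
have r2 : e2' (- T) = 0.
  by apply: (odd e2) => // x; [case: (de x)|case: (ee x)].
have pe : psys T Vp Vm e1 e2 (fun x => la * e1 x) (fun x => la * e2 x).
  split; [by cont..|]; exists e1', e2'; split.
  - by move=> x; case: (de x).
  - by move=> x _; case: (de x).
  - by rewrite (ee T).1 (ee T).2.
  - by rewrite q1 q2 r1 r2.
have evE (u : R -> R) : (forall x : R, u (- x) = u x) -> even_part u = u.
  by move=> h; apply/funext => x; rewrite /even_part h; field.
have se : sys T Vp Vm true e1 e2 (fun x => la * e1 x) (fun x => la * e2 x).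
  have := psys_even T0 Vp_even Vm_even pe.
  by rewrite !evE// => x; have [h1 h2] := ee x; rewrite ?h1 ?h2.
have z0 : 0 <= (0 : R) <= T by rewrite lexx ltW.
have ne : ~ (zero_on T e1 /\ zero_on T e2).
  move=> [/(_ _ z0) h1 /(_ _ z0) h2]; move: e00; rewrite h1 h2 eqxx.
  by [].
have ex0 : e1 x0 != 0.
  by apply/eqP => h; apply: ne; exact: (sys_neumann_vanish T0 Lm_ge0 Lm_eq0 Lp_neumann la0 h se).
pose v := cvec e1 e2 (fun=> 0) (fun=> 0).
have cz : continuous (fun _ : R => 0 : R) by exact: contC.
have dz (x : R) : is_derive x 1 (fun _ : R => 0 : R) 0 by exact: is_deriveC_fun.
have H0 : H2per T (fun _ : R => 0) (fun _ : R => 0).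
  exact: (classical_H2per cz dz dz).
pose G1 x := Vp x * e1 x + la * e2 x.
pose G2 x := Vm x * e2 x - la * e1 x.
have H1 : H2per T e1 G1.
  apply: (classical_H2per (F1 := e1')); [by rewrite /G1; cont| | | |].
  - by move=> x; case: (de x).
  - by move=> x; case: (de x).
  - by rewrite (ee T).1.
  - by rewrite q1 r1.
have H2 : H2per T e2 G2.
  apply: (classical_H2per (F1 := e2')); [by rewrite /G2; cont| | | |].
  - by move=> x; case: (de x).
  - by move=> x; case: (de x).
  - by rewrite (ee T).2.
  - by rewrite q2 r2.
(* The null term [w] lets one argument serve both the eigenvalue equation and the first step of
   [ker_pow]. *)
have JLv w : ae_eq_on T w (fun=> 0) -> JL T phi v (fun x => la%:C *: v x + w x).
  move=> w0; exists (cvec G1 G2 (fun=> 0) (fun=> 0)); split.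
    move=> i; rewrite /v.
    have [->|i0] := eqVneq i 0.
      by split; under [X in H2per _ X _]eq_fun do rewrite mxE;
        under [X in H2per _ _ X]eq_fun do rewrite mxE.
    have -> : i = 1 by apply: val_inj; move: i0; case: i => -[|[|]].
    by split; under [X in H2per _ X _]eq_fun do rewrite mxE;
        under [X in H2per _ _ X]eq_fun do rewrite mxE.
  apply: filterS w0; first exact: (ae_filter_ringOfSetsType mu).
  move=> x wx xT; rewrite wx// addr0; apply/JL_L_diagE.
  rewrite /L_minus /L_plus /v /G1 /G2 !mxE /=.
  have := VpE xT; have := VmE xT.
  move: (Vp x) (Vm x) => _ _ -> ->; simpc.
  by split; congr (_ +i* _); ring.
(* Continuity permits evaluation at 0, where (e1, e2) does not vanish. *)
have vne (c : R[i]) : ae_eq_on T (fun x => c *: v x) (fun=> 0) -> c = 0.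
  case: c => p q h.
  have ca k : continuous (fun x => k * e1 x) by cont.
  have cb k : continuous (fun x => k * e2 x) by cont.
  have sub k (f : R -> R) : continuous f ->
      ae_eq_on T (fun x => k * f x) (fun=> 0) -> k * f 0 = 0.
    move=> cf hf; apply: (ae_eq_continuous T0 _ cz hf); first by cont.
    by case: (inT z0).
  have hp1 : p * e1 0 = 0.
    apply: sub => //; apply: filterS h; first exact: (ae_filter_ringOfSetsType mu).
    move=> x hx xT; have /matrixP/(_ 0 0) := hx xT; rewrite !mxE/=; simpc.
    by move=> [-> _].
  have hq1 : q * e1 0 = 0.
    apply: sub => //; apply: filterS h; first exact: (ae_filter_ringOfSetsType mu).
    move=> x hx xT; have /matrixP/(_ 0 0) := hx xT; rewrite !mxE/=; simpc.
    by move=> [_ ->].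
  have hp2 : p * e2 0 = 0.
    apply: sub => //; apply: filterS h; first exact: (ae_filter_ringOfSetsType mu).
    move=> x hx xT; have /matrixP/(_ 1 0) := hx xT; rewrite !mxE/=; simpc.
    by move=> [-> _].
  have hq2 : q * e2 0 = 0.
    apply: sub => //; apply: filterS h; first exact: (ae_filter_ringOfSetsType mu).
    move=> x hx xT; have /matrixP/(_ 1 0) := hx xT; rewrite !mxE/=; simpc.
    by move=> [_ ->].
  have fin k : k * e1 0 = 0 -> k * e2 0 = 0 -> k = 0.
    move=> /eqP + /eqP; rewrite !mulf_eq0; case: eqVneq => //= _ /eqP k1 /eqP k2.
    by move: e00; rewrite k1 k2 eqxx.
  by rewrite (fin p)// (fin q).
have zzE : cvec (fun=> 0) (fun=> 0) (fun=> 0) (fun=> 0) = (fun=> 0) :> (R -> 'cV[R[i]]_2).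
  by apply/funext => x; apply/esym/cvec_eqP; rewrite !mxE.
have eigJL : JL T phi v (fun x => la%:C *: v x).
  have := JLv (fun=> 0); rewrite (_ : (fun x => _ + _) = (fun x => la%:C *: v x)).
    by apply; apply: nearW.
  by apply/funext => x; rewrite addr0.
have eigv : is_eigenvalue T phi la%:C.
  exists v; split=> // h; suff /eqP : (1 : R[i]) = 0 by rewrite oner_eq0.
  by apply: vne; rewrite (_ : (fun x => _) = v)//; apply/funext => x; rewrite scale1r.
have parts (a1 a2 w1 w2 : R -> R) : psys T Vp Vm a1 a2 w1 w2 ->
    sys T Vp Vm true (even_part a1) (even_part a2) (even_part w1) (even_part w2) /\
    sys T Vp Vm false (odd_part a1) (odd_part a2) (odd_part w1) (odd_part w2).
  by move=> h; split; [exact: psys_even|exact: psys_odd].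
exists la%:C; split=> //.
- exists (fun=> v); split.
  + by move=> _; exists 1%N, (fun=> 0); split; [apply: JLv|]; apply: nearW.
  + move=> c hc j; rewrite (ord1 j); apply: vne; apply: filterS hc.
      exact: (ae_filter_ringOfSetsType mu).
    by move=> x; rewrite big_ord1.
  (* Induction on [n]: if (JL - la) u is already a multiple of v, then u is one too. *)
  + suff ker n u : ker_pow T phi la%:C n u -> exists c : R[i],
        ae_eq_on T u (fun x => c *: v x).
      move=> u [n /ker[c hc]]; exists (fun=> c); apply: filterS hc.
        exact: (ae_filter_ringOfSetsType mu).
      by move=> x; rewrite big_ord1.
    elim: n u => [u u0|n ih u [w [jw /ih[c wc]]]].
      exists 0; apply: filterS u0; first exact: (ae_filter_ringOfSetsType mu).
      by move=> x; rewrite scale0r.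
    case: c wc => p q wc.
    have wc' : ae_eq_on T w (cvec (fun x => p * e1 x) (fun x => p * e2 x)
        (fun x => q * e1 x) (fun x => q * e2 x)).
      apply: filterS wc; first exact: (ae_filter_ringOfSetsType mu).
      move=> x wx xT; rewrite wx//; apply/cvec_eqP; rewrite !mxE/=; simpc.
      by split=> /=; ring.
    have [||||a1 [a2 [b1 [b2 [sa sb uE]]]]] :=
      JL_shift_psys T0 cVp cVm VpE VmE jw _ _ _ _ wc'; [by cont..|].
    (* In the even part a nonzero [k] would be a Jordan chain over e, so this part is a multiple of
       e; the odd part vanishes. The hypothesis [d = 0] absorbs the imaginary part of the
       eigenvalue, which occurs both as 0 and as its opposite. *)
    have noJ (f1 f2 g1 g2 : R -> R) (d k : R) : d = 0 ->
        psys T Vp Vm f1 f2 (fun x => la * f1 x + d * g1 x + k * e1 x)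
          (fun x => la * f2 x + d * g2 x + k * e2 x) ->
        exists c : R, forall x : R, x \in `[- T, T] -> f1 x = c * e1 x /\ f2 x = c * e2 x.
      move=> -> /parts[].
      have evL (f g e : R -> R) : (forall x, e (- x) = e x) ->
          even_part (fun x => la * f x + 0 * g x + k * e x) =
          (fun x => la * even_part f x + k * e x).
        by move=> he; apply/funext => x; rewrite /even_part he; field.
      have odL (f g e : R -> R) : (forall x, e (- x) = e x) ->
          odd_part (fun x => la * f x + 0 * g x + k * e x) =
          (fun x => la * odd_part f x).
        by move=> he; apply/funext => x; rewrite /odd_part he; field.
      have he1 x : e1 (- x) = e1 x by case: (ee x).
      have he2 x : e2 (- x) = e2 x by case: (ee x).
      rewrite !evL// !odL// => sev sod.
      have k0 : k = 0.
        apply/eqP/negP => /negP kn; apply: ne.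
        exact: (sys_jordan T0 Lm_eq0 la0 kn se sev).
      have sev' : sys T Vp Vm true (even_part f1) (even_part f2)
          (fun x => la * even_part f1 x) (fun x => la * even_part f2 x).
        move: sev; rewrite k0; congr sys; apply/funext => x; ring.
      have [zo1 zo2] := sys_odd T0 Lm_ge0 Lm_eq0 Lp_dirichlet la0 sod.
      have pr := sys_proportional T0 Lm_ge0 Lm_eq0 Lp_neumann la0 se sev'.
      exists (even_part f1 x0 / e1 x0) => x xT.
      rewrite (even_odd zo1 xT) (even_odd zo2 xT).
      have pr' y : 0 <= y <= T -> even_part f1 y = even_part f1 x0 / e1 x0 * e1 y /\
          even_part f2 y = even_part f1 x0 / e1 x0 * e2 y.
        move=> yT; have [h1 h2] := pr y yT; split; apply: (mulfI ex0).
          by rewrite -h1; field.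
        by rewrite -h2; field.
      move: xT; rewrite in_itv/= => /andP[xl xr]; have [h|h] := leP 0 x.
        by apply: pr'; rewrite h.
      have xT : 0 <= - x <= T by apply/andP; split; lra.
      by have := pr' _ xT; rewrite !even_part_even he1 he2.
    have [ca hca] := noJ _ _ _ _ _ _ (oppr0 _) sa.
    have [|cb hcb] := noJ b1 b2 a1 a2 0 q erefl.
      by move: sb; congr psys; apply/funext => x /=; ring.
    exists (ca +i* cb); apply: nearW => x xT; rewrite uE//; apply/esym/cvec_eqP.
    have [-> ->] := hca x xT; have [-> ->] := hcb x xT.
    by rewrite !mxE/=; simpc; split=> /=; ring.
- move=> m [w [wn jw]] m0.
  have cz4 : ae_eq_on T (fun=> 0) (cvec (fun=> 0) (fun=> 0) (fun=> 0) (fun=> 0)).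
    by rewrite zzE; apply: nearW.
  have jw' : JL T phi w (fun x => m *: w x + (fun=> 0) x).
    by move: jw; congr (JL _ _ _ _); apply/funext => x; rewrite addr0.
  have [a1 [a2 [b1 [b2 [/parts[sae sao] /parts[sbe sbo] wE]]]]] :=
    JL_shift_psys T0 cVp cVm VpE VmE jw' cz cz cz cz cz4.
  set al := complex.Re m in sae sao sbe sbo m0 *.
  set be := complex.Im m in sae sao sbe sbo.
  have evL (p q : R) (f g : R -> R) : even_part (fun x => p * f x + q * g x + 0) =
      (fun x => p * even_part f x + q * even_part g x).
    by apply/funext => x; rewrite /even_part; field.
  have odL (p q : R) (f g : R -> R) : odd_part (fun x => p * f x + q * g x + 0) =
      (fun x => p * odd_part f x + q * odd_part g x).
    by apply/funext => x; rewrite /odd_part; field.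
  rewrite !evL in sae sbe; rewrite !odL in sao sbo.
  have wz : ~ [/\ forall x : R, x \in `[- T, T] -> a1 x = 0,
      forall x : R, x \in `[- T, T] -> a2 x = 0,
      forall x : R, x \in `[- T, T] -> b1 x = 0 &
      forall x : R, x \in `[- T, T] -> b2 x = 0].
    move=> [h1 h2 h3 h4]; apply: wn; apply: nearW => x xT; rewrite wE//.
    by apply/esym/cvec_eqP; rewrite !mxE h1// h2// h3// h4.
  (* Otherwise the even and odd parts would all vanish, and the eigenfunction with them. *)
  have be0 : be = 0.
    have [//|[ze1 ze2 ze3 ze4]] := sys_complex T0 Lm_ge0 Lm_eq0 m0 sae sbe.
    have [//|[zo1 zo2 zo3 zo4]] := sys_complex T0 Lm_ge0 Lm_eq0 m0 sao sbo.
    by exfalso; apply: wz; split; exact: zero_parts.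
  rewrite be0 in sae sao sbe sbo.
  have simp1 (f g : R -> R) : (fun x => al * f x + - 0 * g x) = (fun x => al * f x).
    by apply/funext => x; ring.
  have simp2 (f g : R -> R) : (fun x => 0 * f x + al * g x) = (fun x => al * g x).
    by apply/funext => x; ring.
  rewrite !simp1 in sae sao; rewrite !simp2 in sbe sbo.
  have [zo1 zo2] := sys_odd T0 Lm_ge0 Lm_eq0 Lp_dirichlet m0 sao.
  have [zo3 zo4] := sys_odd T0 Lm_ge0 Lm_eq0 Lp_dirichlet m0 sbo.
  suff alla : al = la.
    by move: alla be0; rewrite /al /be; case: (m) => ? ? /= -> ->.
  (* Only even parts remain, and that of the real or of the imaginary part is nonzero: a real mode
     for [al], to be compared with e. *)
  have [za|za] := pselect (zero_on T (even_part a1) /\ zero_on T (even_part a2)).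
    have [zb|zb] := pselect (zero_on T (even_part b1) /\ zero_on T (even_part b2)).
      case: za zb => ze1 ze2 [ze3 ze4].
      by exfalso; apply: wz; split; exact: zero_parts.
    exact: (sys_same_eigenvalue T0 Lm_ge0 Lm_eq0 Lp_neumann m0 la0 sbe se zb ne).
  exact: (sys_same_eigenvalue T0 Lm_ge0 Lm_eq0 Lp_neumann m0 la0 sae se za ne).
Qed.

End instability.

(** * Wave profiles *)

Section gronwall.
Context {R : realType}.

Lemma expR_mul_le (E E' : R -> R) (s a b : R) : a <= b ->
  (forall x : R, a <= x <= b -> is_derive x 1 E (E' x)) ->
  (forall x, a <= x <= b -> 0 <= s * E x + E' x) ->
  expR (s * a) * E a <= expR (s * b) * E b.
Proof.
move=> ab dE sE.
pose g y := expR (s * y) * (s * E y + E' y).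
have dg y : a <= y <= b -> is_derive y 1 (fun z => expR (s * z) * E z) (g y).
  move=> yab; have ? := dE y yab.
  have h : is_derive y 1 (fun z : R => s * z) s by deriv; ring.
  have ? := is_derive_comp_fun h (is_derive_expR (s * y)).
  by deriv; rewrite /g; ring.
apply: (@derive_ge0_le _ (fun z => expR (s * z) * E z) g) => //.
- by move=> y /andP[ay yb]; apply: dg; rewrite !ltW.
- exact: is_derive_within.
- by move=> y /andP[ay yb]; rewrite /g mulr_ge0 ?expR_ge0// sE// !ltW.
Qed.

(** e^(Mx) E is nondecreasing, which carries the zero at [c] to the left; e^(-Mx) E is
    nonincreasing, which carries it to the right. *)
Lemma gronwall_zero (E E' : R -> R) (M a b c : R) : a <= c <= b -> 0 <= M ->
  (forall x : R, a <= x <= b -> is_derive x 1 E (E' x)) ->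
  (forall x, a <= x <= b -> 0 <= E x) ->
  (forall x, a <= x <= b -> `|E' x| <= M * E x) -> E c = 0 ->
  forall x, a <= x <= b -> E x = 0.
Proof.
move=> /andP[ac cb] M0 dE E0 EM Ec x /andP[ax xb].
have Ex0 : 0 <= E x by apply: E0; rewrite ax xb.
have EM' y : a <= y <= b -> 0 <= M * E y + E' y /\ 0 <= - M * - E y + - E' y.
  by move=> yab; have := EM y yab; rewrite ler_norml mulrNN => /andP[]; split; lra.
apply/eqP; rewrite eq_le Ex0 andbT.
have [cx|xc] := leP c x.
  have sub y : c <= y <= x -> a <= y <= b.
    by move=> /andP[uy yv]; rewrite (le_trans ac uy) (le_trans yv xb).
  have dN y : c <= y <= x -> is_derive y 1 (fun z => - E z) (- E' y).
    by move=> hy; have ? := dE y (sub y hy); deriv.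
  have := expR_mul_le cx dN (fun y hy => (EM' y (sub y hy)).2).
  by rewrite Ec oppr0 mulr0 mulrN oppr_ge0 pmulr_rle0// expR_gt0.
have sub y : x <= y <= c -> a <= y <= b.
  by move=> /andP[uy yv]; rewrite (le_trans ax uy) (le_trans yv cb).
have := expR_mul_le (ltW xc) (fun y hy => dE y (sub y hy)) (fun y hy => (EM' y (sub y hy)).1).
by rewrite Ec mulr0 pmulr_rle0// expR_gt0.
Qed.

(** The point [p] may be an end point. With equality, [mono_const] on the translated interval would
    make [g] vanish identically. *)
Lemma prim_lt (g : R -> R) (a b p : R) : continuous g -> a < b -> a <= p <= b ->
  (forall x, a <= x <= b -> 0 <= g x) -> 0 < g p -> prim g a < prim g b.
Proof.
move=> cg ab /andP[ap pb] g0 gp; rewrite ltNge; apply/negP => pba.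
have ba : 0 < b - a by rewrite subr_gt0.
have dG y : 0 <= y <= b - a -> is_derive y 1 (fun z => prim g (a + z)) (g (a + y)).
  move=> _; have h : is_derive y (1 : R) (fun z : R => a + z) 1 by deriv; ring.
  by have := is_derive_comp_fun h (prim_is_derive (a + y) cg); rewrite mul1r.
have g0' y : 0 <= y <= b - a -> 0 <= g (a + y).
  by move=> /andP[y0 yb]; apply: g0; apply/andP; split; lra.
have pab : prim g a = prim g b.
  apply/eqP; rewrite eq_le pba andbT.
  apply: (@derive_ge0_le _ (prim g) g) => [|x _||x /andP[ax xb]]; first exact: ltW.
  - exact: prim_is_derive.
  - by apply: is_derive_within => x _; exact: prim_is_derive.
  - by apply: g0; rewrite !ltW.
have bdry : prim g (a + 0) = prim g (a + (b - a)) by rewrite addr0 addrC subrK.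
have pI : 0 <= p - a <= b - a by apply/andP; split; lra.
have := mono_const ba bdry dG g0' pI; rewrite addrC subrK => h.
by move: gp; rewrite h ltxx.
Qed.

Lemma prim_le (g : R -> R) (a b : R) : continuous g -> a <= b ->
  (forall x, a <= x <= b -> 0 <= g x) -> prim g a <= prim g b.
Proof.
move=> cg ab g0; apply: (@derive_ge0_le _ (prim g) g) => // [x _||x /andP[ax xb]].
- exact: prim_is_derive.
- by apply: is_derive_within => x _; exact: prim_is_derive.
- by apply: g0; rewrite !ltW.
Qed.

End gronwall.

Section profile.
Context {R : realType}.
Variables (T h : R) (f f' : R -> R).
Hypothesis T0 : 0 < T.
Hypotheses (df : forall x : R, is_derive x 1 f (f' x))
  (df' : forall x : R, is_derive x 1 f' (f x - 2 * f x ^+ 3 - h)).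
Hypotheses (f_even : forall x, f (- x) = f x) (f_per : forall x, f (x + 2 * T) = f x).
Hypothesis f_decr : {in `[0, T] &, {homo f : x y /~ x < y}}.

Let f'_odd x : f' (- x) = - f' x.
Proof.
have h1 := is_derive_opp (df (- x)).
rewrite (_ : (fun y => f (- y)) = f) in h1; last by apply/funext => y; rewrite f_even.
have h2 := df x.
by rewrite -(@derive_val _ _ _ _ _ _ _ h2) (@derive_val _ _ _ _ _ _ _ h1) opprK.
Qed.

Lemma profile_deriv0 : f' 0 = 0.
Proof. by have := f'_odd 0; rewrite oppr0; lra. Qed.

Lemma profile_derivT : f' T = 0.
Proof.
have dt : is_derive (- T) (1 : R) (fun y : R => y + 2 * T) 1 by deriv; ring.
have e : - T + 2 * T = T by ring.
have h1 := is_derive_comp_fun dt (df (- T + 2 * T)).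
rewrite e mul1r (_ : (fun y => f (y + 2 * T)) = f) in h1; last first.
  by apply/funext => y; rewrite f_per.
have h2 := df (- T).
have : f' (- T) = f' T.
  by rewrite -(@derive_val _ _ _ _ _ _ _ h2) (@derive_val _ _ _ _ _ _ _ h1).
by rewrite f'_odd; lra.
Qed.

Let itv0 : 0 <= (0 : R) <= T. Proof. by rewrite lexx ltW. Qed.
Let itvT : 0 <= T <= T. Proof. by rewrite lexx ltW. Qed.

Lemma profile_lt x y : 0 <= x -> x < y -> y <= T -> f y < f x.
Proof.
move=> x0 xy yT; apply: f_decr => //; rewrite in_itv/=.
  by rewrite (le_trans x0 (ltW xy)) yT.
by rewrite x0 (le_trans (ltW xy) yT).
Qed.

Lemma profile_bounds x : - T <= x <= T -> f T <= f x <= f 0.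
Proof.
have main y : 0 <= y <= T -> f T <= f y <= f 0.
  move=> /andP[]; rewrite le_eqVlt => /predU1P[<- _|y0].
    by rewrite lexx andbT ltW// profile_lt.
  rewrite le_eqVlt => /predU1P[->|yT]; first by rewrite lexx ltW// profile_lt.
  by rewrite !ltW// profile_lt// ltW.
move=> /andP[xl xr]; have [x0|x0] := leP 0 x; first by apply: main; rewrite x0.
by rewrite -(f_even x); apply: main; apply/andP; split; lra.
Qed.

(** Since f''' = (1 - 6 f^2) f', the quantity E = f'^2 + f''^2 satisfies |E'| <= C E. If it vanished
    once, f would be constant, against strict monotonicity. *)
Let no_equilibrium x : 0 <= x <= T -> f' x = 0 -> f x - 2 * f x ^+ 3 - h <> 0.
Proof.
move=> xT f'0 f20.
pose E y := f' y ^+ 2 + (f y - 2 * f y ^+ 3 - h) ^+ 2.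
pose E' y := 2 * f' y * (f y - 2 * f y ^+ 3 - h) * (2 - 6 * f y ^+ 2).
pose m := Num.max `|f T| `|f 0|.
have fm y : 0 <= y <= T -> f y ^+ 2 <= m ^+ 2.
  move=> /andP[y0 yT]; have yI : - T <= y <= T by rewrite yT andbT; have := T0; lra.
  have /andP[l r] := profile_bounds yI.
  rewrite -[leLHS]real_normK ?num_real// ler_sqr ?nnegrE//; last by rewrite le_max normr_ge0.
  have hl := ler_norm (f 0); have hr := ler_norm (- f T); rewrite normrN in hr.
  have m1 : `|f T| <= m by rewrite le_max lexx.
  have m2 : `|f 0| <= m by rewrite le_max lexx orbT.
  by rewrite ler_norml; apply/andP; split; lra.
have z : forall y, 0 <= y <= T -> E y = 0.
  apply: (@gronwall_zero _ E E' (2 + 6 * m ^+ 2) 0 T x xT).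
  - by rewrite addr_ge0// mulr_ge0// sqr_ge0.
  - move=> y _; have ? := df y; have ? := df' y.
    by rewrite /E /E'; deriv; ring.
  - by move=> y _; rewrite /E addr_ge0// sqr_ge0.
  - move=> y yT; rewrite /E /E'; set p := f' y; set q := _ - h.
    have pq : `|2 * p * q| <= p ^+ 2 + q ^+ 2.
      have := sqr_ge0 (p - q); have := sqr_ge0 (p + q).
      by rewrite !expr2 ler_norml => ? ?; apply/andP; split; lra.
    rewrite normrM mulrC; apply: ler_pM => //.
    have := fm y yT; have := sqr_ge0 (f y) => ? ?.
    by rewrite ler_norml; apply/andP; split; lra.
  - by rewrite /E f'0 f20 expr0n addr0.
have f'z y : 0 <= y <= T -> f' y = 0.
  move=> /z; rewrite /E => /eqP; rewrite paddr_eq0 ?sqr_ge0// sqrf_eq0 => /andP[/eqP ->].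
  by [].
have : f 0 = f T.
  apply: derive_eq0_eq; first exact: ltW.
  by move=> y yT; rewrite -(f'z y yT).
by have := profile_lt (lexx 0) T0 (lexx T) => + e; rewrite e ltxx.
Qed.

(** Makes 0 a simple zero of f', hence a regular end when f' is the comparison function for L+; T is
    treated in [profile_secondT]. *)
Lemma profile_second0 : f 0 - 2 * f 0 ^+ 3 - h != 0.
Proof. by apply/eqP; apply: no_equilibrium => //; exact: profile_deriv0. Qed.

Lemma profile_secondT : f T - 2 * f T ^+ 3 - h != 0.
Proof. by apply/eqP; apply: no_equilibrium => //; exact: profile_derivT. Qed.

(** Monotonicity gives f' <= 0. An interior zero would be a maximum of f', where f'' = 0 too, and
    [no_equilibrium] forbids this. *)
Lemma profile_deriv_lt0 x : 0 < x < T -> f' x < 0.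
Proof.
move=> xT.
have le0 y : 0 < y < T -> f' y <= 0.
  move=> yT; have h1 := df y.
  rewrite -(@derive_val _ _ _ _ _ _ _ h1) -derive1E.
  apply: (@decr_derive1_le0_itv _ f true false 0 T) => //.
have := le0 x xT; rewrite le_eqVlt => /predU1P[f'x|//]; exfalso.
have /andP[x0 xT'] := xT.
apply: (@no_equilibrium x) => //; first by rewrite !ltW.
have := @derive1_at_max _ f' 0 T x (ltW T0).
have d (t : R) : t \in `]0, T[ -> derivable f' t 1 by move=> _; have [] := df' t.
move=> /(_ d); rewrite in_itv/= => /(_ xT).
have le t : t \in `]0, T[ -> f' t <= f' x by rewrite in_itv/= f'x; exact: le0.
move=> /(_ le) h1; have h2 := df' x.
by rewrite -(@derive_val _ _ _ _ _ _ _ h2) (@derive_val _ _ _ _ _ _ _ h1).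
Qed.

Lemma profile_cont : continuous f.
Proof. exact: is_derive_continuous df. Qed.

End profile.

(** * Explicit eigenfunctions of L+ at h = 0 *)

Section ground_state.
Context {R : realType}.
Variables (T : R) (g g' : R -> R).
Hypothesis T0 : 0 < T.
Hypotheses (dg : forall x : R, is_derive x 1 g (g' x))
  (dg' : forall x : R, is_derive x 1 g' (g x - 2 * g x ^+ 3 - 0)).
Hypotheses (g_even : forall x, g (- x) = g x) (g_per : forall x, g (x + 2 * T) = g x).
Hypothesis g_decr : {in `[0, T] &, {homo g : x y /~ x < y}}.
Hypothesis gT : 0 < g T.

Let A := g 0 ^+ 2.
Let B := g T ^+ 2.

Let gT0 : g T < g 0.
Proof. exact: (profile_lt g_decr (lexx 0) T0 (lexx T)). Qed.

Let first_integral x : 0 <= x <= T -> g' x ^+ 2 - g x ^+ 2 + g x ^+ 4 = - A + A ^+ 2.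
Proof.
move=> /andP[x0 xT].
have d y : 0 <= y <= x -> is_derive y 1 (fun z => g' z ^+ 2 - g z ^+ 2 + g z ^+ 4) 0.
  by move=> _; have ? := dg y; have ? := dg' y; deriv; ring.
have := derive_eq0_eq x0 d => /= <-.
by rewrite (profile_deriv0 dg g_even) /A; ring.
Qed.

(** g' vanishes at 0 and at T, so the first integral gives A - A^2 = B - B^2, that is (A - B)(A + B
    - 1) = 0, with A and B distinct. *)
Let AB1 : A + B = 1.
Proof.
have TT : 0 <= T <= T by rewrite lexx ltW.
have := first_integral TT; rewrite (profile_derivT dg g_even g_per) => e.
have AB : A - B != 0.
  by rewrite subr_eq0 gt_eqF// /A /B ltr_pXn2r// ?nnegrE ltW// (lt_trans gT).
apply: (mulfI AB); move: e; rewrite /A /B => e.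
by apply/eqP; rewrite -subr_eq0; apply/eqP; rewrite -[RHS](subrr (- g 0 ^+ 2 + (g 0 ^+ 2) ^+ 2)) -{2}e; ring.
Qed.

Let BA : B < A.
Proof. by rewrite /A /B ltr_pXn2r// ?nnegrE ltW// (lt_trans gT). Qed.

Let B0 : 0 < B. Proof. by rewrite exprn_gt0. Qed.

(* Squares of the dnoidal wave shifted by a root of this quadratic are the two
   even periodic eigenfunctions of the two-gap Lame operator L_{+,0}. *)
Let lame (c x : R) : 3 * c ^+ 2 + 2 * c + A * B = 0 -> 0 <= x <= T ->
  is_derive x 1 (fun y => g y ^+ 2 + c) (2 * g x * g' x) /\
  is_derive x 1 (fun y => 2 * g y * g' y) ((4 + 6 * c - 6 * g x ^+ 2) * (g x ^+ 2 + c)).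
Proof.
move=> hc xT; have ? := dg x; have ? := dg' x; split; first by deriv; ring.
have := first_integral xT => e.
have eB : B = 1 - A by have := AB1; lra.
have e' : g' x ^+ 2 = g x ^+ 2 - g x ^+ 4 - A * B by rewrite eB; move: e; rewrite expr2; lra.
deriv; apply/eqP; rewrite -subr_eq0; apply/eqP.
transitivity (2 * (g' x ^+ 2 - (g x ^+ 2 - g x ^+ 4 - A * B)) -
  2 * (3 * c ^+ 2 + 2 * c + A * B)); first by ring.
by rewrite e' hc; ring.
Qed.

Lemma ground_state_data : exists c d n m x0 : R,
  [/\ 0 < n, 0 < m, 0 < x0 < T, g x0 ^+ 2 + c = 0 & [/\
   forall x : R, 0 <= x <= T ->
     is_derive x 1 (fun y => g y ^+ 2 + c) (2 * g x * g' x) /\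
     is_derive x 1 (fun y => 2 * g y * g' y) ((1 - 6 * g x ^+ 2 - n) * (g x ^+ 2 + c)),
   forall x : R, 0 <= x <= T ->
     is_derive x 1 (fun y => g y ^+ 2 + d) (2 * g x * g' x) /\
     is_derive x 1 (fun y => 2 * g y * g' y) ((1 - 6 * g x ^+ 2 + m) * (g x ^+ 2 + d)),
   forall x : R, 0 <= x <= T -> 0 < g x ^+ 2 + d,
   forall x : R, 0 <= x <= T -> 0 < g x &
   forall x : R, 0 < x < T -> g' x < 0]].
Proof.
have eB : B = 1 - A by have := AB1; lra.
have A12 : 1 < 2 * A by have := AB1; have := BA; lra.
(* The roots of the quadratic are (-1 - s) / 3 and (-1 + s) / 3. Root c has eigenvalue -3 - 6 c,
   which gives n = 2 s - 1 and -m = -(2 s + 1). *)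
pose s := Num.sqrt (1 - 3 * (A * B)).
have q0 : 0 <= (2 * A - 1) ^+ 2 by exact: sqr_ge0.
have p1 : 0 < (2 * A - 1) ^+ 2 by rewrite exprn_gt0//; lra.
(* This is 4 s^2 > 1, that is n > 0; it comes from A > 1/2. *)
have d0 : 1 < 4 * (1 - 3 * (A * B)).
  rewrite eB; have -> : 4 * (1 - 3 * (A * (1 - A))) = 3 * (2 * A - 1) ^+ 2 + 1 by ring.
  by lra.
have s2 : s ^+ 2 = 1 - 3 * (A * B) by rewrite sqr_sqrtr//; lra.
have s0 : 0 <= s by exact: sqrtr_ge0.
have s12 : 1 < 2 * s.
  rewrite -(ltr_pXn2r (n := 2))// ?nnegrE ?mulr_ge0// expr1n exprMn s2.
  by have -> : 2 ^+ 2 = 4 :> R by ring.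
have A0 : 0 < A by exact: lt_trans B0 BA.
(* This means g(0)^2 + c > 0, and [hB] means g(T)^2 + c < 0 < g(T)^2 + d: one eigenfunction changes
   sign on (0, T), the other is positive because g^2 >= g(T)^2. *)
have hA : s < 3 * A - 1.
  rewrite -(ltr_pXn2r (n := 2))// ?nnegrE//; last by lra.
  rewrite s2 eB -subr_gt0.
  have -> : (3 * A - 1) ^+ 2 - (1 - 3 * (A * (1 - A))) = 3 * (A * (2 * A - 1)) by ring.
  by apply: mulr_gt0 => //; apply: mulr_gt0 => //; rewrite subr_gt0.
have hB : `|3 * B - 1| < s.
  rewrite -(ltr_pXn2r (n := 2))// ?nnegrE// real_normK ?num_real//.
  rewrite s2 -subr_gt0.
  have -> : 1 - 3 * (A * B) - (3 * B - 1) ^+ 2 = 3 * (B * (1 - 2 * B)) +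
     3 * B * (1 - A - B) by ring.
  rewrite eB; have -> : 1 - A - (1 - A) = 0 by ring.
  by rewrite mulr0 addr0 !mulr_gt0//; [rewrite -eB|lra].
move: hB; rewrite ltr_norml => /andP[hB1 hB2].
pose c := (-1 - s) / 3; pose d := (-1 + s) / 3.
have root_c : 3 * c ^+ 2 + 2 * c + A * B = 0.
  have -> : 3 * c ^+ 2 + 2 * c + A * B = (s ^+ 2 - (1 - 3 * (A * B))) / 3.
    by rewrite /c; field.
  by rewrite s2 subrr mul0r.
have root_d : 3 * d ^+ 2 + 2 * d + A * B = 0.
  have -> : 3 * d ^+ 2 + 2 * d + A * B = (s ^+ 2 - (1 - 3 * (A * B))) / 3.
    by rewrite /d; field.
  by rewrite s2 subrr mul0r.
have gpos x : 0 <= x <= T -> 0 < g x.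
  move=> /andP[x0 xT].
  have xI : - T <= x <= T by rewrite xT andbT; have := T0; lra.
  have /andP[l _] := profile_bounds T0 g_even g_decr xI.
  exact: lt_le_trans l.
have gB x : 0 <= x <= T -> B <= g x ^+ 2.
  move=> xT; have xI : - T <= x <= T by case/andP: xT => ? ->; rewrite andbT; have := T0; lra.
  have /andP[l _] := profile_bounds T0 g_even g_decr xI.
  by rewrite /B ler_pXn2r ?nnegrE// ltW// gpos.
have cont_chi : {within `[0, T], continuous (fun y => - (g y ^+ 2 + c))}.
  apply: continuous_subspaceT; have cg := profile_cont dg.
  by cont.
have sgn : - (g 0 ^+ 2 + c) <= 0 <= - (g T ^+ 2 + c).
  by rewrite -/A -/B /c; apply/andP; split; lra.
have [x0 x0T x00] := ivt_zero (ltW T0) cont_chi (or_introl sgn).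
exists c, d, (2 * s - 1), (2 * s + 1), x0; split.
- lra.
- lra.
- move/eqP: x00; rewrite oppr_eq0 => /eqP x00.
  move: x0T => /andP[]; rewrite le_eqVlt => /predU1P[e|->/=].
    by move: x00; rewrite -e -/A /c; lra.
  rewrite le_eqVlt => /predU1P[e|//].
  by move: x00; rewrite e -/B /c; lra.
- by move/eqP: x00; rewrite oppr_eq0 => /eqP.
- split.
  + move=> x xT; have [h1 h2] := lame root_c xT; split=> //.
    by have -> : 1 - 6 * g x ^+ 2 - (2 * s - 1) = 4 + 6 * c - 6 * g x ^+ 2 by rewrite /c; field.
  + move=> x xT; have [h1 h2] := lame root_d xT; split=> //.
    by have -> : 1 - 6 * g x ^+ 2 + (2 * s + 1) = 4 + 6 * d - 6 * g x ^+ 2 by rewrite /d; field.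
  + by move=> x /gB; rewrite /d; lra.
  + exact: gpos.
  + exact: (profile_deriv_lt0 T0 dg dg' g_even g_decr).
Qed.

End ground_state.

(** * Sign conditions on L- and L+ for small positive h *)

Section perturbed_wave.
Context {R : realType}.
Variables (T h : R) (f f' g g' : R -> R).
Hypotheses (T0 : 0 < T) (h0 : 0 < h).
Hypotheses (df : forall x : R, is_derive x 1 f (f' x))
  (df' : forall x : R, is_derive x 1 f' (f x - 2 * f x ^+ 3 - h)).
Hypotheses (f_even : forall x, f (- x) = f x) (f_per : forall x, f (x + 2 * T) = f x).
Hypothesis f_decr : {in `[0, T] &, {homo f : x y /~ x < y}}.
Hypothesis fT : 0 < f T.
Variables (c d n m x0 : R).
Hypotheses (n0 : 0 < n) (m0 : 0 < m) (x0T : 0 < x0 < T) (gx0 : g x0 ^+ 2 + c = 0).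
Hypotheses (cg : continuous g) (g'0 : g' 0 = 0) (g'T : g' T = 0).
Hypothesis chiP : forall x : R, 0 <= x <= T ->
  is_derive x 1 (fun y => g y ^+ 2 + c) (2 * g x * g' x) /\
  is_derive x 1 (fun y => 2 * g y * g' y) ((1 - 6 * g x ^+ 2 - n) * (g x ^+ 2 + c)).
Hypothesis xiP : forall x : R, 0 <= x <= T ->
  is_derive x 1 (fun y => g y ^+ 2 + d) (2 * g x * g' x) /\
  is_derive x 1 (fun y => 2 * g y * g' y) ((1 - 6 * g x ^+ 2 + m) * (g x ^+ 2 + d)).
Hypothesis xi_gt0 : forall x : R, 0 <= x <= T -> 0 < g x ^+ 2 + d.
Hypothesis g_gt0 : forall x : R, 0 <= x <= T -> 0 < g x.
Hypothesis g'_lt0 : forall x : R, 0 < x < T -> g' x < 0.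
Hypothesis close : forall x : R, 0 <= x <= T ->
  6 * `|f x ^+ 2 - g x ^+ 2| < n /\ 6 * `|f x ^+ 2 - g x ^+ 2| < m.

(** Clamping keeps the potentials within the bounds of the wave on [-T, T], as Picard iteration on
    the line requires. *)
Let fc x := f (clamp (- T) T x).
Let Vp x := 1 - 6 * fc x ^+ 2.
Let Vm x := 1 - 2 * fc x ^+ 2.
Let TT : - T <= T. Proof. by have := T0; lra. Qed.
Let sub x : 0 <= x <= T -> - T <= x <= T.
Proof. by move=> /andP[x1 ->]; rewrite andbT; have := T0; lra. Qed.
Let itv0 : 0 <= (0 : R) <= T. Proof. by rewrite lexx ltW. Qed.
Let itvT : 0 <= T <= T. Proof. by rewrite lexx ltW. Qed.
Let itvx0 : 0 <= x0 <= T. Proof. by case/andP: x0T => ? ?; rewrite !ltW. Qed.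

Let cfc : continuous fc.
Proof. by apply: cont_comp; [exact: clamp_cont|exact: profile_cont df]. Qed.

Let fcE x : - T <= x <= T -> fc x = f x.
Proof. by move=> hx; rewrite /fc clamp_id. Qed.

Let fc_bounds x : f T <= fc x <= f 0.
Proof. by apply: (profile_bounds T0 f_even f_decr); exact: clamp_in. Qed.

Let fc_gt0 x : 0 < fc x.
Proof. by case/andP: (fc_bounds x) => l _; exact: lt_le_trans l. Qed.

Let fc_even x : fc (- x) = fc x.
Proof.
by rewrite /fc clamp_opp ?ltW// f_even.
Qed.

Let M : R := 1 + 6 * f 0 ^+ 2.

Let fc2 x : 0 <= fc x ^+ 2 <= f 0 ^+ 2.
Proof.
rewrite sqr_ge0/= ler_pXn2r ?nnegrE//; [by case/andP: (fc_bounds x)|exact: ltW|].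
by case/andP: (fc_bounds 0) => l r; apply: ltW; apply: lt_le_trans (lt_le_trans fT l) r.
Qed.

Let bVp x : `|Vp x| <= M.
Proof.
have /andP[l r] := fc2 x; rewrite /Vp /M ler_norml; apply/andP; split; lra.
Qed.

Let bVm x : `|Vm x| <= M.
Proof.
have /andP[l r] := fc2 x; rewrite /Vm /M ler_norml; apply/andP; split; lra.
Qed.

Let cVp : continuous Vp. Proof. by rewrite /Vp; cont. Qed.
Let cVm : continuous Vm. Proof. by rewrite /Vm; cont. Qed.

(** The profile equation reads f'' = (Vm - q) f: the positive function f is in the kernel of L- - q,
    and h > 0 makes q positive. *)
Let q x := h / fc x.
Let q_gt0 x : 0 < q x. Proof. by rewrite divr_gt0. Qed.
Let cq : continuous q.
Proof.
rewrite /q; apply: contM; first exact: contC.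
by move=> x; apply: continuousV; [rewrite gt_eqF|exact: cfc].
Qed.

Let dfW x : 0 <= x <= T -> is_derive x 1 f' ((Vm x - q x) * f x).
Proof.
move=> xT; have := df' x; congr is_derive; rewrite /Vm /q fcE ?sub//.
have fx : f x != 0 by rewrite -fcE ?sub// gt_eqF.
by field.
Qed.

Let f'0 : f' 0 = 0. Proof. exact: profile_deriv0 df f_even. Qed.
Let f'T : f' T = 0. Proof. exact: profile_derivT df f_even f_per. Qed.

Let regf (u : R -> R) x : 0 <= x <= T -> regular_end u f f' x.
Proof. by move=> xT; left; rewrite -fcE ?sub// gt_eqF. Qed.

(** Picone's inequality with [f] and the potential [Vm - q]: the end terms vanish because f' is 0 at
    both ends and u u' is 0 under either condition. *)
Let Lm_ineq b u u' F : sl_sol T Vm u u' F -> bc T b u u' ->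
  prim (fun x => q x * u x ^+ 2) T <= dot T u F.
Proof.
move=> [cu cF du du'] bu.
have cuF : continuous (fun x => u x * F x) by cont.
have cqu : continuous (fun x => q x * u x ^+ 2) by cont.
have := @picone _ u u' (fun x => F x - q x * u x) f f' (fun x => Vm x - q x)
  (fun x => prim (fun x => u x * F x) x - prim (fun x => q x * u x ^+ 2) x) 0 T (ltW T0).
rewrite f'0 f'T !mulr0 !mul0r.
have -> : 0 - u T * u' T - (0 - u 0 * u' 0) = 0.
  by case: b bu => -[-> ->]; rewrite !(mul0r, mulr0); ring.
rewrite !prim0// subrr subr0 subr_ge0; apply.
- move=> x xT; split; [exact: du| |exact: df|exact: dfW|].
    by have := du' x xT; congr is_derive; ring.
  have ? := prim_is_derive x cuF; have ? := prim_is_derive x cqu.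
  by deriv; ring.
- by move=> x /andP[x1 x2]; rewrite -fcE ?gt_eqF// sub// !ltW.
- exact: regf.
- exact: regf.
Qed.

Let Lm_ge0 b u u' F : sl_sol T Vm u u' F -> bc T b u u' -> 0 <= dot T u F.
Proof.
move=> su bu; apply: le_trans (Lm_ineq su bu).
have [cu _ _ _] := su; have cqu : continuous (fun x => q x * u x ^+ 2) by cont.
rewrite -(prim0 cqu); apply: prim_le => //; first exact: ltW.
by move=> x _; rewrite mulr_ge0 ?sqr_ge0// ltW.
Qed.

Let Lm_eq0 b u u' F : sl_sol T Vm u u' F -> bc T b u u' -> dot T u F = 0 ->
  forall x, 0 <= x <= T -> u x = 0.
Proof.
move=> su bu uF x xT; apply/eqP; apply: contraT => ux.
have [cu _ _ _] := su; have cqu : continuous (fun x => q x * u x ^+ 2) by cont.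
have := Lm_ineq su bu; rewrite uF -(prim0 cqu) leNgt (@prim_lt _ _ 0 T x)//.
- by move=> y _; rewrite mulr_ge0 ?sqr_ge0// ltW.
- by rewrite mulr_gt0// exprn_even_gt0.
Qed.

(** Picone's inequality with f', which satisfies L+ f' = 0 and is negative inside; at the ends u and
    f' vanish together and f'' does not. *)
Let Lp_dirichlet u u' F : sl_sol T Vp u u' F -> bc T false u u' -> 0 <= dot T u F.
Proof.
move=> [cu cF du du'] [u0 uT].
have cuF : continuous (fun x => u x * F x) by cont.
have := @picone _ u u' F f' (fun x => f x - 2 * f x ^+ 3 - h) Vp
  (prim (fun x => u x * F x)) 0 T (ltW T0).
rewrite u0 uT expr0n/= !mul0r !subrr prim0// subr0; apply.
- move=> x xT; split; [exact: du|exact: du'|exact: df'| |exact: prim_is_derive].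
  by have ? := df x; deriv; rewrite /Vp fcE ?sub//; ring.
- by move=> x xT; rewrite lt_eqF// (profile_deriv_lt0 T0 df df' f_even f_decr).
- by right; split=> //; exact: (profile_second0 T0 df df' f_even f_decr).
- by right; split=> //; exact: (profile_secondT T0 df df' f_even f_per f_decr).
Qed.

Let chi x := g x ^+ 2 + c.
Let chi' x := 2 * g x * g' x.
Let gc x := g (clamp (- T) T x).
Let W x := 1 - 6 * gc x ^+ 2 - n.
(** chi'' = W chi, and on [0, T] k = n - 6 (f^2 - g^2): the eigenvalue n absorbs the perturbation of
    the wave, so k > 0. *)
Let k x := Vp x - W x.

Let cgc : continuous gc.
Proof. by apply: cont_comp => //; exact: clamp_cont. Qed.

Let gcE x : 0 <= x <= T -> gc x = g x.
Proof. by move=> xT; rewrite /gc clamp_id// sub. Qed.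

Let ck : continuous k. Proof. by rewrite /k /W; cont. Qed.

Let k_gt0 x : 0 <= x <= T -> 0 < k x.
Proof.
move=> xT; rewrite /k /W /Vp gcE// fcE ?sub//.
by have [+ _] := close xT; have := ler_norm (f x ^+ 2 - g x ^+ 2); lra.
Qed.

Let chi_lt x y : 0 <= x -> x < y -> y <= T -> chi y < chi x.
Proof.
move=> x1 xy yT.
rewrite -ltrN2; apply: (@derive_gt0_lt _ (fun z => - chi z) (fun z => - chi' z)) => //.
- move=> z /andP[xz zy]; have zT : 0 <= z <= T by rewrite (le_trans x1 (ltW xz)) (le_trans (ltW zy)).
  by have [? _] := chiP zT; rewrite /chi; deriv.
- apply: continuous_subspaceT; rewrite /chi; cont.
- move=> z /andP[xz zy].
  have zT : 0 < z < T by rewrite (le_lt_trans x1 xz) (lt_le_trans zy).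
  have zT' : 0 <= z <= T by case/andP: zT => ? ?; rewrite !ltW.
  by rewrite oppr_gt0 /chi' pmulr_rlt0 ?g'_lt0// mulr_gt0// g_gt0.
Qed.

Let chi_neq0 x : 0 <= x <= T -> x != x0 -> chi x != 0.
Proof.
move=> /andP[x1 xT]; rewrite neq_lt => /orP[xx|xx].
  by rewrite gt_eqF// -gx0; apply: chi_lt => //; case/andP: itvx0.
by rewrite lt_eqF// -gx0; apply: chi_lt => //; case/andP: itvx0.
Qed.

Let chi'x0 : chi' x0 != 0.
Proof.
apply: mulf_neq0; last by rewrite lt_eqF// g'_lt0.
by apply: mulf_neq0; [rewrite pnatr_eq0|rewrite gt_eqF// g_gt0].
Qed.

Let chi'0 : chi' 0 = 0. Proof. by rewrite /chi' g'0 mulr0. Qed.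
Let chi'T : chi' T = 0. Proof. by rewrite /chi' g'T mulr0. Qed.

Let chi_regular (u : R -> R) x : 0 <= x <= T -> x != x0 \/ u x0 = 0 ->
  regular_end u chi chi' x.
Proof.
move=> xT; have [->|xx0] := eqVneq x x0.
  by move=> [//|ux0]; right.
by move=> _; left; exact: chi_neq0.
Qed.

(** Picone's inequality on one side of [x0]. The potential of chi being [W] and not [Vp], the source
    becomes F - k u. *)
Let chi_picone u u' F G (a b : R) : 0 <= a -> a <= b -> b <= T ->
  (x0 <= a) || (b <= x0) ->
  (forall x : R, a <= x <= b -> is_derive x 1 u (u' x) /\
    is_derive x 1 u' (Vp x * u x - F x) /\ is_derive x 1 G (u x * (F x - k x * u x))) ->
  (a != x0 \/ u x0 = 0) -> (b != x0 \/ u x0 = 0) ->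
  (u b ^+ 2 * chi' b / chi b - u b * u' b) -
  (u a ^+ 2 * chi' a / chi a - u a * u' a) <= G b - G a.
Proof.
move=> a0 ab bT x0ab H ra rb.
apply: (@picone _ u u' (fun x => F x - k x * u x) chi chi' W) => //.
- move=> x xab; have [du [du' dG]] := H x xab.
  have xT : 0 <= x <= T by case/andP: xab => ? ?; rewrite (le_trans a0)// (le_trans _ bT).
  have [d1 d2] := chiP xT; split=> //.
    by move: du'; congr is_derive; rewrite /k; ring.
  by move: d2; congr is_derive; rewrite /W gcE.
- move=> x /andP[ax xb]; apply: chi_neq0.
    by rewrite (le_trans a0 (ltW ax)) (le_trans (ltW xb)).
  by case/orP: x0ab => e; [rewrite gt_eqF// (le_lt_trans e)|rewrite lt_eqF// (lt_le_trans xb)].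
- by apply: chi_regular => //; rewrite a0 (le_trans ab).
- by apply: chi_regular => //; rewrite bT (le_trans a0).
Qed.

(** Picone's inequality on [0, x0] and on [x0, T]: the end terms vanish at x0 because u does, at 0
    and T because u' and chi' do. The sum bounds the form from below by the integral of k u^2. *)
Let Lp_neumann u u' F : sl_sol T Vp u u' F -> bc T true u u' -> u x0 = 0 -> 0 <= dot T u F.
Proof.
move=> [cu cF du du'] [u'0 u'T] ux0.
have cuF : continuous (fun x => u x * F x) by cont.
have cku : continuous (fun x => k x * u x ^+ 2) by cont.
pose G x := prim (fun x => u x * F x) x - prim (fun x => k x * u x ^+ 2) x.
have H x : 0 <= x <= T -> is_derive x 1 u (u' x) /\
    is_derive x 1 u' (Vp x * u x - F x) /\ is_derive x 1 G (u x * (F x - k x * u x)).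
  move=> xT; split; [exact: du|split; [exact: du'|]].
  have ? := prim_is_derive x cuF; have ? := prim_is_derive x cku.
  by rewrite /G; deriv; ring.
have /andP[x00 x0T'] := itvx0.
have i1 : 0 <= G x0 - G 0.
  have h1 : (x0 <= 0) || (x0 <= x0) by rewrite lexx orbT.
  have h2 (x : R) : 0 <= x <= x0 -> 0 <= x <= T.
    by move=> /andP[-> xx]; rewrite (le_trans xx).
  have := chi_picone (lexx 0) x00 x0T' h1 (fun x hx => H x (h2 x hx)) (or_intror ux0) (or_intror ux0).
  by rewrite ux0 u'0 chi'0 expr0n/= !(mul0r, mulr0) !subrr.
have i2 : 0 <= G T - G x0.
  have h1 : (x0 <= x0) || (T <= x0) by rewrite lexx.
  have h2 (x : R) : x0 <= x <= T -> 0 <= x <= T.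
    by move=> /andP[xx ->]; rewrite (le_trans x00).
  have := chi_picone x00 x0T' (lexx T) h1 (fun x hx => H x (h2 x hx)) (or_intror ux0) (or_intror ux0).
  by rewrite ux0 u'T chi'T expr0n/= !(mul0r, mulr0) !subrr.
have k1 : prim (fun x => k x * u x ^+ 2) 0 <= prim (fun x => k x * u x ^+ 2) T.
  apply: prim_le => //; first exact: ltW.
  by move=> x xT; rewrite mulr_ge0 ?sqr_ge0// ltW// k_gt0.
move: i1 i2 k1; rewrite /G !prim0// /dot; set a := prim _ x0; set b := prim _ x0.
set p := prim _ T; set r := prim _ T; lra.
Qed.

(** Picone's inequality on [0, z] gives y(z) y'(z) > 0 as soon as y(z) or f'(z) is 0. Hence y has no
    zero, and z = T yields the sign of y'(T). *)
Let Vm_pos (y y' : R -> R) :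
  (forall x : R, 0 <= x <= T -> is_derive x 1 y (y' x)) ->
  (forall x : R, 0 <= x <= T -> is_derive x 1 y' (Vm x * y x)) ->
  y 0 = 1 -> y' 0 = 0 -> 0 < y' T.
Proof.
move=> dy dy' y0 y'0.
(* [y] is controlled on [0, T] only; its clamped extension is continuous on the line, as [prim]
   requires. *)
have cy := clamp_extend (ltW T0) (is_derive_within dy).
set yc := (fun x => _) in cy.
have ycE x : 0 <= x <= T -> yc x = y x by move=> xT; rewrite /yc clamp_id.
have cqy : continuous (fun x => q x * yc x ^+ 2) by cont.
have key z : 0 < z -> z <= T -> y z ^+ 2 * f' z = 0 -> 0 < y z * y' z.
  move=> z0 zT rz.
  have zI x : 0 <= x <= z -> 0 <= x <= T by move=> /andP[-> xz]; rewrite (le_trans xz).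
  have zz : 0 <= z <= T by rewrite ltW.
  have l : prim (fun x => q x * yc x ^+ 2) 0 < prim (fun x => q x * yc x ^+ 2) z.
    apply: (@prim_lt _ _ 0 z 0) => //; first by rewrite lexx ltW.
      by move=> x _; rewrite mulr_ge0 ?sqr_ge0// ltW.
    by rewrite mulr_gt0// ycE// y0 expr1n.
  have := @picone _ y y' (fun x => - (q x * y x)) f f' (fun x => Vm x - q x)
    (fun x => - prim (fun x => q x * yc x ^+ 2) x) 0 z (ltW z0).
  rewrite f'0 y'0 rz !(mulr0, mul0r) subrr => P.
  have {}P : 0 - y z * y' z - 0 <= - prim (fun x => q x * yc x ^+ 2) z -
      - prim (fun x => q x * yc x ^+ 2) 0.
    apply: P.
    - move=> x xz; have xT := zI x xz; split; [exact: dy| |exact: df|exact: dfW|].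
        by have := dy' x xT; congr is_derive; ring.
      have ? := prim_is_derive x cqy.
      by deriv; rewrite ycE//; ring.
    - by move=> x /andP[x1 xz]; rewrite -fcE ?gt_eqF// sub// zI// !ltW.
    - exact: regf.
    - exact: regf.
  by move: P l; set u := prim _ 0; set v := prim _ z; lra.
have yT : 0 < y T.
  rewrite ltNge; apply/negP => yT.
  have [|z zT] := @ivt_zero _ yc 0 T (ltW T0) (continuous_subspaceT cy).
    by right; rewrite !ycE// y0 yT ler01.
  rewrite ycE// => yz; have /andP[z1 z2] := zT.
  have z0 : 0 < z.
    rewrite lt_neqAle z1 andbT; apply/eqP => e.
    by move: yz; rewrite -e y0 => /eqP; rewrite oner_eq0.
  by have := key z z0 z2; rewrite yz expr0n !mul0r ltxx => /(_ erefl).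
have := key T T0 (lexx T); rewrite f'T mulr0 => /(_ erefl).
by rewrite pmulr_rgt0.
Qed.

(** Sturm comparison: with the positive eigenfunction xi if y stays nonnegative, otherwise with chi,
    which limits y to a single zero, located beyond [x0]. *)
Let Vp_neg (y y' : R -> R) :
  (forall x : R, 0 <= x <= T -> is_derive x 1 y (y' x)) ->
  (forall x : R, 0 <= x <= T -> is_derive x 1 y' (Vp x * y x)) ->
  y 0 = 1 -> y' 0 = 0 -> y' T < 0.
Proof.
move=> dy dy' y0 y'0.
have cy := clamp_extend (ltW T0) (is_derive_within dy).
set yc := (fun x => _) in cy.
have ycE x : 0 <= x <= T -> yc x = y x by move=> xT; rewrite /yc clamp_id.
have cky : continuous (fun x => k x * yc x ^+ 2) by cont.
pose K := prim (fun x => k x * yc x ^+ 2).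
have Klt a b p : 0 <= a -> a < b -> b <= T -> a <= p <= b -> y p != 0 -> K a < K b.
  move=> a0 ab bT pab yp.
  have I x : a <= x <= b -> 0 <= x <= T.
    by move=> /andP[ax xb]; rewrite (le_trans a0 ax) (le_trans xb).
  apply: (@prim_lt _ _ a b p) => //.
    by move=> x xab; rewrite mulr_ge0 ?sqr_ge0// ltW// k_gt0// I.
  by rewrite mulr_gt0 ?k_gt0 ?I// ycE ?I// exprn_even_gt0.
have ineq a b : 0 <= a -> a <= b -> b <= T -> (x0 <= a) || (b <= x0) ->
    (a != x0 \/ y x0 = 0) -> (b != x0 \/ y x0 = 0) ->
    (y b ^+ 2 * chi' b / chi b - y b * y' b) -
    (y a ^+ 2 * chi' a / chi a - y a * y' a) <= K a - K b.
  move=> a0 ab bT ho ra rb.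
  have -> : K a - K b = - K b - - K a by ring.
  apply: (@chi_picone y y' (fun=> 0) (fun x => - K x)) => // x /andP[ax xb].
  have xT : 0 <= x <= T by rewrite (le_trans a0 ax) (le_trans xb).
  split; [exact: dy|split]; first by rewrite subr0; exact: dy'.
  by have ? := prim_is_derive x cky; rewrite /K; deriv; rewrite ycE//; ring.
(* On [0, z] all end terms vanish, while K is strictly increasing at 0 since y(0) = 1. For z = x0
   the end is regular because y vanishes there. *)
have no_zero z : 0 < z -> z <= x0 -> y z != 0.
  move=> z0 zx0; apply/eqP => yz.
  have /andP[x00 x0T'] := x0T.
  have zT : z <= T by rewrite (le_trans zx0) ?ltW.
  have h1 : (x0 <= 0) || (z <= x0) by rewrite zx0 orbT.
  have r0 : 0 != x0 \/ y x0 = 0 by left; rewrite lt_eqF.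
  have rz : z != x0 \/ y x0 = 0.
    by have [<-|] := eqVneq z x0; [right|left].
  have := ineq 0 z (lexx 0) (ltW z0) zT h1 r0 rz.
  rewrite yz y'0 chi'0 expr0n/= !(mul0r, mulr0) !subrr subr_ge0 leNgt.
  by rewrite (@Klt 0 z 0)// ?lexx ?ltW// y0 oner_eq0.
(* The bracket y xi' - y' xi has derivative kap y xi with kap = m + 6 (f^2 - g^2) > 0; at T it
   equals - y'(T) xi(T), which is therefore positive. *)
have [ypos|] := pselect (forall x, 0 <= x <= T -> 0 <= y x).
  pose xi x := g x ^+ 2 + d.
  pose kap x := (1 - 6 * gc x ^+ 2 + m) - Vp x.
  pose xic x := gc x ^+ 2 + d.
  have ckap : continuous (fun x => kap x * (yc x * xic x)) by rewrite /kap /xic; cont.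
  have kap_gt0 x : 0 <= x <= T -> 0 < kap x.
    move=> xT; rewrite /kap /Vp gcE// fcE ?sub//.
    have [_ +] := close xT; have := ler_norm (- (f x ^+ 2 - g x ^+ 2)).
    by rewrite normrN; lra.
  have dD x : 0 <= x <= T ->
      is_derive x 1 (fun x => y x * (2 * g x * g' x) - y' x * xi x) (kap x * (yc x * xic x)).
    move=> xT; have ? := dy x xT; have ? := dy' x xT; have [? ?] := xiP xT.
    by rewrite /xi; deriv; rewrite /kap /xic gcE// ycE//; ring.
  have := prim_ftc T0 ckap dD; rewrite g'T g'0 y'0 !mulr0 mul0r subrr subr0 sub0r => e.
  have : prim (fun x => kap x * (yc x * xic x)) 0 < prim (fun x => kap x * (yc x * xic x)) T.
    apply: (@prim_lt _ _ 0 T 0) => //.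
      move=> x xT; rewrite mulr_ge0 ?(ltW (kap_gt0 _ xT))// ycE// /xic gcE//.
      by rewrite mulr_ge0 ?ypos// ltW// xi_gt0.
    by rewrite mulr_gt0 ?kap_gt0// ycE// y0 mul1r /xic gcE// xi_gt0.
  rewrite prim0// e oppr_gt0 pmulr_llt0//.
  exact: xi_gt0.
(* Now y(xs) < 0. The zero z of y before xs lies beyond x0, so Picone's inequality on [z, T] gives
   y(T) y'(T) > 0. *)
move=> /existsNP[xs /not_implyP[xsT /negP]]; rewrite -ltNge => yxs.
have /andP[xs0 xsT'] := xsT.
have [|z zxs] := @ivt_zero _ yc 0 xs xs0 (continuous_subspaceT cy).
  by right; rewrite !ycE// y0 (ltW yxs) ler01.
have /andP[z1 z2] := zxs.
have zT : 0 <= z <= T by rewrite z1 (le_trans z2).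
rewrite ycE// => yz.
have z0 : 0 < z.
  rewrite lt_neqAle z1 andbT; apply/eqP => e.
  by move: yz; rewrite -e y0 => /eqP; rewrite oner_eq0.
have x0z : x0 < z.
  by rewrite ltNge; apply/negP => zx0; have := no_zero z z0 zx0; rewrite yz eqxx.
have zxs' : z < xs.
  by rewrite lt_neqAle z2 andbT; apply/eqP => e; move: yxs; rewrite -e yz ltxx.
have zx0 : z != x0 \/ y x0 = 0 by left; rewrite gt_eqF.
have yTy'T : 0 < y T * y' T.
  have rT : T != x0 \/ y x0 = 0 by left; rewrite gt_eqF//; case/andP: x0T.
  have h1 : (x0 <= z) || (T <= x0) by rewrite ltW.
  have zTT : z < T by exact: lt_le_trans xsT'.
  have := ineq z T z1 (ltW zTT) (lexx T) h1 zx0 rT.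
  rewrite yz chi'T expr0n/= !(mul0r, mulr0, subr0, sub0r) => i.
  have : K z < K T by apply: (@Klt z T xs) => //; [rewrite ltW|rewrite lt_eqF].
  by move: i; lra.
(* Otherwise y has a second zero w after xs, and Picone's inequality on [z, w], where all end terms
   vanish, is contradicted by K z < K w. *)
have yT : y T < 0.
  rewrite ltNge; apply/negP => yT.
  have [|w xsw] := @ivt_zero _ yc xs T xsT' (continuous_subspaceT cy).
    by left; rewrite !ycE// yT ltW.
  have /andP[w1 w2] := xsw.
  have wT : 0 <= w <= T by rewrite (le_trans xs0 w1).
  rewrite ycE// => yw.
  have zw : z < w by exact: lt_le_trans w1.
  have rw : w != x0 \/ y x0 = 0 by left; rewrite gt_eqF// (lt_trans x0z).
  have h1 : (x0 <= z) || (w <= x0) by rewrite ltW.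
  have := ineq z w z1 (ltW zw) w2 h1 zx0 rw.
  rewrite yz yw expr0n/= !(mul0r, mulr0) !subrr subr_ge0 leNgt.
  by rewrite (@Klt z w xs)//; [rewrite w1 ltW|rewrite lt_eqF].
by rewrite -(nmulr_rgt0 _ yT).
Qed.

Theorem perturbed_wave_instability : exists lam : R[i],
  [/\ is_eigenvalue T f lam, 0 < complex.Re lam, complex.Im lam = 0,
    algebraic_multiplicity T f lam 1 &
    forall mu : R[i], is_eigenvalue T f mu -> 0 < complex.Re mu -> mu = lam].
Proof.
apply: (@single_real_unstable_eigenvalue _ T M x0 f Vp Vm) => //.
- by have /andP[l r] := fc2 0; rewrite /M addr_ge0// mulr_ge0// (le_trans l).
- by move=> x; rewrite in_itv/= => xT; rewrite /Vp fcE.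
- by move=> x; rewrite in_itv/= => xT; rewrite /Vm fcE.
- by move=> x; rewrite /Vp fc_even.
- by move=> x; rewrite /Vm fc_even.
Qed.

End perturbed_wave.

(** * The wave family *)

Section wave_facts.
Local Open Scope complex_scope.
Context {R : realType}.
Implicit Types a h : R.

(** The lower bound gives 2 a^2 > 1, so the square root is genuine and kappa^2 = (2 a^2 - 1) / a^2,
    which is below 1 exactly when a^2 < 1. *)
Lemma modulus_bounds a : 1 / Num.sqrt 2 < a < 1 -> 0 < a /\ modulus a ^+ 2 < 1.
Proof.
move=> /andP[a1 a2].
have s2 : 0 < Num.sqrt 2 :> R by rewrite sqrtr_gt0.
have a0 : 0 < a by apply: lt_trans a1; rewrite divr_gt0.
split=> //; rewrite /modulus expr_div_n ltr_pdivrMr ?exprn_gt0// mul1r.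
have h : 1 < 2 * a ^+ 2.
  have : 1 < a * Num.sqrt 2 by rewrite -ltr_pdivrMr.
  rewrite -(ltr_pXn2r (n := 2))// ?nnegrE// ?mulr_ge0 ?ltW//.
  by rewrite expr1n exprMn sqr_sqrtr// mulrC.
rewrite sqr_sqrtr; last by lra.
by have : a ^+ 2 < 1 by [rewrite expr_lt1// ltW]; lra.
Qed.

Lemma elliptic_radicand_gt0 (k x : R) : k ^+ 2 < 1 -> 0 < 1 - k ^+ 2 * sin x ^+ 2.
Proof.
move=> k1; rewrite subr_gt0; apply: le_lt_trans k1.
rewrite ler_piMr ?sqr_ge0// -(cos2Dsin2 x) lerDr; exact: sqr_ge0.
Qed.

Lemma elliptic_integrand_cont (k : R) : k ^+ 2 < 1 -> continuous (elliptic_integrand k).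
Proof.
move=> k1.
have cs : continuous (@sin R) by exact: continuous_sin.
have c : continuous (fun t : R => 1 - k ^+ 2 * sin t ^+ 2) by cont.
have cr : continuous (fun t : R => Num.sqrt (1 - k ^+ 2 * sin t ^+ 2)).
  exact: (cont_comp c (@sqrt_continuous R)).
move=> x; apply: (continuousV _ (cr x)).
by rewrite gt_eqF// sqrtr_gt0 elliptic_radicand_gt0.
Qed.

Lemma half_period_gt0 a : 1 / Num.sqrt 2 < a < 1 -> 0 < half_period a.
Proof.
move=> /modulus_bounds[a0 k1]; rewrite /half_period divr_gt0//.
have pi2 : 0 < pi / 2 :> R by rewrite divr_gt0// pi_gt0.
have ci := elliptic_integrand_cont k1.
rewrite /ellipticK /ellipticF [X in _ - X](_ : _ = 0); last first.
  by rewrite set_itv_ge ?Rintegral_set0// bnd_simp -ltNge.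
rewrite subr0 integral_prim//; last exact: ltW.
rewrite subr_gt0; apply: (@prim_lt _ _ 0 (pi / 2) 0) => //.
- by rewrite lexx ltW.
- by move=> x _; rewrite /elliptic_integrand invr_ge0 sqrtr_ge0.
- by rewrite /elliptic_integrand invr_gt0 sqrtr_gt0 elliptic_radicand_gt0.
Qed.

(** The radicand of dn is positive for every amplitude, as kappa^2 < 1. *)
Lemma wave0_gt0 a x : 1 / Num.sqrt 2 < a < 1 -> 0 < wave0 a x.
Proof.
move=> /modulus_bounds[a0 k1]; rewrite /wave0 mulr_gt0// /jacobi_dn sqrtr_gt0.
exact: elliptic_radicand_gt0.
Qed.

Lemma profile_equation_derive h (f : R -> R) : profile_equation h f ->
  (forall x : R, is_derive x 1 f (derive1 f x)) /\
  (forall x : R, is_derive x 1 (derive1 f) (f x - 2 * f x ^+ 3 - h)).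
Proof.
move=> fP; split=> x; have [d1 d2 e] := fP x.
  by apply: DeriveDef => //; rewrite derive1E.
by apply: DeriveDef => //; rewrite -derive1E; move: e; lra.
Qed.

(** Joint continuity at the points (0, x), made uniform in x by compactness of [0, T]. *)
Lemma smooth_near0 (T : R) (phi : R -> R -> R) (d e : R) : 0 < d ->
  smooth [set p : R * R | `|p.1| < d] (fun p => phi p.1 p.2) -> 0 < e ->
  \forall h \near (0 : R), forall x, 0 <= x <= T -> `|phi h x - phi 0 x| < e.
Proof.
move=> d0 /(_ 0%N) /= cphi e0.
have cpt : compact `[0 : R, T] by exact: segment_compact.
have := (compact_near_coveringP _).1 cpt R (nbhs (0 : R))
  (fun h x => `|phi h x - phi 0 x| < e) _.
have loc x : `[0, T]%classic x ->
    \forall x' \near x & h \near (0 : R), `|phi h x' - phi 0 x'| < e.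
  move=> _; have p0 : `|((0 : R), x).1| < d by rewrite /= normr0.
  have /cvgrPdist_lt/(_ (e / 2)) := cphi _ p0; rewrite divr_gt0// => /(_ isT) /=.
  move=> [[P Q] /= [nP nQ] PQ]; exists (Q, P) => //= -[x' h] /= [Qx' Ph].
  have h1 := PQ (h, x') (conj Ph Qx'); have h2 := PQ (0, x') (conj (nbhs_singleton nP) Qx').
  rewrite /= in h1 h2.
  have -> : phi h x' - phi 0 x' = (phi 0 x - phi 0 x') - (phi 0 x - phi h x') by ring.
  by apply: le_lt_trans (ler_normB _ _) _; lra.
move=> /(_ _ loc); apply: filterS => h hP x xT.
by apply: hP; rewrite /= in_itv/=.
Qed.

Lemma profile_stationary (T h : R) (f : R -> R) : profile_equation h f ->
  (forall x, f (x + 2 * T) = f x) -> periodic_stationary_solution T h f.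
Proof.
move=> fP per; split=> // t x; have [d1 d2 e] := fP x.
have c0 (z : R) : derivable (fun _ : R => z) x 1 by exact: derivable_cst.
have c0t (z : R) : derivable (fun _ : R => z) t 1 by exact: derivable_cst.
have e1 : Cderive (fun y => (f y)%:C) = (fun y => (derive1 f y)%:C).
  by apply/funext => y; rewrite /Cderive/= derive1_cst.
split.
- by split=> /=; exact: c0t.
- by split=> /=.
- by rewrite e1; split=> /=.
- rewrite e1 /Cderive/= !derive1_cst mulr0 add0r sqr_normc.
  move: e; move: (derive1 (derive1 f) x) (f x) => p q e.
  have -> : h = - (p - q + 2 * q ^+ 3) by rewrite e opprK.
  by simpc; congr (_ +i* _); ring.
Qed.

End wave_facts.

Theorem proposition2 (R : realType) (a : R) (ha : 1 / Num.sqrt 2 < a < 1)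
  (phi : R -> R -> R) (hphi : wave_family a phi) :
  exists h0 : R, 0 < h0 /\
    forall h : R, 0 < h < h0 ->
      [/\ periodic_stationary_solution (half_period a) h (phi h),
          spectrally_unstable (half_period a) (phi h) &
          exists lam : R[i],
            [/\ is_eigenvalue (half_period a) (phi h) lam,
                0 < complex.Re lam,
                complex.Im lam = 0,
                algebraic_multiplicity (half_period a) (phi h) lam 1 &
                forall mu : R[i], is_eigenvalue (half_period a) (phi h) mu ->
                  0 < complex.Re mu -> mu = lam]].
Proof.
have T0 := half_period_gt0 ha; set T := half_period a in T0 *.
have [d [d0 fam sm p0]] := hphi; rewrite -/T in fam.
have z : `|(0 : R)| < d by rewrite normr0.
have [pe0 ev0 per0 dec0] := fam 0 z.
have [dg dg'] := profile_equation_derive pe0.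
have gT : 0 < phi 0 T by rewrite p0 wave0_gt0.
have [c [c' [n [m [x0 [n0 m0 x0T gx0 [chiP xiP xi_gt0 g_gt0 g'_lt0]]]]]]] :=
  ground_state_data T0 dg dg' ev0 per0 dec0 gT.
have g0 : 0 < phi 0 0 by apply: g_gt0; rewrite lexx ltW.
(* From |f + g| <= |f - g| + 2 g <= 1 + 2 phi_0(0), the bound |f - g| < e implies 6 |f^2 - g^2| < e
   r. *)
pose r := 6 * (2 * phi 0 0 + 1).
have r0 : 0 < r by rewrite mulr_gt0// addr_gt0// mulr_gt0.
(* The bound 1 serves the estimate of |f + g|, [phi 0 T] keeps phi_h(T) positive, and the last two
   give e r <= n and e r <= m. *)
pose e := Num.min (Num.min 1 (phi 0 T)) (Num.min (n / r) (m / r)).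
have e0 : 0 < e by rewrite !lt_min ltr01 gT !divr_gt0.
have [e1 eT en em] : [/\ e <= 1, e <= phi 0 T, e * r <= n & e * r <= m].
  by split; rewrite -?ler_pdivlMr// /e !ge_min lexx ?orbT.
have /nbhs_ballP[d1 /= d10 near0] := smooth_near0 T d0 sm e0.
exists (Num.min d d1); split; first by rewrite lt_min d0.
move=> h /andP[h0]; rewrite lt_min => /andP[hd hd1].
have nh : `|h| < d by rewrite gtr0_norm.
have [pe ev per dec] := fam h nh.
have [df df'] := profile_equation_derive pe.
have close1 x : 0 <= x <= T -> `|phi h x - phi 0 x| < e.
  by apply: near0; rewrite /ball/= sub0r normrN gtr0_norm.
have TT : 0 <= T <= T by rewrite lexx ltW.
have fT : 0 < phi h T.
  by have := close1 T TT; rewrite ltr_norml => /andP[l _]; move: l eT; lra.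
have close x : 0 <= x <= T ->
    6 * `|phi h x ^+ 2 - phi 0 x ^+ 2| < n /\ 6 * `|phi h x ^+ 2 - phi 0 x ^+ 2| < m.
  move=> xT; suff : 6 * `|phi h x ^+ 2 - phi 0 x ^+ 2| < e * r.
    by move=> l; split; apply: lt_le_trans l _.
  have xI : - T <= x <= T by case/andP: xT => x1 ->; rewrite andbT; move: x1 T0; lra.
  have /andP[_ gx] := profile_bounds T0 ev0 dec0 xI.
  have cx := close1 x xT; have gx' := g_gt0 x xT.
  have s : `|phi h x + phi 0 x| <= 2 * phi 0 0 + 1.
    have -> : phi h x + phi 0 x = (phi h x - phi 0 x) + 2 * phi 0 x by ring.
    apply: le_trans (ler_normD _ _) _; rewrite [`|2 * _|]gtr0_norm ?mulr_gt0//.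
    by move: cx e1 gx; lra.
  have -> : e * r = 6 * (e * (2 * phi 0 0 + 1)) by rewrite /r; ring.
  rewrite ltr_pM2l// subr_sqr normrM.
  apply: le_lt_trans (ler_wpM2l (normr_ge0 _) s) _.
  by rewrite ltr_pM2r// addr_gt0// mulr_gt0.
have [lam H] := @perturbed_wave_instability _ T h (phi h) _ (phi 0) _ T0 h0 df df' ev per dec
  fT c c' n m x0 x0T gx0 (profile_cont dg) (profile_deriv0 dg ev0)
  (profile_derivT dg ev0 per0) chiP xiP xi_gt0 g_gt0 g'_lt0 close.
have [lam1 lam2 _ _ _] := H.
split; [exact: profile_stationary| |by exists lam].
by apply; exists lam.
Qed.
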